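(* Let $z\in\mathcal F_\infty$ and let $\nu=\nu(z)$. Then $\nu^T\le\nu$ in the dominance order. If $\nu^T=\nu$ then $\hat F^{\mathrm{FPF}}_z=s_\nu$. Otherwise $\hat F^{\mathrm{FPF}}_z\in s_{\nu^T}+s_\nu+\mathbb N\text{-span}\{s_\lambda:\nu^T<\lambda<\nu\}$, where $<$ is dominance order and $s_\lambda$ denotes the Schur function.
   Context: Let $S_\mathbb{Z}$ be the group of permutations of $\mathbb{Z}$ with finite support, and let $S_\infty$ be the subgroup of those with support in $\mathbb P=\{1,2,\dots\}$. Let $s_i=(i,i+1)$ and let $\ell(w)$ be the number of inversions of $w$. Let $\Theta(i)=i-(-1)^i$, and let $\mathcal F_\infty=\{w^{-1}\Theta w:w\in S_\infty\}$. For $z\in\mathcal F_\infty$, let $\mathcal{A}_{\mathrm{FPF}}(z)$ be the set of $w\in S_\mathbb{Z}$ of minimal length with $z=w^{-1}\Theta w$. For $w\in S_\mathbb Z$, the Stanley symmetric function is $F_w=\sum_{(a_1,\dots,a_\ell)}\sum x_{i_1}\cdots x_{i_\ell}$. The outer sum is over reduced words $w=s_{a_1}\cdots s_{a_\ell}$. The inner sum is over positive integers $i_1\le\cdots\le i_\ell$ with $i_j<i_{j+1}$ whenever $a_j<a_{j+1}$. Define $\hat F^{\mathrm{FPF}}_z=\sum_{w\in\mathcal A_{\mathrm{FPF}}(z)}F_w$. The FPF-involution code of $z\in\mathcal F_\infty$ is $\hat c_{\mathrm{FPF}}(z)=(c_1,c_2,\dots)$, where $c_i$ is the number of $j\in\mathbb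 P$ with $j<i<z(j)$ and $j<z(i)$. Define $\nu(z)$ to be the transpose of the partition obtained by sorting $\hat c_{\mathrm{FPF}}(z)$ into weakly decreasing order. $\lambda^T$ denotes the transpose (conjugate) of a partition $\lambda$. *)

(* Defs.v *)
From HB Require Import structures.
From mathcomp Require Import all_boot all_order all_algebra.
From Stdlib Require Import ClassicalEpsilon.
Set Implicit Arguments. Unset Strict Implicit. Unset Printing Implicit Defensive.
Import Order.TTheory GRing.Theory Num.Theory.
Local Open Scope ring_scope.

(* Cardinality of a (finite) predicate: the size of a duplicate-free list
   enumerating exactly the elements satisfying P.  (Meaningless if P is
   infinite; only applied to finite sets below.) *)
Definition fcard (T : eqType) (P : T -> Prop) : nat :=
  size (epsilon (inhabits [::]) (fun s : seq T => uniq s /\ forall x, P x <-> x \in s)).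

Definition in_SZ (w : int -> int) : Prop :=
  bijective w /\ exists N : nat, forall i : int, (i < - (N%:Z)) \/ (N%:Z < i) -> w i = i.

Definition in_Sinf (w : int -> int) : Prop :=
  in_SZ w /\ forall i : int, i <= 0 -> w i = i.

Definition s_ (k : int) (j : int) : int :=
  if j == k then k + 1 else if j == k + 1 then k else j.

Definition word_perm (a : seq int) : int -> int :=
  foldr (fun k f => s_ k \o f) id a.

Definition inv_len (w : int -> int) : nat :=
  fcard (fun p : int * int => p.1 < p.2 /\ w p.2 < w p.1).

Definition reduced_word (w : int -> int) (a : seq int) : Prop :=
  (forall j, w j = word_perm a j) /\ size a = inv_len w.

Definition Theta (i : int) : int := if odd `|i|%N then i + 1 else i - 1.

(* z = w^{-1} Theta w, written as w o z = Theta o w *)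
Definition fpf_conj (w z : int -> int) : Prop := forall i, w (z i) = Theta (w i).

Definition in_Finf (z : int -> int) : Prop := exists w, in_Sinf w /\ fpf_conj w z.

Definition in_AFPF (z w : int -> int) : Prop :=
  [/\ in_SZ w, fpf_conj w z &
      forall w', in_SZ w' -> fpf_conj w' z -> (inv_len w <= inv_len w')%N].

(* A monomial x_1^{al_0} x_2^{al_1} ... is encoded by al : seq nat
   (exponents beyond size al are 0). *)

(* Coefficient of x^al in \hat F^FPF_z = sum_{w in A_FPF(z)} F_w :
   number of pairs (a, i) with a a reduced word of some w in A_FPF(z)
   (a determines w) and i a compatible sequence of content al. *)
Definition hatF_coeff (z : int -> int) (al : seq nat) : nat :=
  fcard (fun p : seq int * seq nat =>
    (exists w, in_AFPF z w /\ reduced_word w p.1) /\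
    size p.2 = size p.1 /\
    all (fun k => (0 < k)%N) p.2 /\
    sorted leq p.2 /\
    (forall j : nat, (j.+1 < size p.1)%N -> nth 0 p.1 j < nth 0 p.1 j.+1 ->
        (nth 0%N p.2 j < nth 0%N p.2 j.+1)%N) /\
    (forall k : nat, count_mem k.+1 p.2 = nth 0%N al k)).

Definition is_partition (la : seq nat) : bool :=
  sorted geq la && all (fun p => (0 < p)%N) la.

Definition conjp (la : seq nat) : seq nat :=
  mkseq (fun k => count (fun p => (k < p)%N) la) (foldr maxn 0%N la).

Definition dom_le (la mu : seq nat) : Prop :=
  sumn la = sumn mu /\ forall k, (sumn (take k la) <= sumn (take k mu))%N.

Definition dom_lt (la mu : seq nat) : Prop := dom_le la mu /\ la <> mu.

Definition is_ssyt (la : seq nat) (T : seq (seq nat)) : Prop :=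
  [/\ [seq size r | r <- T] = la,
      all (all (fun e => (0 < e)%N)) T,
      all (sorted leq) T &
      forall r c : nat, (r.+1 < size T)%N -> (c < size (nth [::] T r.+1))%N ->
        (nth 0%N (nth [::] T r) c < nth 0%N (nth [::] T r.+1) c)%N].

Definition schur_coeff (la : seq nat) (al : seq nat) : nat :=
  fcard (fun T : seq (seq nat) =>
    is_ssyt la T /\ forall k : nat, count_mem k.+1 (flatten T) = nth 0%N al k).

Definition fpf_code (z : int -> int) (i : int) : nat :=
  fcard (fun j : int => [/\ 0 < j, j < i, i < z j & j < z i]).

Definition code_bound (z : int -> int) : nat :=
  epsilon (inhabits 0%N) (fun n => forall i : nat, (n < i)%N -> fpf_code z i%:Z = 0%N).

Definition code_seq (z : int -> int) : seq nat :=
  [seq fpf_code z i%:Z | i <- iota 1 (code_bound z)].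

Definition nu (z : int -> int) : seq nat :=
  conjp (sort geq (filter (fun k => (0 < k)%N) (code_seq z))).

(* Main.v *)
Require Import Defs.
From HB Require Import structures.
From mathcomp Require Import all_boot all_order all_algebra all_fingroup.
From mathcomp Require Import zify.
From Stdlib Require Import ClassicalEpsilon FunctionalExtensionality.
Set Implicit Arguments. Unset Strict Implicit. Unset Printing Implicit Defensive.
Import Order.TTheory GRing.Theory Num.Theory.
Local Open Scope ring_scope.

(** Choose K so that z agrees with Theta outside {1, ..., 2K+2}.  The adjacent
    transpositions of this window act on fixed-point-free involutions by
    conjugation; let u_c be the operator that conjugates by the c-th one when
    this moves away from Theta and is 0 otherwise.  The u_c satisfy the
    nilCoxeter relations, and a word is a reduced word of an atom of z exactly
    when the corresponding monomial has (Theta, z)-entry 1.  So the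
    coefficients of F^FPF_z are entries of products of the elements
    h_r(u), the sums of strictly decreasing monomials of degree r.

    The h_r commute, so Jacobi-Trudi determinants define elements s_la(u) with
    the Pieri rules, and F^FPF_z = sum_la c_la s_la, with c_la the entry of
    s_la(u).  By the Fomin-Greene argument s_la(u) is a sum of monomials, hence
    c_la >= 0.  Moreover u_0, u_2, u_4, ... kill Theta, while u_(2k+1) u_(2k)
    and u_(2k+1) u_(2k+2) agree on it; this makes products of the h_r and
    products of the e_r have the same entries.

    If a reduced word of an atom w is cut into strictly increasing blocks, then
    its last t blocks have total length at most sum_i min(t, c_i(w)), with c(w)
    the code of w.  Among the atoms of z these sums are maximal exactly for the
    atom that lists the opening points in increasing order, whose code is the
    FPF-involution code; so they are bounded by the partial sums of nu, and
    block lengths nu occur for exactly one word.  Applied to both expansions of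
    the products this gives la <= nu and la^T <= nu whenever c_la <> 0, and
    coefficient 1 for la = nu and la^T = nu. *)

(** * Bicommutants *)

(** Two families are needed because the definition of F^FPF_z speaks of decreasing monomials, hence
    of the h_r, whereas codes bound the lengths of increasing blocks, hence speak about the e_r. A
    shape la with c_la nonzero occurs in the product of the h_r over its rows and in the product of
    the e_r over its columns. As no c_la is negative, nothing cancels it there, so both products
    have a nonzero entry and both bounds on block lengths reach la. Positivity thus serves the
    dominance statements as well as the last clause. Everything is kept finite: shapes live in a box
    with d + 1 rows and b columns. Here d is the degree, so that the last row stays empty, and b is
    so large that the h_p met at the right edge of the box vanish. The operators are integer
    matrices indexed by all permutations of the window; their relations come from those of
    conjugation, and only the entry at (Theta, z) is interpreted. *)

(* The bicommutant of a commuting family is a commutative ring containing it, so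
   that determinants in the family make sense. *)
Section Bicommutant.
Variables (A : nzRingType) (I : Type) (h : I -> A).

Definition bicomm_pred : {pred A} := fun x =>
  if excluded_middle_informative
       (forall y, (forall p, GRing.comm y (h p)) -> GRing.comm x y)
  then true else false.

Lemma bicommP x :
  reflect (forall y, (forall p, GRing.comm y (h p)) -> GRing.comm x y)
          (x \in bicomm_pred).
Proof. by rewrite unfold_in; case: excluded_middle_informative => H; constructor. Qed.

Fact bicomm_subring : subring_closed bicomm_pred.
Proof.
split=> [|x y /bicommP cx /bicommP cy|x y /bicommP cx /bicommP cy]; apply/bicommP => t ct.
- exact/commr_sym/commr1.
- by apply/commr_sym/commrB; apply/commr_sym; [exact: cx|exact: cy].
- by apply/commr_sym/commrM; apply/commr_sym; [exact: cx|exact: cy].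
Qed.
HB.instance Definition _ := GRing.isSubringClosed.Build A bicomm_pred bicomm_subring.

Definition commuting := forall p q, GRing.comm (h p) (h q).
(** The commutation proof is a parameter of the type, so that the commutative ring structure can be
    inferred from the type alone. *)
Record bicommutant (hC : commuting) := Bicommutant {
  bicomm_val :> A; _ : bicomm_val \in bicomm_pred }.
Variable hC : commuting.
HB.instance Definition _ := [isSub for @bicomm_val hC].
HB.instance Definition _ := [Choice of bicommutant hC by <:].
HB.instance Definition _ := [SubChoice_isSubNzRing of bicommutant hC by <:].

Lemma bicommutant_mulC : commutative (@GRing.mul (bicommutant hC)).
Proof.
move=> [x cx] [y cy]; apply: val_inj => /=.
move/bicommP: (cx) => -> // p; apply/(bicommP _ cy) => q; exact: hC.
Qed.
HB.instance Definition _ :=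
  GRing.PzRing_hasCommutativeMul.Build (bicommutant hC) bicommutant_mulC.
End Bicommutant.

(** * The Pieri rule for Jacobi-Trudi determinants *)

Section Shapes.
Local Open Scope nat_scope.
Variables d b : nat.
Implicit Types (l m : {ffun 'I_d.+1 -> 'I_b.+1}) (i j : 'I_d.+1).

(** A virtual row of full width b lies above the first row, which is therefore bounded by the box
    only. *)
Definition row_above l i : nat := if i == ord0 then b else l (inord i.-1).
Definition hstrip m l := [forall i, m i <= l i <= row_above m i].
Definition is_part l := [forall i, l i <= row_above l i].
Definition weight l : nat := \sum_i l i.

Lemma row_above_succ l i (k : nat) : i = k.+1 :> nat -> row_above l i = l (inord k).
Proof. by move=> ik; rewrite /row_above -val_eqE /= ik. Qed.

Lemma is_part_le l i j : is_part l -> i <= j -> l j <= l i.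
Proof.
move=> /forallP lp; elim: {j}(j : nat) {-2}j (erefl (j : nat)) => [|k IH] j jk.
  by rewrite jk leqn0 => /eqP i0; rewrite (_ : i = j) //; apply: val_inj; rewrite /= i0 jk.
rewrite leq_eqVlt => /predU1P[/val_inj -> //|]; rewrite jk ltnS => ik.
apply: leq_trans (lp j) _; rewrite (row_above_succ _ jk).
by apply: IH; rewrite inordK // -ltnS -jk ltnW // ltnS.
Qed.

Lemma hstrip_part m l : is_part m -> hstrip m l -> is_part l.
Proof.
move=> mp /forallP h; apply/forallP => i; have /andP[_ li] := h i.
apply: leq_trans li _; rewrite /row_above; case: ifP => // _.
by have /andP[] := h (inord i.-1).
Qed.

Lemma hstrip_le m l i : hstrip m l -> m i <= l i.
Proof. by move=> /forallP/(_ i)/andP[]. Qed.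
End Shapes.

Section HPieri.
Variables (R : comNzRingType) (d b : nat) (h : int -> R) (t : R).
Implicit Types (l m : {ffun 'I_d.+1 -> 'I_b.+1}).

Definition sdet l := \det (\matrix_(i < d.+1, j < d.+1) h ((l i)%:Z - i%:Z + j%:Z)).

Lemma sum_bidiag (c : R) (F : 'I_d.+1 -> R) (i : 'I_d.+1) :
  \sum_k ((k == i)%:R + c *+ (k.+1 == i :> nat)) * F k =
  F i + (if i == ord0 then 0 else c * F (inord i.-1)).
Proof.
transitivity (\sum_k ((if k == i then F k else 0) + (if k.+1 == i :> nat then c * F k else 0))).
  apply: eq_bigr => k _; rewrite mulrDl; congr (_ + _).
    by case: eqP; rewrite ?mul1r ?mul0r.
  by case: eqP; rewrite ?mulr1n ?mulr0n ?mul0r.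
rewrite big_split /= -!big_mkcond /= big_pred1_eq; congr (_ + _).
case: eqP => [->|i0]; first by rewrite big1.
rewrite (big_pred1 (inord i.-1)) // => k /=; rewrite -val_eqE /= inordK ?(leq_ltn_trans (leq_pred i)) //.
by case: i i0 => -[|i] i1 //= i0; case: i0; apply: val_inj.
Qed.

Hypothesis h0 : h 0 = 1.
Hypothesis hneg : forall p : int, (p < 0)%R -> h p = 0.
Hypothesis hbig : forall p : int, (b%:Z - d%:Z <= p)%R -> h p = 0.

(** By multilinearity the sum over strips is one determinant whose rows are truncated series.
    Unitriangular row operations undo the truncation; unitriangular column operations then restore
    the Jacobi-Trudi entries, except in the last column, which yields the factor on the right. *)
Lemma hpieri_gen m : is_part m -> m ord_max = ord0 ->
  \sum_(l | hstrip m l) t ^+ (\sum_i (l i - m i))%N * sdet l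
  = (\sum_(0 <= k < b.+1) t ^+ k * h k%:Z) * sdet m.
Proof.
move=> mp m0.
pose G := \matrix_(i < d.+1, j < d.+1) \sum_(m i <= k < b.+1) t ^+ (k - m i)%N * h (k%:Z - i%:Z + j%:Z).
pose Rw := \matrix_(i < d.+1, j < d.+1)
  \sum_(k < b.+1 | (m i <= k <= row_above m i)%N) t ^+ (k - m i)%N * h (k%:Z - i%:Z + j%:Z).
pose c (i : 'I_d.+1) := - t ^+ (m (inord i.-1) - m i)%N.+1.
pose L := \matrix_(i < d.+1, k < d.+1) ((k == i)%:R + c i *+ (k.+1 == i :> nat)).
pose U := \matrix_(k < d.+1, j < d.+1) ((k == j)%:R - t *+ (k == j.+1 :> nat)).
have detL : \det L = 1.
  rewrite det_trig; last first.
    apply/is_trig_mxP => i j ij; rewrite mxE.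
    by rewrite -val_eqE /= !gtn_eqF ?mulr0n ?addr0 // (leq_trans ij).
  by apply: big1 => i _; rewrite mxE eqxx gtn_eqF ?mulr0n ?addr0.
have detU : \det U = 1.
  rewrite det_trig; last first.
    apply/is_trig_mxP => i j ij; rewrite mxE.
    by rewrite -val_eqE /= !ltn_eqF ?mulr0n ?subr0 // (leq_trans ij).
  by apply: big1 => i _; rewrite mxE eqxx ltn_eqF ?mulr0n ?subr0.
have -> : \sum_(l | hstrip m l) t ^+ (\sum_i (l i - m i))%N * sdet l = \det Rw.
  rewrite /determinant.
  under [RHS]eq_bigr => s _.
    under eq_bigr => i _ do rewrite mxE.
    rewrite bigA_distr_big_dep big_distrr /=.
    over.
  rewrite exchange_big /=; apply: eq_big => [l|l _].
    by apply/forallP/familyP.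
  rewrite /sdet /determinant big_distrr /=; apply: eq_bigr => s _.
  rewrite mulrCA; congr (_ * _); rewrite expr_sum -big_split /=.
  by apply: eq_bigr => i _; rewrite mxE.
(* Past the row above, the series in row i is, after a shift of k by one, a power of t times row i-1
   of [G]; the surplus term at k = b vanishes by [hbig]. *)
have -> : Rw = L *m G.
  apply/matrixP => i j; rewrite [RHS]mxE; under eq_bigr do rewrite mxE.
  rewrite sum_bidiag !mxE.
  have -> : \sum_(k < b.+1 | (m i <= k <= row_above m i)%N) t ^+ (k - m i)%N * h (k%:Z - i%:Z + j%:Z)
     = \sum_(m i <= k < (row_above m i).+1) t ^+ (k - m i)%N * h (k%:Z - i%:Z + j%:Z).
    have le1 : (row_above m i <= b)%N by rewrite /row_above; case: ifP => // _; rewrite -ltnS.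
    rewrite (@big_nat_widen _ _ _ _ _ b.+1) // (@big_nat_widenl _ _ _ _ 0) // big_mkord.
    by apply: eq_bigl => k; rewrite ltnS andbC.
  have [i0|i0] := eqVneq i ord0; first by rewrite addr0 /row_above i0 eqxx.
  have [k ik] : exists k, i = k.+1 :> nat by case: i i0 => -[|k] // ? _; exists k.
  have le2 := forallP mp i.
  rewrite (row_above_succ _ ik) in le2 *.
  have i1k : inord i.-1 = inord k :> 'I_d.+1 by rewrite ik.
  rewrite [X in _ = X + _](@big_cat_nat _ _ _ (m (inord k)).+1) //=; last exact: leqW.
  rewrite -[LHS]addr0 -addrA; congr (_ + _).
  rewrite /c i1k big_distrr /= [X in _ = _ + X]big_nat_recr /=; last by rewrite -ltnS.
  rewrite (hbig _); last by have := ltn_ord i; have := ltn_ord j => ? ?; rewrite inordK; lia.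
  rewrite !mulr0 addr0 big_add1 /= -big_split /= big_nat big1 // => q /andP[q1 q2].
  rewrite inordK; last by move: (ltn_ord i); lia.
  rewrite mulrA mulNr -exprD (_ : (q.+1%:Z - i%:Z + j%:Z = q%:Z - k%:Z + j%:Z)%R); last lia.
  by rewrite (_ : (_.+1 + _ = q.+1 - m i)%N) ?mulNr ?subrr //; lia.
rewrite det_mulmx detL mul1r -[\det G]mulr1 -detU -det_mulmx.
(* Subtracting t times the next column telescopes each series to its first term; the last column has
   no next one. *)
pose N := \matrix_(i < d.+1, j < d.+1) (if j == ord_max then G i j else h ((m i)%:Z - i%:Z + j%:Z)).
have -> : G *m U = N.
  apply/matrixP => i j; rewrite !mxE.
  have -> : \sum_j0 G i j0 * U j0 j = G i j - (if j == ord_max then 0 else t * G i (inord j.+1)).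
    transitivity (\sum_k ((if k == j then G i k else 0) - (if k == j.+1 :> nat then t * G i k else 0))).
      apply: eq_bigr => k _; rewrite (_ : U k j = (k == j)%:R - t *+ (k == j.+1 :> nat)) ?[LHS]mxE // mulrBr; congr (_ - _).
        by case: eqP; rewrite ?mulr1 ?mulr0.
      by case: eqP; rewrite ?mulr1n ?mulr0n ?mulr0 // mulrC.
    rewrite sumrB -!big_mkcond /= big_pred1_eq; congr (_ - _).
    case: eqP => [->|/eqP jm]; first by rewrite big1 // => k /eqP kd; move: (ltn_ord k); rewrite kd /= ltnn.
    have jd : (j.+1 < d.+1)%N by rewrite ltn_neqAle ltn_ord -val_eqE /= in jm *; rewrite eqSS jm.
    by rewrite (big_pred1 (inord j.+1)) // => k /=; rewrite -val_eqE /= inordK.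
  rewrite !mxE; case: eqP => [_|/eqP jm]; first by rewrite subr0.
  have jd : (j.+1 < d.+1)%N by rewrite ltn_neqAle ltn_ord -val_eqE /= in jm *; rewrite eqSS jm.
  rewrite inordK // big_ltn // subnn expr0 mul1r big_distrr /= [in X in _ - X]big_nat_recr /=; last by rewrite -ltnS.
  rewrite (hbig (p := (b%:Z - i%:Z + j.+1%:Z)%R)); last by move: (ltn_ord i); lia.
  rewrite !mulr0 addr0 big_add1 /= -addrA -sumrB big_nat big1 ?addr0 // => q /andP[q1 q2].
  rewrite mulrA -exprS (_ : (q.+1%:Z - i%:Z + j%:Z = q%:Z - i%:Z + j.+1%:Z)%R); last lia.
  by rewrite subSn // subrr.
(* Since m ends in 0, the last rows of both matrices vanish left of the corner. There [N] has the
   whole series of the h_k and the Jacobi-Trudi matrix has h 0 = 1. *)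
rewrite /sdet !(expand_det_row _ ord_max) big_distrr /=; apply: eq_bigr => j _.
rewrite !mxE m0 /=.
have [jm|jm] := eqVneq j ord_max; last first.
  rewrite hneg ?mul0r ?mulr0 //.
  by have:= ltn_ord j; move: jm; rewrite -val_eqE /=; lia.
rewrite jm /= [0 - _ + _]addrNK h0 mul1r; congr (_ * _).
  by apply: eq_bigr => k _; rewrite subn0; congr (_ * h _); lia.
rewrite /cofactor; congr (_ * \det _); apply/matrixP => i k; rewrite !mxE.
by rewrite eq_sym (negPf (neq_lift _ _)).
Qed.
End HPieri.

Section HPieriCoef.
Variables (R : comNzRingType) (d b : nat) (h : int -> R).
Implicit Types (l m : {ffun 'I_d.+1 -> 'I_b.+1}).
Hypothesis h0 : h 0 = 1.
Hypothesis hneg : forall p : int, (p < 0)%R -> h p = 0.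
Hypothesis hbig : forall p : int, (b%:Z - d%:Z <= p)%R -> h p = 0.

Lemma hstrip_weight m l :
  hstrip m l -> weight l = (weight m + \sum_i (l i - m i))%N.
Proof.
move=> hml; rewrite /weight -big_split /=; apply: eq_bigr => i _.
by rewrite subnKC // hstrip_le.
Qed.

Lemma hpieri m (r : nat) : is_part m -> m ord_max = ord0 -> (r <= b)%N ->
  h r%:Z * sdet h m = \sum_(l | hstrip m l && (weight l == weight m + r)%N) sdet h l.
Proof.
move=> mp m0 rb.
(* The generating identity is used over polynomials, with t the variable; the claim is its
   coefficient of degree r. *)
pose hX (p : int) := (h p)%:P.
have sX l : sdet hX l = (sdet h l)%:P.
  rewrite /sdet -(det_map_mx (@polyC R)); congr (\det _).
  by apply/matrixP => i j; rewrite !mxE.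
have /(congr1 (fun p : {poly R} => p`_r)) : 
  \sum_(l | hstrip m l) 'X ^+ (\sum_i (l i - m i))%N * sdet hX l
  = (\sum_(0 <= k < b.+1) 'X ^+ k * hX k%:Z) * sdet hX m.
  apply: hpieri_gen => // [|p hp|p hp]; rewrite /hX.
  - by rewrite h0.
  - by rewrite hneg.
  - by rewrite hbig.
rewrite sX coefMC coef_sum.
have -> : (\sum_(0 <= k < b.+1) 'X^k * (h k%:Z)%:P)`_r = h r%:Z.
  rewrite big_mkord coef_sum (bigD1 (inord r)) //= coefMC coefXn inordK // eqxx mul1r.
  rewrite big1 ?addr0 // => i; rewrite -val_eqE /= inordK // coefMC coefXn eq_sym => /negPf ->.
  by rewrite mul0r.
move=> <-; rewrite [RHS]big_mkcondr /=.
apply: eq_bigr => l hml; rewrite sX coefMC coefXn (hstrip_weight hml) eqn_add2l eq_sym.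
by case: eqP; rewrite ?mul1r ?mul0r.
Qed.
End HPieriCoef.

(** * Noncommutative symmetric functions in nilCoxeter generators *)

Section NilCoxeter.
Variables (A : nzRingType) (u : nat -> A).
Hypothesis u_sq : forall a, u a * u a = 0.
Hypothesis u_far : forall a b, (a.+1 < b)%N -> u a * u b = u b * u a.
Hypothesis u_braid : forall a, u a * u a.+1 * u a = u a.+1 * u a * u a.+1.

(* [hh c p] and [ee c p] are the sums of the strictly decreasing, respectively
   increasing, monomials of degree p in u_0, ..., u_(c-1). *)
Fixpoint hh (c : nat) (p : int) : A :=
  if c is c'.+1 then hh c' p + u c' * hh c' (p - 1) else (p == 0)%:R.
Fixpoint ee (c : nat) (p : int) : A :=
  if c is c'.+1 then ee c' p + ee c' (p - 1) * u c' else (p == 0)%:R.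

Lemma hhS c p : hh c.+1 p = hh c p + u c * hh c (p - 1). Proof. by []. Qed.
Lemma eeS c p : ee c.+1 p = ee c p + ee c (p - 1) * u c. Proof. by []. Qed.

Lemma hh_neg c p : p < 0 -> hh c p = 0.
Proof.
elim: c p => [|c IH] p p0 /=; first by case: eqP p0 => // ->.
by rewrite !IH ?mulr0 ?addr0 //; lia.
Qed.

Lemma ee_neg c p : p < 0 -> ee c p = 0.
Proof.
elim: c p => [|c IH] p p0 /=; first by case: eqP p0 => // ->.
by rewrite !IH ?mul0r ?addr0 //; lia.
Qed.

Lemma hh_0 c : hh c 0 = 1.
Proof. by elim: c => [|c IH] //=; rewrite IH hh_neg ?mulr0 ?addr0. Qed.

Lemma ee_0 c : ee c 0 = 1.
Proof. by elim: c => [|c IH] //=; rewrite IH ee_neg ?mul0r ?addr0. Qed.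

Lemma hh_big c p : c%:Z < p -> hh c p = 0.
Proof.
elim: c p => [|c IH] p p0 /=; first by case: eqP p0 => // ->.
by rewrite !IH ?mulr0 ?addr0 //; lia.
Qed.

Lemma hh_far c k p : (c < k)%N -> u k * hh c p = hh c p * u k.
Proof.
elim: c p => [|c IH] p ck /=; first by rewrite commr_nat.
by rewrite mulrDr mulrDl mulrA -u_far // -mulrA -mulrA !IH // ltnW.
Qed.

Lemma hh_split e c p : (e <= c)%N ->
  hh c p = hh e p + \sum_(e <= b < c) u b * hh b (p - 1).
Proof.
elim: c => [|c IH]; first by rewrite leqn0 => /eqP ->; rewrite big_geq ?addr0.
rewrite leq_eqVlt => /predU1P[->|ec]; first by rewrite big_geq ?addr0.
by rewrite big_nat_recr //= addrA -IH.
Qed.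

(** P commutes with [hh u c], whose letters are below c, and [hh u c q] equals h q - Q h (q - 1)
    because Q squares to 0. Substituting this moves P across h up to correction terms. *)
Lemma hh_mulu c p : let P := u c.+1 in let Q := u c in let h := hh c.+1 in
  h p * P = P * h p + (Q * P - P * Q) * h (p - 1) - Q * P * Q * h (p - 2).
Proof.
move=> P Q h.
have Qh q : Q * h q = Q * hh c q by rewrite /h /= mulrDr mulrA u_sq mul0r addr0.
have gh q : hh c q = h q - Q * h (q - 1) by rewrite Qh /h /= addrK.
have gP q : hh c q * P = P * hh c q by rewrite hh_far.
rewrite {1}/h /= -/Q mulrDl gP -!mulrA gP (mulrA Q P) !gh.
rewrite (_ : p - 1 - 1 = p - 2); last by rewrite -addrA.
by rewrite !mulrBr !mulrBl !mulrA -!addrA; congr (_ + _); rewrite addrCA.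
Qed.

Lemma hhM_succ c p q : let P := u c.+1 in let Q := u c in let h := hh c.+1 in
  hh c.+2 p * hh c.+2 q =
  h p * h q + P * (h p * h (q - 1) + h (p - 1) * h q)
  + (Q * P - P * Q) * (h (p - 1) * h (q - 1)).
Proof.
move=> P Q h; rewrite (hhS c.+1 p) (hhS c.+1 q) -/h -/P.
have PP : P * P = 0 := u_sq _.
have hP r : h r * P = P * h r + (Q * P - P * Q) * h (r - 1) - Q * P * Q * h (r - 2).
  exact: hh_mulu.
have PhP r : P * (h r * P) = Q * P * Q * h (r - 1).
  have PQP : P * Q * P = Q * P * Q by rewrite /P /Q u_braid.
  have PQPQ : P * Q * P * Q = 0 by rewrite PQP -mulrA u_sq mulr0.
  rewrite hP mulrBr mulrDr mulrBl mulrBr !mulrA PP PQPQ PQP !mul0r !subr0.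
  by rewrite add0r.
clearbody P Q h; rewrite (mulrDl (h p)) !mulrDr !mulrA -(mulrA P (h (p - 1)) P) PhP hP.
rewrite (_ : p - 1 - 1 = p - 2); last by rewrite -addrA.
rewrite mulrBl mulrDl -!addrA; congr (_ + _); rewrite !addrA.
by rewrite [LHS]addrAC subrK addrAC.
Qed.

Lemma hhC c p q : hh c p * hh c q = hh c q * hh c p.
Proof.
elim: c p q => [|[|c] IH] p q; first by rewrite /= -!natrM mulnC.
  have C r s : hh 0 r * (u 0 * hh 0 s) = u 0 * (hh 0 r * hh 0 s).
    by rewrite !mulrA; congr (_ * _); apply/esym/commr_nat.
  rewrite (hhS 0 p) (hhS 0 q).
  rewrite !mulrDl !mulrDr !C -!(mulrA (u 0)) !C !(mulrA (u 0) (u 0)) u_sq !mul0r !addr0.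
  rewrite (IH q p) (IH q (p - 1)) (IH (q - 1) p) -!addrA; congr (_ + _).
  exact: addrC.
rewrite !hhM_succ (IH p q) (IH p (q - 1)) (IH (p - 1) q) (IH (p - 1) (q - 1)).
by rewrite (addrC (_ * _) (hh _ q * _)).
Qed.

(** After [u c], whose square is 0, [hh u c] and [hh u c.+1] cannot be told apart, so both factors
    come from one commuting family. This symmetry makes adjacent rows of an alternating sum
    cancel. *)
Lemma hh_pair c p q :
  u c * hh c p * hh c.+1 q = u c * hh c q * hh c.+1 p.
Proof.
have H r : u c * hh c r = u c * hh c.+1 r by rewrite /= mulrDr mulrA u_sq mul0r addr0.
by rewrite !H -!mulrA hhC.
Qed.

(** With t marking the degree, the two families are products of the 1 + t u_b in opposite orders, so
    in the alternating product the inner factors 1 - t u_c and 1 + t u_c meet, and they cancel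
    because u_c squares to 0. *)
Lemma ee_hh c (r : nat) :
  \sum_(0 <= k < r.+1) (-1) ^+ k * ee c k%:Z * hh c (r%:Z - k%:Z) = (r == 0)%:R.
Proof.
elim: c r => [|c IH] r.
  rewrite big_ltn //= big_nat big1 ?addr0 => [|k /andP[k1 _]]; last first.
    by case: k k1 => // k _; rewrite mulr0 mul0r.
  by rewrite expr0 !mul1r; congr (_%:R); lia.
transitivity (\sum_(0 <= k < r.+1) ((-1) ^+ k * ee c k%:Z * hh c (r%:Z - k%:Z)
  + ((-1) ^+ k * ee c k%:Z * u c * hh c (r%:Z - k%:Z - 1)
  + (-1) ^+ k * ee c (k%:Z - 1) * u c * hh c (r%:Z - k%:Z)))).
  apply: eq_bigr => k _ /=; rewrite !mulrDr !mulrDl !mulrA -!addrA; congr (_ + _).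
  by rewrite [LHS]addrC -!addrA -(mulrA _ (u c) (u c)) u_sq mulr0 mul0r add0r addrC.
rewrite big_split /= IH -[RHS]addr0; congr (_ + _).
rewrite big_split /= big_nat_recr // [X in _ + X]big_ltn //=.
rewrite (hh_neg c (p := (r%:Z - r%:Z - 1)%R)) ?subrr // mulr0 addr0.
rewrite (ee_neg c (p := (0 - 1)%R)) // mulr0 !mul0r add0r big_add1 /= -big_split /=.
rewrite big1 // => k _; rewrite exprS !mulNr mul1r.
rewrite (_ : r%:Z - k.+1%:Z = r%:Z - k%:Z - 1)%R; last lia.
by rewrite (_ : k.+1%:Z - 1 = k%:Z)%R ?subrr //; lia.
Qed.

Lemma ee_rec c (r : nat) : (0 < r)%N ->
  (-1) ^+ r * ee c r%:Z = - \sum_(0 <= k < r) (-1) ^+ k * ee c k%:Z * hh c (r%:Z - k%:Z).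
Proof.
move=> r0; have := ee_hh c r; rewrite big_nat_recr //= subrr hh_0 mulr1 addrC.
by rewrite eqn0Ngt r0 => /eqP; rewrite addr_eq0 => /eqP.
Qed.

Lemma ee_hhC c (r : nat) q : ee c r%:Z * hh c q = hh c q * ee c r%:Z.
Proof.
elim: r {-2}r (leqnn r) => [|n IH] r; first by rewrite leqn0 => /eqP ->; rewrite ee_0 mulr1 mul1r.
move=> rn; case: (posnP r) => [->|r0]; first by rewrite ee_0 mulr1 mul1r.
suff: GRing.comm (hh c q) ((-1) ^+ r * ee c r%:Z).
  move=> H; apply: commr_sym.
  have -> : ee c r = (-1) ^+ r * ((-1) ^+ r * ee c r).
    by rewrite mulrA -expr2 sqrr_sign mul1r.
  by apply: commrM => //; exact: commr_sign.
rewrite ee_rec //; apply: commrN; rewrite big_nat; apply: commr_sum => k /andP[_ kr].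
apply: commrM; last exact: hhC.
by apply: commrM; [exact: commr_sign | rewrite /GRing.comm IH //; lia].
Qed.
End NilCoxeter.

(** * Positivity of noncommutative Schur functions *)

Section Alternant.
Variable A : nzRingType.
Implicit Types (g : nat -> int -> A) (x : nat -> int).

(** A determinant with the factors of each term kept in row order, so that it makes sense in a
    noncommutative ring. *)
Definition alt D g x :=
  \sum_(s : 'S_D) (-1) ^+ s * \prod_(r < D) g r (x (s r)).

Lemma eq_alt D g g' x x' :
  (forall r i, (r < D)%N -> (i < D)%N -> g r (x i) = g' r (x' i)) -> alt D g x = alt D g' x'.
Proof.
move=> eg; apply: eq_bigr => s _; congr (_ * _); apply: eq_bigr => r _; exact: eg.
Qed.

Lemma alt_swap0 D g x r : (r.+1 < D)%N ->
  (forall p q, g r p * g r.+1 q = g r q * g r.+1 p) -> alt D g x = 0.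
Proof.
case: D => // D rD sym; pose i : 'I_D.+1 := inord r; pose j : 'I_D.+1 := inord r.+1.
have iE : i = r :> nat by rewrite inordK // ltnW.
have jE : j = r.+1 :> nat by rewrite inordK.
have ij : i != j by rewrite -val_eqE /= iE jE ltn_eqF.
pose t := tperm i j.
have oddMt s: (t * s)%g = ~~ s :> bool by rewrite odd_permM odd_tperm ij.
rewrite /alt (bigID (@odd_perm _)) /=.
apply: canLR (subrK _) _; rewrite add0r -sumrN.
rewrite (reindex_inj (mulgI t)); apply: eq_big => //= s.
rewrite oddMt => /negPf->; rewrite expr1 expr0 mulN1r mul1r; congr (- _).
pose F (s : 'S_D.+1) k := g k (x (s (inord k))).
have FE (s' : 'S_D.+1) : \prod_(k < D.+1) g k (x (s' k)) = \prod_(0 <= k < D.+1) F s' k.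
  by rewrite big_mkord; apply: eq_bigr => k _; rewrite /F inord_val.
have split (s' : 'S_D.+1) : \prod_(0 <= k < D.+1) F s' k =
   \prod_(0 <= k < r) F s' k * (F s' r * F s' r.+1) * \prod_(r.+2 <= k < D.+1) F s' k.
  rewrite (@big_cat_nat _ _ _ r) //=; last by rewrite ltnW // ltnW.
  by rewrite -mulrA; congr (_ * _); rewrite big_ltn ?(ltnW rD) // big_ltn // mulrA.
rewrite !FE !split; congr (_ * _ * _); last first.
- rewrite big_nat [RHS]big_nat; apply: eq_bigr => k /andP[k1 k2].
  by rewrite /F permM tpermD // -val_eqE /= ?iE ?jE inordK //; lia.
- rewrite /F !permM -/i -/j tpermL tpermR; exact: sym.
rewrite big_nat [RHS]big_nat; apply: eq_bigr => k /andP[k1 k2].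
have kD : (k < D.+1)%N by lia.
by rewrite /F permM tpermD // -val_eqE /= ?iE ?jE inordK //; lia.
Qed.

Lemma alt_updD D g g1 g2 x r : (r < D)%N ->
  (forall q p, q != r -> g q p = g1 q p) -> (forall q p, q != r -> g q p = g2 q p) ->
  (forall i, (i < D)%N -> g r (x i) = g1 r (x i) + g2 r (x i)) ->
  alt D g x = alt D g1 x + alt D g2 x.
Proof.
move=> rD e1 e2 er; rewrite /alt -big_split /=; apply: eq_bigr => s _.
rewrite -mulrDr; congr (_ * _).
case: D rD er s => // D rD er s.
pose F (g : nat -> int -> A) k := g k (x (s (inord k))).
have FE g' : \prod_(k < D.+1) g' k (x (s k)) = \prod_(0 <= k < D.+1) F g' k.
  by rewrite big_mkord; apply: eq_bigr => k _; rewrite /F inord_val.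
have split g' : \prod_(0 <= k < D.+1) F g' k =
   \prod_(0 <= k < r) F g' k * F g' r * \prod_(r.+1 <= k < D.+1) F g' k.
  by rewrite (@big_cat_nat _ _ _ r) //= ?(ltnW rD) // -mulrA [in LHS](@big_ltn _ _ _ r).
rewrite !FE !split.
have E1 g' : (forall q p, q != r -> g q p = g' q p) ->
    \prod_(0 <= k < r) F g k = \prod_(0 <= k < r) F g' k.
  by move=> e; rewrite big_nat [RHS]big_nat; apply: eq_bigr => k /andP[_ kr]; rewrite /F e ?ltn_eqF.
have E2 g' : (forall q p, q != r -> g q p = g' q p) ->
    \prod_(r.+1 <= k < D.+1) F g k = \prod_(r.+1 <= k < D.+1) F g' k.
  by move=> e; rewrite big_nat [RHS]big_nat; apply: eq_bigr => k /andP[rk _]; rewrite /F e ?gtn_eqF.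
rewrite -(E1 _ e1) -(E1 _ e2) -(E2 _ e1) -(E2 _ e2) -mulrDl -mulrDr.
by rewrite {2}/F er.
Qed.

(** Column 0 vanishes below its top entry 1, so only permutations fixing 0 contribute. *)
Lemma alt_drop D g x : x 0 = 0 -> (forall p, p = 0 -> g 0 p = 1) ->
  (forall r, (0 < r)%N -> g r 0 = 0) ->
  alt D.+1 g x = alt D (fun r => g r.+1) (fun i => x i.+1).
Proof.
move=> x0 g0 gr; rewrite /alt (bigID (fun s : 'S_D.+1 => s ord0 == ord0)) /= addrC.
rewrite big1 ?add0r => [|s s0]; last first.
  suff -> : \prod_(r < D.+1) g r (x (s r)) = 0 by rewrite mulr0.
  pose k := (s^-1)%g ord0.
  have k0 : (0 < k)%N.
    rewrite lt0n; apply: contra s0 => /eqP k0.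
    have {1}<- : k = ord0 by apply: val_inj.
    by rewrite /k permKV.
  rewrite (_ : \prod_(r < D.+1) g r (x (s r)) = \prod_(0 <= r < D.+1) g r (x (s (inord r)))); last first.
    by rewrite big_mkord; apply: eq_bigr => r _; rewrite inord_val.
  rewrite (@big_cat_nat _ _ _ k) //= 1?ltnW //= [X in _ * X]big_ltn //.
  by rewrite inord_val permKV /= x0 gr // mul0r mulr0.
rewrite (reindex (lift_perm ord0 ord0)) /=; last first.
  pose f (s : 'S_D.+1) k := odflt k (unlift (s ord0) (s (lift ord0 k))).
  have fK (s : 'S_D.+1) k : lift (s ord0) (f s k) = s (lift ord0 k).
    rewrite /f; have:= neq_lift ord0 k.
    by rewrite -(can_eq (permK s)) => /unlift_some[] ? ? ->.
  have inj_f s : injective (f s).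
    by move=> k k' /(congr1 (lift (s ord0))); rewrite !fK => /perm_inj/lift_inj.
  exists (fun s => perm (@inj_f s)) => [s _ | s].
    apply/permP=> k'; rewrite permE; apply: (@lift_inj _ ord0).
    by have := fK (lift_perm ord0 ord0 s) k'; rewrite lift_perm_id lift_perm_lift.
  rewrite inE => /eqP s0; apply/permP=> k.
  case: (unliftP ord0 k) => [k'|] ->; rewrite ?lift_perm_id //.
  by rewrite lift_perm_lift permE -{1}s0 fK.
apply: eq_big => [s|s _]; first by rewrite lift_perm_id eqxx.
rewrite odd_lift_perm /= big_ord_recl lift_perm_id /= g0 // mul1r; congr (_ * _).
by apply: eq_bigr => i _; rewrite lift_perm_lift.
Qed.
End Alternant.

Section FominGreene.
Variables (A : nzRingType) (u : nat -> A).
Hypothesis u_sq : forall a, u a * u a = 0.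
Hypothesis u_far : forall a b, (a.+1 < b)%N -> u a * u b = u b * u a.
Hypothesis u_braid : forall a, u a * u a.+1 * u a = u a.+1 * u a * u a.+1.
Variable Pos : A -> Prop.
Hypothesis Pos0 : Pos 0.
Hypothesis Pos1 : Pos 1.
Hypothesis PosD : forall x y, Pos x -> Pos y -> Pos (x + y).
Hypothesis PosM : forall x y, Pos x -> Pos y -> Pos (x * y).
Hypothesis Posu : forall a, Pos (u a).

Definition tailrow (c : nat -> nat) (q : nat) (p : int) : A := hh u (c q) (p - q%:Z).
(* The Fomin-Greene expansion: the first letters a_0, a_1, ... of the factors are
   extracted one row after the other.  The terms where the next letter is at most
   its predecessor cancel in the alternating sum, by [hh_pair]; once all rows are
   peeled, increasing letters factor out. *)
Definition peeled r (a c : nat -> nat) (q : nat) (p : int) : A :=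
  if (q < r)%N then u (a q) * hh u (a q) (p - q%:Z - 1) else tailrow c q p.

(** The letters of [hh u (a i)] are below a i < a m, hence at distance at least 2 from a m, so
    [u (a m)] moves to the front past them. The letters a become the bounds of the next round. *)
Lemma peeled_all D (a c : nat -> nat) (x : nat -> int) :
  (forall q r, (q < r)%N -> (r < D)%N -> (a q < a r)%N) ->
  alt D (peeled D a c) x = \prod_(0 <= q < D) u (a q) * alt D (tailrow a) (fun i => x i - 1).
Proof.
move=> ainc; rewrite /alt big_distrr /=; apply: eq_bigr => s _.
rewrite [RHS]mulrA (commr_sign _ s) -[RHS]mulrA; congr (_ * _).
case: D ainc s => [|D] ainc s; first by rewrite big_geq ?big_ord0 ?mul1r ?big_ord0.
have -> : \prod_(r < D.+1) peeled D.+1 a c r (x (s r)) =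
   \prod_(0 <= r < D.+1) (u (a r) * hh u (a r) (x (s (inord r)) - r%:Z - 1)).
  by rewrite big_mkord; apply: eq_bigr => r _; rewrite /peeled ltn_ord inord_val.
have -> : \prod_(r < D.+1) tailrow a r (x (s r) - 1) =
   \prod_(0 <= r < D.+1) hh u (a r) (x (s (inord r)) - r%:Z - 1).
  by rewrite big_mkord; apply: eq_bigr => r _; rewrite /tailrow inord_val addrAC.
set y := fun r => x (s (inord r)).
suff H n : (n <= D.+1)%N ->
  \prod_(0 <= r < n) (u (a r) * hh u (a r) (y r - r%:Z - 1)) =
  \prod_(0 <= q < n) u (a q) * \prod_(0 <= r < n) hh u (a r) (y r - r%:Z - 1) by exact: H.
elim: n => [|m IH] mD; first by rewrite !big_nil mulr1.
rewrite !big_nat_recr //= IH ?(ltnW mD) // -!mulrA; congr (_ * _).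
rewrite !mulrA; congr (_ * _).
suff: GRing.comm (u (a m)) (\prod_(0 <= i < m) hh u (a i) (y i - i%:Z - 1)) by [].
rewrite big_nat; apply: commr_prod => i /andP[_ im].
by rewrite /GRing.comm hh_far // ainc.
Qed.

Lemma alt_row0 D g (x : nat -> int) r : (r < D)%N ->
  (forall i, (i < D)%N -> g r (x i) = 0 :> A) -> alt D g x = 0.
Proof.
move=> rD g0; apply: (addrI (alt D g x)); rewrite addr0; symmetry.
by apply: (alt_updD (r := r)) => // i /g0 ->; rewrite addr0.
Qed.

Definition setrow (g : nat -> int -> A) r (f : int -> A) q p := if q == r then f p else g q p.

Lemma alt_setrowD D g (x : nat -> int) r f f1 f2 : (r < D)%N ->
  (forall i, (i < D)%N -> f (x i) = f1 (x i) + f2 (x i)) ->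
  alt D (setrow g r f) x = alt D (setrow g r f1) x + alt D (setrow g r f2) x.
Proof.
move=> rD fD; apply: (alt_updD (r := r)) => // [q p|q p|i iD]; rewrite /setrow ?eqxx ?fD //.
- by move=> /negPf ->.
- by move=> /negPf ->.
Qed.

Lemma Pos_row_sum D g r e C (x : nat -> int) (F : nat -> int -> A) : (r < D)%N ->
  (forall b, (e <= b < C)%N -> Pos (alt D (setrow g r (F b)) x)) ->
  Pos (alt D (setrow g r (fun p => \sum_(e <= b < C) F b p)) x).
Proof.
move=> rD; move: {2}(C - e)%N (erefl (C - e)%N) => n; elim: n e => [|n IHn] e en H.
  rewrite (@alt_row0 _ _ _ r) // => i _.
  by rewrite /setrow eqxx big_geq //; lia.
rewrite (@alt_setrowD _ _ _ _ _ (F e) (fun p => \sum_(e.+1 <= b < C) F b p)) //; last first.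
  by move=> i _; rewrite big_ltn //; lia.
apply: PosD; first by apply: H; lia.
by apply: IHn => [|b bC]; [lia | apply: H; lia].
Qed.

Definition colrow r b (p : int) : A := u b * hh u b (p - r%:Z - 1).

(** Induction on the number j of rows not yet peeled. Since c is weakly increasing, a r lies below
    the bound of row r+1, which can therefore be split at this letter. *)
Lemma Pos_peeled D (c : nat -> nat) (x : nat -> int) :
  (forall q, (q.+1 < D)%N -> (c q <= c q.+1)%N) ->
  (forall a, (forall q r, (q < r)%N -> (r < D)%N -> (a q < a r)%N) ->
     Pos (alt D (peeled D a c) x)) ->
  forall j r a, (r.+1 + j = D)%N -> (a r < c r)%N ->
  (forall q q', (q < q')%N -> (q' <= r)%N -> (a q < a q')%N) ->
  Pos (alt D (peeled r.+1 a c) x).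
Proof.
move=> cinc base; elim=> [|j IH] r a rj ac ainc.
  rewrite addn0 in rj; rewrite -rj in base *; apply: base => q q' qq' q'D; exact: ainc.
have rD : (r.+1 < D)%N by lia.
have acr : (a r < c r.+1)%N by apply: leq_trans ac _; exact: cinc.
pose g := peeled r.+1 a c.
rewrite (@eq_alt _ _ _ (setrow g r.+1 (tailrow c r.+1)) _ x) //; last first.
  by move=> q i qD iD; rewrite /setrow; case: eqP => // ->; rewrite /peeled ltnn.
(* Row r+1 consists of the words with all letters at most a r and those whose first, largest, letter
   b exceeds a r. *)
rewrite (@alt_setrowD _ _ _ _ _ (fun p => hh u (a r).+1 (p - r.+1%:Z))
   (fun p => \sum_((a r).+1 <= b < c r.+1) colrow r.+1 b p)) //; last first.
  by move=> i _; rewrite /tailrow (hh_split _ _ acr).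
rewrite (@alt_swap0 _ _ _ _ r) // => [|p q]; last first.
  rewrite /setrow eqxx ltn_eqF // /g /peeled ltnSn hh_pair //; congr (_ * hh u _ _ * hh u _ _); lia.
rewrite add0r; apply: Pos_row_sum => // b /andP[ab bc].
pose a' q := if q == r.+1 then b else a q.
rewrite (@eq_alt _ _ _ (peeled r.+2 a' c) _ x) //; last first.
  move=> q i qD iD; rewrite /setrow /peeled /a'; case: (eqVneq q r.+1) => [->|qr]; first by rewrite ltnSn.
  by have -> : (q < r.+2)%N = (q < r.+1)%N by lia.
apply: IH; [lia | by rewrite /a' eqxx |].
move=> q q' qq' q'r; rewrite /a' (ltn_eqF (m := q)); last by lia.
have [/eqP E|q'r1] := eqVneq q' r.+1; last by apply: ainc; lia.
by have [->//|qr] := eqVneq q r; apply: ltn_trans ab; apply: ainc; lia.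
Qed.

Lemma alt_0 (g : nat -> int -> A) x : alt 0 g x = 1.
Proof.
rewrite /alt (big_pred1 1%g) ?odd_perm1 ?big_ord0 ?mulr1 // => s.
by apply/esym/eqP/permP => -[].
Qed.

(** If x 0 = 0, the first row and column drop out. Otherwise row 0 has positive degrees and a first
    letter can be taken from one row after the other; this lowers every x by 1 and replaces c by
    increasing letters. Either way D plus the last x decreases. *)
Theorem Pos_alt D (c x : nat -> nat) :
  (forall q, (q.+1 < D)%N -> (c q <= c q.+1)%N) ->
  (forall q r, (q < r)%N -> (r < D)%N -> (x q < x r)%N) ->
  Pos (alt D (tailrow c) (fun i => (x i)%:Z)).
Proof.
move: {2}(D + x D.-1)%N (leqnn (D + x D.-1)%N) => n.
elim: n D c x => [|n IH] [|D] c x xn cinc xinc; rewrite ?alt_0 //.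
have xD i : (i < D)%N -> (x 0 < x i.+1)%N by move=> iD; exact: xinc.
case: (posnP (x 0)) => x0.
  rewrite alt_drop ?x0 // => [|p ->|r r0]; last 2 first.
  - by rewrite /tailrow subrr hh_0.
  - by rewrite /tailrow hh_neg //; lia.
  rewrite (@eq_alt _ _ _ (tailrow (fun r => c r.+1)) _ (fun i => (x i.+1).-1%:Z)).
    case: D xn cinc xinc xD => [|D] xn cinc xinc xD; first by rewrite alt_0.
    apply: IH => [|q qD|q r qr rD] /=; [by have := xD D (ltnSn D); move: xn => /=; lia | exact: cinc |].
    have := xinc q.+1 r.+1 qr rD; have := xD q; lia.
  move=> r i rD iD; rewrite /tailrow; congr (hh u _ _); have:= xD i iD; lia.
have xpos i : (i < D.+1)%N -> (0 < x i)%N by case: i => // i iD; apply: leq_ltn_trans (xD i iD).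
rewrite (@eq_alt _ _ _ (setrow (tailrow c) 0 (fun p => \sum_(0 <= b < c 0) colrow 0 b p)) _ (fun i => (x i)%:Z)); last first.
  move=> r i rD iD; rewrite /setrow; case: eqP => // ->.
  rewrite /tailrow (hh_split _ _ (leq0n _)) /= (_ : (_ == _) = false) ?add0r //.
  by have := xpos i iD; lia.
apply: Pos_row_sum => // b /andP[_ bc].
rewrite (@eq_alt _ _ _ (peeled 1 (fun=> b) c) _ (fun i => (x i)%:Z)); last first.
  by move=> [|r] i rD iD; rewrite /setrow /peeled.
apply: (@Pos_peeled _ _ _ _ _ D) => // [a ainc|q q']; last by case: q'.
rewrite peeled_all //; apply: PosM.
  by elim/big_rec: _ => // i y _; apply: PosM.
rewrite (@eq_alt _ _ _ (tailrow a) _ (fun i => (x i).-1%:Z)).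
  apply: IH => [|q qD|q r qr rD].
  - by have := xpos D (ltnSn _); move: xn => /=; lia.
  - by rewrite ltnW // ainc.
  - by have := xinc q r qr rD; have := xpos q (ltn_trans qr rD); lia.
by move=> r i rD iD; congr tailrow; have := xpos i iD; lia.
Qed.
End FominGreene.

(** * Jacobi-Trudi determinants as alternating sums of ordered products *)

Section JacobiTrudiReversal.
Variables (R : comNzRingType) (d b : nat) (h : int -> R).
Implicit Types (l : {ffun 'I_d.+1 -> 'I_b.+1}).

(** Reversing rows and columns costs the sign of the reversal twice. The arguments become x (s r) -
    r, where x i is the part in row d - i plus i; for a partition x is strictly increasing, as
    [Pos_alt] requires. *)
Lemma sdet_rev l : sdet h l =
  \sum_(s : 'S_d.+1) (-1) ^+ s *
    \prod_(r < d.+1) h ((l (rev_ord (s r)))%:Z + (s r)%:Z - r%:Z).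
Proof.
pose N := \matrix_(i < d.+1, j < d.+1) h ((l (rev_ord i))%:Z + i%:Z - j%:Z).
transitivity (\det N); last first.
  rewrite -det_tr /determinant; apply: eq_bigr => s _; congr (_ * _).
  by apply: eq_bigr => i _; rewrite !mxE.
pose rho := perm (@rev_ord_inj d.+1).
have -> : N = row_perm rho (col_perm rho (\matrix_(i < d.+1, j < d.+1) h ((l i)%:Z - i%:Z + j%:Z))).
  apply/matrixP => i j; rewrite !mxE !permE /=; congr h.
  by have := ltn_ord i; have := ltn_ord j; lia.
rewrite row_permE col_permE !det_mulmx !det_perm odd_permV mulrC -mulrA.
by rewrite -signr_addb addbb mulr1.
Qed.

Hypothesis h0 : h 0 = 1.
Hypothesis hneg : forall p : int, (p < 0)%R -> h p = 0.
Lemma sdet0 : sdet h ([ffun=> ord0] : {ffun 'I_d.+1 -> 'I_b.+1}) = 1.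
Proof.
rewrite /sdet -det_tr det_trig; last first.
  by apply/is_trig_mxP => i j ij; rewrite !mxE ffunE hneg //=; lia.
by rewrite big1 // => i _; rewrite !mxE ffunE /= sub0r addNr.
Qed.
End JacobiTrudiReversal.

(** * Noncommutative Schur functions *)

Section SchurElements.
Variables (A : nzRingType) (u : nat -> A).
Hypothesis u_sq : forall a, u a * u a = 0.
Hypothesis u_far : forall a b, (a.+1 < b)%N -> u a * u b = u b * u a.
Hypothesis u_braid : forall a, u a * u a.+1 * u a = u a.+1 * u a * u a.+1.
Variables (C d b : nat).
Hypothesis bbig : (C + d < b)%N.
Implicit Types (l m : {ffun 'I_d.+1 -> 'I_b.+1}).

Let hC : forall p q, GRing.comm (hh u C p) (hh u C q) := hhC u_sq u_far u_braid C.

Fact hh_bicomm p : hh u C p \in bicomm_pred (hh u C).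
Proof. by apply/bicommP => y cy; apply: commr_sym. Qed.

Definition hbic p : bicommutant hC := Bicommutant hC (hh_bicomm p).
Definition schur l : A := val (sdet hbic l).

Lemma hbic0 : hbic 0 = 1. Proof. by apply: val_inj; rewrite /= hh_0. Qed.
Lemma hbic_neg p : p < 0 -> hbic p = 0.
Proof. by move=> p0; apply: val_inj; rewrite /= hh_neg. Qed.
(** [hh u C p] is 0 beyond p = C, and [bbig] places b - d there: this is the truncation hypothesis
    of the Pieri rule. *)
Lemma hbic_big (p : int) : b%:Z - d%:Z <= p -> hbic p = 0.
Proof. by move=> p0; apply: val_inj; rewrite /= hh_big //; lia. Qed.

Lemma schur0 : schur [ffun=> ord0] = 1.
Proof. by rewrite /schur sdet0 //; [exact: hbic0 | exact: hbic_neg]. Qed.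

Lemma h_schur m (r : nat) : is_part m -> m ord_max = ord0 -> (r <= b)%N ->
  hh u C r%:Z * schur m = \sum_(l | hstrip m l && (weight l == weight m + r)%N) schur l.
Proof.
move=> mp m0 rb; have := hpieri hbic0 hbic_neg hbic_big mp m0 rb.
by move/(congr1 (val : bicommutant hC -> A)); rewrite rmorphM [X in _ = X -> _]raddf_sum.
Qed.

Lemma schur_alt l : schur l = alt d.+1 (tailrow u (fun=> C))
  (fun i => (l (rev_ord (inord i)) + i)%N%:Z).
Proof.
rewrite /schur sdet_rev /alt rmorph_sum; apply: eq_bigr => s _.
rewrite rmorphM rmorph_prod rmorph_sign; congr (_ * _).
by apply: eq_bigr => r _; rewrite /tailrow inord_val.
Qed.

Lemma Pos_schur (Pos : A -> Prop) : Pos 0 -> Pos 1 ->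
  (forall x y, Pos x -> Pos y -> Pos (x + y)) ->
  (forall x y, Pos x -> Pos y -> Pos (x * y)) -> (forall a, Pos (u a)) ->
  forall l, is_part l -> Pos (schur l).
Proof.
move=> P0 P1 PD PM Pu l lp; rewrite schur_alt.
apply: Pos_alt => // q r qr rD; rewrite -addnS leq_add //.
apply: is_part_le => //=; rewrite !inordK ?(ltn_trans qr) //; lia.
Qed.
End SchurElements.

(** * Kostka expansions *)

Section VerticalStrips.
Variables d b : nat.
Implicit Types (l m : {ffun 'I_d.+1 -> 'I_b.+1}) (i j : 'I_d.+1).

Definition vstrip m l := [forall i, (m i <= l i <= (m i).+1)%N].

Lemma vstrip_weight m l : vstrip m l -> weight l = (weight m + \sum_i (l i - m i))%N.
Proof.
move=> /forallP v; rewrite /weight -big_split /=; apply: eq_bigr => i _.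
by rewrite subnKC //; have /andP[] := v i.
Qed.

Lemma vstrip_refl m : vstrip m m.
Proof. by apply/forallP => i; rewrite leqnn leqnSn. Qed.

Lemma hstrip_refl m : is_part m -> hstrip m m.
Proof. by move=> /forallP mp; apply/forallP => i; rewrite leqnn mp. Qed.

Lemma weight_eq m l : (forall i, m i <= l i)%N -> weight l = weight m -> l = m.
Proof.
move=> ml wE; apply/ffunP => i; apply: val_inj => /=; apply/eqP; rewrite eqn_leq ml andbT leqNgt.
apply/negP => mi; suff: (weight m < weight l)%N by rewrite wE ltnn.
rewrite /weight (bigD1 i) //= [X in (_ < X)%N](bigD1 i) //= -addSn leq_add //.
exact: leq_sum.
Qed.

(** d+1 nonzero rows weigh more than d. Having d+1 rows thus secures the empty last row that the
    Pieri rule asks for, in all degrees up to d. *)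
Lemma part_last m : is_part m -> (weight m <= d)%N -> m ord_max = ord0.
Proof.
move=> mp wd; apply: val_inj => /=; apply/eqP; rewrite -leqn0 leqNgt; apply/negP => m0.
suff: (d.+1 <= weight m)%N by rewrite ltnNge wd.
rewrite -[d.+1]card_ord -sum1_card; apply: leq_sum => i _.
by apply: leq_trans m0 _; apply: is_part_le => //; rewrite -ltnS.
Qed.

(* The sum factors over the rows, and the first row in which [l] and [m] differ
   contributes 1 - 1 or an empty sum. *)
Lemma strip_sign m l : is_part m -> is_part l -> l != m ->
  \sum_(k | hstrip m k && vstrip k l) (-1) ^+ (weight l - weight k) = 0 :> int.
Proof.
move=> mp lp lm.
pose Q i (v : 'I_b.+1) := (m i <= v <= row_above m i)%N && (v <= l i <= v.+1)%N.
transitivity (\prod_i \sum_(v | Q i v) (-1) ^+ (l i - v) : int).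
  rewrite bigA_distr_big_dep /=; apply: eq_big => [k|k /andP[_ kl]].
    apply/andP/familyP => [[/forallP h1 /forallP h2] i|H]; first by rewrite unfold_in /Q h1 h2.
    by split; apply/forallP => i; have := H i; rewrite unfold_in => /andP[].
  by rewrite (vstrip_weight kl) addKn expr_sum.
have [i lmi imin] : exists2 i, l i != m i & forall j, (j < i)%N -> l j = m j.
  have [i0 H0] : exists i, l i != m i.
    by apply/existsP; rewrite -negb_forall; apply: contra lm => /forallP H; apply/eqP/ffunP => i; apply/eqP.
  case: (@arg_minnP _ i0 (fun i => l i != m i) (fun i => nat_of_ord i)) => // i li imin.
  by exists i => // j ji; apply/eqP; apply: contraTT ji => /imin; rewrite -leqNgt.
(* Above row i the shapes agree, so this bound follows from l being a partition. *)
have above v : (v <= l i)%N -> (v <= row_above m i)%N.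
  move=> vl; apply: leq_trans vl _; have := forallP lp i; rewrite /row_above.
  case: eqP => // /eqP; rewrite -val_eqE /= => i0.
  rewrite (imin (inord i.-1)) // inordK; have := ltn_ord i; lia.
rewrite (bigD1 i) //= (_ : \sum_(v | _) _ = 0) ?mul0r //.
have [li|li|/val_inj E] := ltngtP (l i) (m i); last by rewrite E eqxx in lmi.
  by rewrite big1 // => v; rewrite /Q; lia.
have li1 : ((l i).-1 < b.+1)%N by have := ltn_ord (l i); lia.
rewrite (bigD1 (l i)) /=; last by rewrite /Q; have := above (l i); lia.
rewrite (bigD1 (Ordinal li1)) /=; last first.
  by rewrite /Q -val_eqE /=; have := above (l i).-1; lia.
rewrite big1 ?addr0 => [|v]; last by rewrite /Q -!val_eqE /=; lia.
by rewrite subnn (_ : (l i - (l i).-1)%N = 1%N); [rewrite expr0 expr1 addrN | lia].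
Qed.
End VerticalStrips.

Section Expansions.
Variables (A : nzRingType) (u : nat -> A).
Hypothesis u_sq : forall a, u a * u a = 0.
Hypothesis u_far : forall a b, (a.+1 < b)%N -> u a * u b = u b * u a.
Hypothesis u_braid : forall a, u a * u a.+1 * u a = u a.+1 * u a * u a.+1.
Variables (C d b : nat).
Hypothesis bbig : (C + d < b)%N.
Implicit Types (l m k : {ffun 'I_d.+1 -> 'I_b.+1}).
Local Notation schur := (schur u_sq u_far u_braid C).

Definition vsum m r := \sum_(l | [&& is_part l, vstrip m l & weight l == weight m + r]%N) schur l.

(** The counterpart of [ee_hh] on shapes: after exchanging the sums each Schur element carries the
    signed count of [strip_sign], which is 0 because r > 0 makes l differ from m. *)
Lemma vsum_alternating m (r : nat) : is_part m -> (0 < r)%N ->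
  \sum_(0 <= j < r.+1) (-1) ^+ j *
    \sum_(k | hstrip m k && (weight k == weight m + (r - j))%N) vsum k j = 0.
Proof.
move=> mp r0.
pose X k := \sum_(l | [&& is_part l, vstrip k l & weight l == weight m + r]%N)
   schur l *~ (-1) ^+ (weight l - weight k).
transitivity (\sum_(k | hstrip m k) X k).
  transitivity (\sum_(k | hstrip m k) \sum_(j < r.+1)
     if (weight k == weight m + (r - j))%N then (-1) ^+ j * vsum k j else 0).
    rewrite exchange_big /= big_mkord; apply: eq_bigr => j _.
    rewrite big_mkcondr big_distrr /=; apply: eq_bigr => k _.
    by case: eqP; rewrite ?mulr0.
  apply: eq_bigr => k mk; have wk := hstrip_weight mk.
  case: (leqP (weight k) (weight m + r)) => kr; last first.
    rewrite big1 => [|j _]; last by case: eqP => //; lia.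
    rewrite /X big1 // => l /and3P[_ /vstrip_weight lw /eqP]; lia.
  have jr : (weight m + r - weight k < r.+1)%N by lia.
  rewrite (bigD1 (Ordinal jr)) //= big1 ?addr0 => [|j]; last first.
    by rewrite -val_eqE /= => jn; case: eqP => //; have := ltn_ord j; lia.
  rewrite (_ : (_ == _) = true); last by lia.
  rewrite /vsum big_distrr /=; apply: eq_big => [l|l /and3P[_ _ /eqP lw]].
    by congr [&& _, _ & _]; lia.
  rewrite -[in RHS]mulrzl -signr_odd rmorph_sign signr_odd; congr (_ ^+ _ * _); lia.
rewrite /X (exchange_big_dep (fun l => is_part l && (weight l == weight m + r)%N)) /=; last first.
  by move=> k l _ /and3P[-> _ ->].
apply: big1 => l /andP[lp lw].
rewrite -mulrz_sumr.
rewrite (eq_bigl (fun k => hstrip m k && vstrip k l)); last by move=> k; rewrite lp lw andbT.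
rewrite strip_sign ?mulr0z //; apply/eqP => lm; move: lw; rewrite lm; lia.
Qed.

(** [ee_hh] times [schur m] and [vsum_alternating] are two alternating relations whose terms below r
    agree by [h_schur] and induction; so their last terms agree. *)
Lemma e_schur m (r : nat) : is_part m -> (weight m + r <= d)%N ->
  ee u C r%:Z * schur m = vsum m r.
Proof.
elim: r {-2}r (leqnn r) m => [|n IH] r rn m mp wm; case: (posnP r) => [r0|r0]; try lia.
1, 2: rewrite r0 ee_0 mul1r /vsum (big_pred1 m) // => l /=; rewrite addn0;
  apply/and3P/eqP => [[_ /forallP v /eqP w]|->]; rewrite ?vstrip_refl //;
  by apply: weight_eq w => i; have /andP[] := v i.
have last0 k : is_part k -> (weight k <= d)%N -> k ord_max = ord0 by exact: part_last.
have := vsum_alternating mp r0.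
have := congr1 (fun x => x * schur m) (ee_hh u_sq C r).
rewrite /= (gtn_eqF r0) mul0r big_distrl /= !big_nat_recr //= subrr hh_0 mulr1.
rewrite subnn addn0 (big_pred1 m) => [E1 E2|k]; last first.
  apply/andP/eqP => [[mk /eqP w]|->]; last by rewrite hstrip_refl ?eqxx.
  by apply: weight_eq w => i; apply: hstrip_le.
suff E : \sum_(0 <= i < r) (-1) ^+ i * ee u C i%:Z * hh u C (r%:Z - i%:Z) * schur m =
  \sum_(0 <= i < r) (-1) ^+ i *
       (\sum_(k | hstrip m k && (weight k == weight m + (r - i))%N) vsum k i).
  move: E1; rewrite E => E1; have /addrI := etrans E1 (esym E2); rewrite -mulrA.
  by move/(congr1 (fun x => (-1) ^+ r * x)); rewrite !mulrA -!expr2 !sqrr_sign !mul1r.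
rewrite big_nat [RHS]big_nat; apply: eq_bigr => j /andP[_ jr].
rewrite -!mulrA; congr (_ * _).
rewrite (_ : r%:Z - j%:Z = (r - j)%N%:Z)%R; last by lia.
rewrite h_schur //; [|by apply: last0 => //; lia|by lia].
rewrite big_distrr /=; apply: eq_bigr => k /andP[mk /eqP wk].
apply: IH; [lia | exact: hstrip_part mk | lia].
Qed.

(* The numbers of chains of horizontal, respectively vertical, strips from the
   empty shape to [l]; the head of [s] is the size of the outermost strip. *)
Fixpoint hcount (s : seq nat) l : nat :=
  if s is r :: s' then
    \sum_(m | [&& is_part m, hstrip m l & weight l == weight m + r]) hcount s' m
  else (l == [ffun=> ord0]).
Fixpoint vcount (s : seq nat) l : nat :=
  if s is r :: s' then
    \sum_(m | [&& is_part m, vstrip m l & weight l == weight m + r]) vcount s' m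
  else (l == [ffun=> ord0]).

Lemma weight0 : weight ([ffun=> ord0] : {ffun 'I_d.+1 -> 'I_b.+1}) = 0%N.
Proof. by rewrite /weight big1 // => i _; rewrite ffunE. Qed.

Lemma hcount_weight s l : hcount s l != 0%N -> weight l = sumn s.
Proof.
elim: s l => [|r s IH] l /=; first by rewrite eqb0 negbK => /eqP ->; exact: weight0.
rewrite sum_nat_eq0 negb_forall => /existsP[m]; rewrite negb_imply.
by move=> /andP[/and3P[_ _ /eqP ->] /IH ->]; rewrite addnC.
Qed.

Lemma vcount_weight s l : vcount s l != 0%N -> weight l = sumn s.
Proof.
elim: s l => [|r s IH] l /=; first by rewrite eqb0 negbK => /eqP ->; exact: weight0.
rewrite sum_nat_eq0 negb_forall => /existsP[m]; rewrite negb_imply.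
by move=> /andP[/and3P[_ _ /eqP ->] /IH ->]; rewrite addnC.
Qed.

Lemma part0 : is_part ([ffun=> ord0] : {ffun 'I_d.+1 -> 'I_b.+1}).
Proof. by apply/forallP => i; rewrite ffunE. Qed.

Lemma h_expansion s : (sumn s <= d)%N ->
  \prod_(r <- s) hh u C r%:Z = \sum_(l | is_part l) schur l *+ hcount s l.
Proof.
elim: s => [_|r s IH] /=.
  rewrite big_nil (bigD1 [ffun=> ord0]) /=; last exact: part0.
  rewrite eqxx mulr1n schur0 // big1 ?addr0 // => l /andP[_ /negPf ->]; exact: mulr0n.
move=> sd; rewrite big_cons IH; last by lia.
rewrite big_distrr /=; under [RHS]eq_bigr do rewrite -sumrMnr.
rewrite (exchange_big_dep (@is_part d b)) /=; last by move=> l m _ /and3P[].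
apply: eq_bigr => m mp; rewrite mulrnAr.
have [->|/hcount_weight wm] := eqVneq (hcount s m) 0%N.
  by rewrite mulr0n; apply/esym/big1 => l _; rewrite mulr0n.
rewrite h_schur //; [|by apply: part_last => //; lia|by lia].
rewrite -sumrMnl; apply: eq_bigl => l; rewrite mp /=.
case mk : (hstrip m l); rewrite ?andbF //= (hstrip_part mp mk) /= //.
Qed.

Lemma e_expansion s : (sumn s <= d)%N ->
  \prod_(r <- s) ee u C r%:Z = \sum_(l | is_part l) schur l *+ vcount s l.
Proof.
elim: s => [_|r s IH] /=.
  rewrite big_nil (bigD1 [ffun=> ord0]) /=; last exact: part0.
  rewrite eqxx mulr1n schur0 // big1 ?addr0 // => l /andP[_ /negPf ->]; exact: mulr0n.
move=> sd; rewrite big_cons IH; last by lia.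
rewrite big_distrr /=; under [RHS]eq_bigr do rewrite -sumrMnr.
rewrite (exchange_big_dep (@is_part d b)) /=; last by move=> l m _ /and3P[].
apply: eq_bigr => m mp; rewrite mulrnAr.
have [->|/vcount_weight wm] := eqVneq (vcount s m) 0%N.
  by rewrite mulr0n; apply/esym/big1 => l _; rewrite mulr0n.
rewrite e_schur //; last by lia.
by rewrite -sumrMnl; apply: eq_bigl => l; rewrite mp.
Qed.
End Expansions.

(** * Counting semistandard tableaux *)
Local Open Scope nat_scope.

(** Duplicate-free lists with the same elements have the same length, whichever of them [epsilon]
    picks. *)
Lemma fcard_eq (T : eqType) (P : T -> Prop) (s : seq T) :
  uniq s -> (forall x, P x <-> x \in s) -> Defs.fcard P = size s.
Proof.
move=> us sP; rewrite /Defs.fcard.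
set Q := fun _ => _.
have [ut tP] : Q (epsilon (inhabits [::]) Q) by apply: epsilon_spec; exists s.
apply: perm_size; apply: uniq_perm => // x.
by apply/idP/idP => H; [apply/sP/tP | apply/tP/sP].
Qed.

(** Used for a sorted row, where the copies of the largest entry come last, for the zero rows of a
    shape and for the empty rows of a padded tableau. *)
Lemma filter_nseq_split (T : eqType) (p : pred T) (x : T) (L : seq T) :
  pairwise (fun y z => p z ==> p y) L -> {in L, forall y, ~~ p y -> y = x} ->
  L = filter p L ++ nseq (size L - count p L) x.
Proof.
elim: L => //= y L IH /andP[/allP yL pL] Lx.
have {}IH := IH pL (fun z zL => Lx z (mem_behead (s := y :: L) zL)).
case: ifP => [_|/negbT py]; first by rewrite add1n subSS /= -IH.
have c0 : count p L = 0.
  by apply/eqP; rewrite -leqn0 leqNgt -has_count; apply/hasPn => z zL; apply: contra py; exact/implyP/yL.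
have -> : filter p L = [::] by apply/nilP; rewrite /nilp size_filter c0.
rewrite add0n c0 subn0 /= [in LHS](Lx y) ?mem_head //; congr (_ :: _).
by rewrite {1}IH c0 subn0 (_ : filter p L = [::]) //; apply/nilP; rewrite /nilp size_filter c0.
Qed.

Section Tableaux.
Variables d b : nat.
Implicit Types (l m : {ffun 'I_d.+1 -> 'I_b.+1}) (T : seq (seq nat)) (s : seq nat).

Definition add_strip n l m T : seq (seq nat) :=
  mkseq (fun i => nth [::] T i ++ nseq (l (inord i) - m (inord i)) n) d.+1.

Fixpoint tabs s l : seq (seq (seq nat)) :=
  if s is r :: s' then
    [seq add_strip (size s) l m T |
       m <- [seq m <- enum {: {ffun 'I_d.+1 -> 'I_b.+1}} | [&& is_part m, hstrip m l & weight l == weight m + r]],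
       T <- tabs s' m]
  else if l == [ffun=> ord0] then [:: nseq d.+1 [::]] else [::].

Lemma size_tabs s l : size (tabs s l) = hcount s l.
Proof.
elim: s l => [|r s IH] l; first by rewrite /=; case: eqP.
rewrite /tabs -/tabs size_allpairs_dep sumnE big_map big_filter big_enum_cond /=.
by apply: eq_big => // m; rewrite inE.
Qed.

(* Tableaux padded with empty rows: the shape may have fewer than d+1 rows. *)
Record padded s l T : Prop := Padded {
  pad_size : size T = d.+1;
  pad_row : forall i : 'I_d.+1, size (nth [::] T i) = l i;
  pad_ent : all (all (fun e => 0 < e <= size s)) T;
  pad_sort : all (sorted leq) T;
  pad_col : forall r c, r < d -> c < size (nth [::] T r.+1) ->
     nth 0 (nth [::] T r) c < nth 0 (nth [::] T r.+1) c;
  pad_cont : forall k, count_mem k.+1 (flatten T) = nth 0 (rev s) k }.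

Definition restrict n T := [seq filter (fun e => e < n) r | r <- T].

Lemma pad_row_nat s l T i : padded s l T -> i < d.+1 -> size (nth [::] T i) = l (inord i).
Proof. by move=> pT iD; have := pad_row pT (inord i); rewrite inordK. Qed.

Lemma pad_ent_nth s l T i e : padded s l T -> e \in nth [::] T i -> 0 < e <= size s.
Proof.
move=> pT; case: (ltnP i (size T)) => iT; last by rewrite nth_default.
by move: e; apply/allP; apply: (allP (pad_ent pT)); apply: mem_nth.
Qed.

Lemma add_stripK s l m T n : padded s m T -> size s < n -> restrict n (add_strip n l m T) = T.
Proof.
move=> pT sn; apply: (@eq_from_nth _ [::]); rewrite size_map size_mkseq ?(pad_size pT) // => i iD.
rewrite (nth_map [::]) ?size_mkseq // nth_mkseq // filter_cat [X in _ ++ X]filter_nseq ltnn cats0.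
apply/all_filterP/allP => e /(pad_ent_nth pT) /andP[_ es]; lia.
Qed.

Lemma padded_shape s l m T : padded s l T -> padded s m T -> l = m.
Proof.
move=> pl pm; apply/ffunP => i; apply: val_inj => /=.
by rewrite -(pad_row pl) (pad_row pm).
Qed.

Lemma count_flatten_mkseq (f : nat -> seq nat) n p :
  count p (flatten (mkseq f n)) = \sum_(i < n) count p (f i).
Proof. by rewrite count_flatten sumnE -map_comp big_map -{1}[n]subn0 -/(index_iota 0 n) big_mkord. Qed.

Lemma flatten_pad s l T p : padded s l T ->
  count p (flatten T) = \sum_(i < d.+1) count p (nth [::] T i).
Proof.
move=> pT; rewrite -count_flatten_mkseq; congr (count _ (flatten _)).
by rewrite -{1}(mkseq_nth [::] T) (pad_size pT).
Qed.

Lemma padded_add r s l m T : is_part m -> hstrip m l -> weight l = weight m + r ->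
  padded s m T -> padded (r :: s) l (add_strip (size s).+1 l m T).
Proof.
move=> mp ml lw pT; have le_ml i : m i <= l i by exact: hstrip_le.
split.
- by rewrite size_mkseq.
- move=> i; rewrite nth_mkseq // inord_val size_cat size_nseq (pad_row pT) subnKC //.
- apply/allP => w /mapP[i]; rewrite mem_iota => /andP[_ iD] ->; rewrite all_cat all_nseq.
  rewrite ltnSn /= orbT andbT; apply/allP => e /(pad_ent_nth pT) /=; lia.
- apply/allP => w /mapP[i]; rewrite mem_iota /= => iD ->.
  rewrite sorted_pairwise; last exact: leq_trans.
  rewrite pairwise_cat; apply/and3P; split.
  + by apply/allrelP => e f /(pad_ent_nth pT) es; rewrite mem_nseq => /andP[_ /eqP ->]; lia.
  + rewrite -sorted_pairwise; last exact: leq_trans.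
    by apply: (allP (pad_sort pT)); rewrite mem_nth // (pad_size pT).
  + by elim: (_ - _) => //= n ->; rewrite all_nseq leqnn orbT.
- move=> i c iD; have iD1 : i < d.+1 by exact: ltnW.
  rewrite !nth_mkseq // !size_cat !size_nseq.
  rewrite (pad_row_nat pT) // subnKC // => cl.
  have cm : c < m (inord i).
    apply: leq_trans cl _; have /andP[_] := forallP ml (inord i.+1).
    by rewrite (row_above_succ m (inordK (iD : i.+1 < d.+1))).
  rewrite !nth_cat !(pad_row_nat pT) // cm.
  case: (ltnP c (m (inord i.+1))) => cm'; first by apply: (pad_col pT iD); rewrite (pad_row_nat pT).
  rewrite nth_nseq ifT; last by lia.
  have /(pad_ent_nth pT) : nth 0 (nth [::] T i) c \in nth [::] T i.
    by rewrite mem_nth // (pad_row_nat pT) // ltnW.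
  by lia.
- move=> k; rewrite count_flatten_mkseq.
  under eq_bigr => i _ do rewrite count_cat count_nseq inord_val.
  rewrite big_split /= -(flatten_pad _ pT) (pad_cont pT) rev_cons nth_rcons size_rev eqSS.
  case: ltngtP => ks.
  + by rewrite big1 ?addn0 // => i _; rewrite eqSS (gtn_eqF ks).
  + by rewrite big1 ?addn0 ?nth_default ?size_rev ?(ltnW ks) // => i _; rewrite eqSS (ltn_eqF ks).
  + rewrite ks nth_default ?size_rev // add0n.
    under eq_bigr do rewrite mul1n.
    by apply/eqP; rewrite -(eqn_add2l (weight m)) -lw (hstrip_weight ml).
Qed.

Lemma restrict_row s r l T i : padded (r :: s) l T ->
  let w := nth [::] T i in
  w = filter (fun e => e < (size s).+1) w ++
      nseq (size w - count (fun e => e < (size s).+1) w) (size s).+1.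
Proof.
move=> pT w; apply: filter_nseq_split.
  have : sorted leq w.
    rewrite /w; case: (ltnP i (size T)) => iT; last by rewrite nth_default.
    by apply: (allP (pad_sort pT)); rewrite mem_nth.
  rewrite sorted_pairwise; last exact: leq_trans.
  by apply: sub_pairwise => x y xy; apply/implyP; exact: leq_ltn_trans.
by move=> e /(pad_ent_nth pT) /=; lia.
Qed.
(** The copies of the largest letter end their rows, and strict columns allow at most one in each
    column, so the cells removed form a horizontal strip. *)
Lemma padded_restrict r s l T : is_part l -> padded (r :: s) l T ->
  exists m, [/\ is_part m, hstrip m l, weight l = weight m + r, padded s m (restrict (size s).+1 T)
     & T = add_strip (size s).+1 l m (restrict (size s).+1 T)].
Proof.
move=> lp pT; set n := (size s).+1; set p := fun e => e < n.
have sT := pad_size pT.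
have rowE (i : 'I_d.+1) : nth [::] (restrict n T) i = filter p (nth [::] T i).
  by rewrite (nth_map [::]) // sT.
pose m : {ffun 'I_d.+1 -> 'I_b.+1} := [ffun i : 'I_d.+1 => inord (count p (nth [::] T i))].
have mE (i : 'I_d.+1) : m i = count p (nth [::] T i) :> nat.
  rewrite ffunE inordK // (leq_ltn_trans (count_size _ _)) // (pad_row pT); exact: ltn_ord.
have small (i : 'I_d.+1) c : c < m i -> nth 0 (nth [::] T i) c = nth 0 (filter p (nth [::] T i)) c.
  by move=> cm; rewrite {1}(restrict_row i pT) nth_cat size_filter -/n -/p -mE cm.
have ml : hstrip m l.
  apply/forallP => i; rewrite mE -(pad_row pT) count_size /=.
  rewrite /row_above; case: eqP => [_|/eqP]; first by rewrite (pad_row pT) -ltnS.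
  rewrite -val_eqE /= => i0; have iD := ltn_ord i.
  set j : 'I_d.+1 := inord i.-1.
  have jE : j = i.-1 :> nat by rewrite inordK //; lia.
  have iS : i = j.+1 :> nat by lia.
  (* Otherwise row j has the largest letter in column m j, and row i has a cell below it, which
     would need a larger entry. *)
  rewrite leqNgt; apply/negP => lt.
  have jd : j < d by lia.
  have := @pad_col _ _ _ pT j (m j) jd; rewrite -iS => /(_ lt).
  have : nth 0 (nth [::] T i) (m j) \in nth [::] T i by exact: mem_nth.
  move=> /(pad_ent_nth pT) /andP[_ /= le1].
  have cl : m j < size (nth [::] T j).
    rewrite (pad_row pT); apply: leq_trans (is_part_le (i := j) (j := i) lp _); last by rewrite iS.
    by rewrite -(pad_row pT).
  rewrite (restrict_row j pT) nth_cat size_filter -/n -/p -mE ltnn subnn.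
  rewrite nth_nseq ifT /n; last by rewrite subn_gt0.
  by lia.
have mp : is_part m.
  apply/forallP => i; apply: leq_trans (hstrip_le i ml) _.
  by have /andP[] := forallP ml i.
have TE : T = add_strip n l m (restrict n T).
  apply: (@eq_from_nth _ [::]) => [|i]; first by rewrite size_mkseq sT.
  rewrite sT => iD; rewrite nth_mkseq // (nth_map [::]) ?sT // -/p.
  have := mE (inord i); rewrite inordK // => ->.
  by rewrite -(pad_row_nat pT iD) {1}(restrict_row i pT).
have cntn k : count_mem k.+1 (flatten T) = nth 0 (rev (r :: s)) k by apply: (pad_cont pT).
exists m; split=> //.
  have := cntn (size s); rewrite rev_cons nth_rcons size_rev ltnn eqxx => <-.
  rewrite (flatten_pad _ pT) (hstrip_weight ml); congr (_ + _); apply: eq_bigr => i _.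
  rewrite (restrict_row i pT) count_cat count_nseq /= eqxx mul1n -/n -/p -mE (pad_row pT).
  rewrite (_ : count _ _ = 0) //; apply/count_memPn; by rewrite mem_filter /p ltnn.
have rT : padded s m (restrict n T).
  split.
  - by rewrite size_map.
  - by move=> i; rewrite rowE size_filter mE.
  - apply/allP => w /mapP[w0 w0T ->]; apply/allP => e; rewrite mem_filter => /andP[en ew].
    by have := allP (allP (pad_ent pT) _ w0T) _ ew; rewrite /p /n in en *; lia.
  - apply/allP => w /mapP[w0 w0T ->]; apply: sorted_filter; first exact: leq_trans.
    exact: (allP (pad_sort pT)).
  - move=> i c iD; have iD1 : i < d.+1 by exact: ltnW.
    rewrite -[i.+1](@inordK d) // -{2}[i](@inordK d) // !rowE size_filter -mE => cl.
    have cm : c < m (inord i).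
      apply: leq_trans cl _; apply: is_part_le => //; rewrite !inordK //.
    rewrite -!small // !inordK //; apply: (pad_col pT) => //.
    have := pad_row_nat pT (iD : i.+1 < d.+1) => ->.
    by apply: leq_trans cl _; apply: hstrip_le.
  - move=> k; rewrite -filter_flatten; case: (ltnP k (size s)) => ks.
      rewrite count_filter; have := cntn k; rewrite rev_cons nth_rcons size_rev ks => <-.
      apply: eq_count => e /=; case: eqP => //= ->; rewrite /p /n; lia.
    rewrite nth_default ?size_rev //; apply/count_memPn; rewrite mem_filter /p /n; lia.
exact: rT.
Qed.

Lemma mem_tabs s l T : is_part l -> T \in tabs s l <-> padded s l T.
Proof.
elim: s l T => [|r s IH] l T lp.
  rewrite /tabs; case: eqP => [->|l0]; last first.
    split=> // pT; case: l0; apply/ffunP => i; apply: val_inj; rewrite ffunE /= -(pad_row pT).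
    case E: (nth [::] T i) => [|e w] //.
    have /(pad_ent_nth pT) /= : e \in nth [::] T i by rewrite E mem_head.
    by lia.
  rewrite inE; split=> [/eqP ->|pT].
    split=> //.
    - by rewrite size_nseq.
    - by move=> i; rewrite nth_nseq ltn_ord ffunE.
    - by apply/allP => w; rewrite mem_nseq => /andP[_ /eqP ->].
    - by apply/allP => w; rewrite mem_nseq => /andP[_ /eqP ->].
    - by move=> i c iD; rewrite nth_nseq if_same.
    - by move=> k; rewrite nth_nil; elim: (d.+1) => //= n.
  apply/eqP; apply: (@eq_from_nth _ [::]); rewrite ?size_nseq ?(pad_size pT) // => i iD.
  rewrite nth_nseq iD; case E: (nth [::] T i) => [|e w] //.
  have /(pad_ent_nth pT) /= : e \in nth [::] T i by rewrite E mem_head.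
  by lia.
rewrite /tabs -/tabs; split.
  move=> /allpairsPdep [m [T' [mM T'm ->]]]; move: mM; rewrite mem_filter => /andP[/and3P[mp ml /eqP lw] _].
  by apply: padded_add => //; apply/IH.
move=> pT; have [m [mp ml lw pT' TE]] := padded_restrict lp pT.
apply/allpairsPdep; exists m, (restrict (size s).+1 T); split=> //.
  by rewrite mem_filter mp ml lw eqxx mem_enum.
exact/IH.
Qed.

Lemma uniq_tabs s l : is_part l -> uniq (tabs s l).
Proof.
elim: s l => [|r s IH] l lp; first by rewrite /=; case: eqP.
rewrite /tabs -/tabs; apply: allpairs_uniq_dep => [|m|].
- by apply: filter_uniq; exact: enum_uniq.
- by rewrite mem_filter => /andP[/and3P[mp _ _] _]; exact: IH.
move=> _ _ /allpairsPdep [m [T [mM Tm ->]]] /allpairsPdep [m' [T' [mM' Tm' ->]]] /=.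
move: mM mM'; rewrite !mem_filter => /andP[/and3P[mp _ _] _] /andP[/and3P[mp' _ _] _].
move: Tm Tm' => /(mem_tabs _ _ mp) pT /(mem_tabs _ _ mp') pT'.
move/(congr1 (restrict (size s).+1)); rewrite (@add_stripK s l m T _ pT) // (@add_stripK s l m' T' _ pT') // => E.
by rewrite -E in pT' *; rewrite (padded_shape pT pT').
Qed.

Definition shape_seq l := [seq r <- [seq (l i : nat) | i <- enum 'I_d.+1] | 0 < r].

Lemma sizes_padded s l T : padded s l T -> [seq size r | r <- T] = [seq (l i : nat) | i <- enum 'I_d.+1].
Proof.
move=> pT; apply: (@eq_from_nth _ 0) => [|i].
  by rewrite size_map [RHS]size_map size_enum_ord (pad_size pT).
rewrite size_map (pad_size pT) => iD.
rewrite (nth_map [::]) ?(pad_size pT) // (pad_row_nat pT) // (nth_map (inord i)) ?size_enum_ord //.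
by congr (nat_of_ord (l _)); apply: val_inj; rewrite /= nth_enum_ord // inordK.
Qed.

Definition unpad T := [seq r <- T | r != [::]].
Definition pad T := T ++ nseq (d.+1 - size T) [::].

Lemma unpad_shape s l T : padded s l T -> [seq size r | r <- unpad T] = shape_seq l.
Proof.
move=> pT; rewrite /shape_seq -(sizes_padded pT) filter_map; congr map.
by apply: eq_filter => -[].
Qed.

Lemma unpadK s l T : is_part l -> padded s l T -> pad (unpad T) = T.
Proof.
move=> lp pT; rewrite /pad [RHS](@filter_nseq_split _ (fun r => r != [::]) [::] T).
- by rewrite -(pad_size pT) -size_filter.
- have : pairwise geq [seq size r | r <- T].
    rewrite (sizes_padded pT) pairwise_map.
    apply/(pairwiseP ord0) => i j; rewrite !inE size_enum_ord => iD jD ij /=.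
    by apply: is_part_le => //; rewrite !nth_enum_ord // ltnW.
  rewrite pairwise_map; apply: sub_pairwise => x y /=; case: x => //; case: y => //.
- by move=> y _; rewrite negbK => /eqP.
Qed.

(** Dropping empty rows is a bijection from padded tableaux to tableaux. The head of the list in
    [hcount] belongs to the outermost strip, that is to the largest letter; hence the reversal. *)
Lemma schur_coeff_hcount l al : is_part l ->
  schur_coeff (shape_seq l) al = hcount (rev al) l.
Proof.
move=> lp; rewrite -size_tabs -(size_map unpad); apply: fcard_eq.
  rewrite map_inj_in_uniq ?uniq_tabs // => T T' /(mem_tabs _ _ lp) pT /(mem_tabs _ _ lp) pT' E.
  by rewrite -(unpadK lp pT) -(unpadK lp pT') E.
move=> T; split; last first.
  move=> /mapP[{}T /(mem_tabs _ _ lp) pT ->]; split; last first.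
    move=> k; have := pad_cont pT k; rewrite revK => <-; rewrite -[in RHS](unpadK lp pT) /pad.
    rewrite flatten_cat count_cat (_ : flatten (nseq _ _) = [::]) ?addn0 //.
    by elim: (_ - _).
  have uT : {subset unpad T <= T} by move=> r; rewrite mem_filter => /andP[].
  split.
  - exact: unpad_shape pT.
  - apply/allP => r /uT rT; apply/allP => e er.
    by have /andP[] := allP (allP (pad_ent pT) _ rT) _ er.
  - by apply/allP => r /uT rT; apply: (allP (pad_sort pT)).
  - move=> r c rT cr.
    have nE i : i < size (unpad T) -> nth [::] (unpad T) i = nth [::] T i.
      by move=> iT; rewrite -[in RHS](unpadK lp pT) nth_cat iT.
    rewrite !nE // ?(ltnW rT) // in cr *; apply: (pad_col pT) => //.
    rewrite -ltnS -(pad_size pT); apply: leq_trans rT _; rewrite size_filter; exact: count_size.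
move=> [[shp pos srt col] cont].
have ne r : r \in T -> r != [::].
  move=> rT; have : size r \in shape_seq l by rewrite -shp map_f.
  by rewrite mem_filter => /andP[]; case: r {rT}.
have TE : unpad (pad T) = T.
  rewrite /unpad /pad filter_cat (_ : filter _ (nseq _ _) = [::]) ?cats0.
    by apply/all_filterP/allP.
  by elim: (_ - _).
rewrite -TE; apply: map_f; apply/(mem_tabs _ _ lp).
have sT : size T <= d.+1.
  rewrite -(size_map size) shp size_filter (leq_trans (count_size _ _)) //.
  by rewrite [size (map _ _)]size_map size_enum_ord.
have shE : [seq size r | r <- pad T] = [seq (l i : nat) | i <- enum 'I_d.+1].
  rewrite map_cat shp map_nseq [RHS](@filter_nseq_split _ (fun r => 0 < r) 0).
  - have sz : size [seq (l i : nat) | i <- enum 'I_d.+1] = d.+1 by rewrite size_map size_enum_ord.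
    by rewrite -size_filter sz -/(shape_seq l) -shp size_map.
  - rewrite pairwise_map; apply/(pairwiseP ord0) => i j; rewrite !inE size_enum_ord => iD jD ij /=.
    apply/implyP => /leq_trans; apply; by apply: is_part_le => //; rewrite !nth_enum_ord // ltnW.
  - by move=> y _; rewrite -eqn0Ngt => /eqP.
have nthp i : i < size T -> nth [::] (pad T) i = nth [::] T i by move=> iT; rewrite nth_cat iT.
have nthe i : size T <= i -> nth [::] (pad T) i = [::].
  by move=> iT; rewrite nth_cat ltnNge iT /= nth_nseq if_same.
have fl : flatten (pad T) = flatten T.
  by rewrite flatten_cat (_ : flatten (nseq _ _) = [::]) ?cats0 //; elim: (_ - _).
split.
- by rewrite size_cat size_nseq subnKC.
- move=> i; have := congr1 (fun x => nth 0 x i) shE.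
  rewrite (nth_map [::]) ?size_cat ?size_nseq ?subnKC // => ->.
  by rewrite (nth_map i) ?size_enum_ord // nth_ord_enum.
- rewrite all_cat (_ : all _ (nseq _ _)) ?andbT; last by elim: (_ - _).
  apply/allP => r rT; apply/allP => e er; rewrite (allP (allP pos _ rT) _ er) /=.
  (* An entry beyond the length of al would have to occur zero times. *)
  case: e er => // e er; rewrite size_rev ltnNge; apply/negP => le.
  have := cont e; rewrite nth_default // => /count_memPn; rewrite /=.
  by move/negP; apply; apply/flattenP; exists r.
- by rewrite all_cat srt; elim: (_ - _).
- move=> r c rD; case: (ltnP r.+1 (size T)) => rT; last by rewrite nthe.
  by rewrite (nthp r.+1) // (nthp r) ?(ltnW rT) // => cT; exact: col.
- by move=> k; rewrite fl revK cont.
Qed.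
End Tableaux.

(** * The nilCoxeter module of geodesics and the omega symmetry *)
Local Open Scope ring_scope.

Section Omega.
Variables (A : nzRingType) (u : nat -> A) (phi : {additive A -> int}).
Hypothesis u_sq : forall a, u a * u a = 0.
Hypothesis u_far : forall a b, (a.+1 < b)%N -> u a * u b = u b * u a.
Hypothesis u_braid : forall a, u a * u a.+1 * u a = u a.+1 * u a * u a.+1.
Hypothesis phi_even : forall k M, phi (u k.*2 * M) = 0.
Variable K : nat.
Hypothesis phi_odd : forall k M, (k < K)%N ->
  phi (u k.*2.+1 * u k.*2 * M) = phi (u k.*2.+1 * u k.*2.+2 * M).

(** Next to phi a leading even letter gives 0, and after u_(2k+1) the letter u_(2k) may be traded
    for u_(2k+2), which passes all letters below 2k. This trade is the reason why [ee] has one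
    letter more than [hh]. *)
Lemma phi_hh_even k p M : (k <= K)%N -> phi (hh u k.*2 p * M) = phi (ee u k.*2.+1 p * M).
Proof.
elim: k p M => [|k IH] p M kK.
  rewrite eeS mulrDl raddfD /= -mulrA [X in _ + X](_ : _ = 0) ?addr0 //.
  by case: (p - 1 == 0); rewrite ?mul1r ?mul0r ?raddf0 // (phi_even 0).
have far a r : (k.*2 < a)%N -> u a * hh u k.*2 r = hh u k.*2 r * u a by exact: hh_far.
have {}IH q M' := IH q M' (ltnW kK).
rewrite doubleS !hhS (eeS u k.*2.+2 p) (eeS u k.*2.+1 p) (eeS u k.*2.+1 (p - 1)).
move: IH far; set g := hh u k.*2; set E := ee u k.*2.+1; clearbody g E => IH far.
have R0 : phi (E (p - 1) * (u k.*2.+2 * M)) = 0.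
  by rewrite -IH mulrA -far // -mulrA -doubleS phi_even.
rewrite !(mulrDr, mulrDl) !raddfD /= -!mulrA phi_even addr0 R0 add0r.
rewrite (mulrA (u k.*2.+1) (u k.*2)) phi_odd // !(mulrA (u _) (g _)) !far // -!mulrA.
by rewrite (mulrA (u k.*2.+2) (g _)) far // -mulrA (mulrA (u k.*2.+1) (g _)) far // -mulrA !IH addrA.
Qed.

Lemma phi_hh p M : phi (hh u K.*2.+1 p * M) = phi (ee u K.*2.+1 p * M).
Proof. by rewrite -phi_hh_even // hhS mulrDl raddfD /= -mulrA phi_even addr0. Qed.

(** Only the factor next to phi can be converted. The resulting [ee] moves past the remaining [hh]
    to make room for the next conversion, which reverses the order. *)
Lemma phi_hh_ee (s : seq nat) :
  phi (\prod_(r <- s) hh u K.*2.+1 r%:Z) = phi (\prod_(r <- rev s) ee u K.*2.+1 r%:Z).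
Proof.
suff H M : phi (\prod_(r <- s) hh u K.*2.+1 r%:Z * M) = phi (\prod_(r <- rev s) ee u K.*2.+1 r%:Z * M).
  by have := H 1; rewrite !mulr1.
elim: s M => [|r s IH] M; first by rewrite !big_nil.
rewrite big_cons rev_cons -cats1 big_cat big_seq1 /= -[in RHS]mulrA -IH.
rewrite -mulrA phi_hh 2!mulrA; congr (phi (_ * _)).
suff: GRing.comm (ee u K.*2.+1 r%:Z) (\prod_(j <- s) hh u K.*2.+1 j%:Z) by [].
by apply: commr_prod => j _; exact: ee_hhC.
Qed.
End Omega.

(** * Matrices of an action that must raise a length *)

Section GeodesicRepresentation.
Variables (X : finType) (N : nat) (rk : X -> 'I_N.+1) (vl : 'I_N.+1 -> X).
Hypotheses (rkK : cancel rk vl) (vlK : cancel vl rk).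
Variables (act : nat -> X -> X) (L : X -> nat) (C : nat).
Hypothesis Lact : forall c x, (c < C)%N -> (L (act c x) <= (L x).+1)%N.

Definition acts (w : seq nat) x := foldl (fun y c => act c y) x w.

(* On row vectors, [umx c] sends the basis vector of x to that of [act c x] when
   this increases [L] by one, and to 0 otherwise. *)
Definition umx c : 'M[int]_N.+1 :=
  \matrix_(i, j) ([&& c < C, act c (vl i) == vl j & L (vl j) == (L (vl i)).+1]%N : nat)%:Z.

Definition ev x : 'rV[int]_N.+1 := delta_mx 0 (rk x).

Lemma ev_umx c x : ev x *m umx c =
  if (c < C)%N && (L (act c x) == (L x).+1) then ev (act c x) else 0.
Proof.
rewrite /ev -rowE; apply/rowP => j; rewrite !mxE rkK.
have [Ej|nE] := eqVneq (act c x) (vl j).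
  by rewrite Ej /=; case: ifP => _; rewrite !mxE ?vlK ?eqxx.
rewrite andbF; case: ifP => _; rewrite !mxE //= (_ : (j == _) = false) //.
by apply/eqP => jE; rewrite jE rkK eqxx in nE.
Qed.

Lemma ev_inj (M M' : 'M[int]_N.+1) : (forall x, ev x *m M = ev x *m M') -> M = M'.
Proof. by move=> H; apply/row_matrixP => i; rewrite !rowE -[i]vlK; exact: H. Qed.

Lemma acts_cat w w' x : acts (w ++ w') x = acts w' (acts w x).
Proof. exact: foldl_cat. Qed.

Lemma L_acts w x : all (fun c => c < C)%N w -> (L (acts w x) <= L x + size w)%N.
Proof.
elim: w x => [|c w IH] x /=; first by rewrite addn0.
by move=> /andP[cC wC]; apply: leq_trans (IH _ wC) _; have := Lact x cC; lia.
Qed.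

(** A letter raises [L] by at most 1, so all steps of a word are raises exactly when the total rise
    equals its length: one condition on the endpoints suffices. *)
Lemma ev_word w x : ev x *m \prod_(c <- w) umx c =
  if all (fun c => c < C)%N w && (L (acts w x) == L x + size w)%N then ev (acts w x) else 0.
Proof.
elim: w x => [|c w IH] x /=; first by rewrite big_nil mulmx1 addn0 eqxx.
rewrite big_cons -mulmxE mulmxA ev_umx.
case: (ltnP c C) => cC /=; last by rewrite mul0mx.
have := Lact x cC; case: eqP => [Lc|Lc] Lx; last first.
  rewrite mul0mx; case: ifP => // /andP[wC /eqP E].
  by have := L_acts (act c x) wC; lia.
by rewrite IH Lc addSnnS.
Qed.

Lemma umx_words w w' : size w = size w' ->
  all (fun c => c < C)%N w = all (fun c => c < C)%N w' ->
  (all (fun c => c < C)%N w -> acts w =1 acts w') -> \prod_(c <- w) umx c = \prod_(c <- w') umx c.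
Proof.
move=> sw aw ww; apply: ev_inj => x; rewrite !ev_word sw -aw.
by case wC: (all _ w); rewrite //= ww.
Qed.

Hypothesis actK : forall c x, (c < C)%N -> act c (act c x) = x.
Hypothesis act_far : forall a b x, (a.+1 < b)%N -> (b < C)%N -> act b (act a x) = act a (act b x).
Hypothesis act_braid : forall a x, (a.+1 < C)%N ->
  act a (act a.+1 (act a x)) = act a.+1 (act a (act a.+1 x)).

Lemma umx_sq a : umx a * umx a = 0.
Proof.
apply: ev_inj => x; rewrite mulmx0; have := ev_word [:: a; a] x.
rewrite !big_cons big_nil mulr1 => ->; rewrite /= andbT; case: ifP => // /andP[/andP[aC _]].
by rewrite actK //; lia.
Qed.

Lemma umx_far a b : (a.+1 < b)%N -> umx a * umx b = umx b * umx a.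
Proof.
move=> ab; have := @umx_words [:: a; b] [:: b; a] erefl.
rewrite !big_cons big_nil !mulr1; apply; first by rewrite /= !andbT andbC.
by rewrite /= => /and3P[_ bC _] x /=; exact: act_far.
Qed.

Lemma umx_braid a : umx a * umx a.+1 * umx a = umx a.+1 * umx a * umx a.+1.
Proof.
have := @umx_words [:: a; a.+1; a] [:: a.+1; a; a.+1] erefl.
rewrite !big_cons big_nil !mulr1 !mulrA; apply; first by rewrite /=; lia.
by rewrite /= => /and4P[_ aC _ _] x /=; exact: act_braid.
Qed.

Definition nonneg_mx (M : 'M[int]_N.+1) := forall i j, 0 <= M i j.

Lemma nonneg_umx c : nonneg_mx (umx c).
Proof. by move=> i j; rewrite mxE. Qed.
Lemma nonneg0 : nonneg_mx 0. Proof. by move=> i j; rewrite mxE. Qed.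
Lemma nonneg1 : nonneg_mx 1. Proof. by move=> i j; rewrite mxE; case: eqP. Qed.
Lemma nonnegD M M' : nonneg_mx M -> nonneg_mx M' -> nonneg_mx (M + M').
Proof. by move=> m m' i j; rewrite mxE addr_ge0. Qed.
Lemma nonnegM M M' : nonneg_mx M -> nonneg_mx M' -> nonneg_mx (M * M').
Proof. by move=> m m' i j; rewrite -mulmxE mxE sumr_ge0 // => k _; rewrite mulr_ge0. Qed.

Variables x0 z : X.
Definition entry (M : 'M[int]_N.+1) : int := M (rk x0) (rk z).
Fact entry_additive : zmod_morphism entry.
Proof. by move=> M M'; rewrite /entry !mxE. Qed.
HB.instance Definition _ := GRing.isZmodMorphism.Build _ _ entry entry_additive.

Lemma entry_ev M : entry M = (ev x0 *m M) 0 (rk z).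
Proof. by rewrite /ev -rowE mxE. Qed.

Lemma entry_word w : entry (\prod_(c <- w) umx c) =
  ([&& all (fun c => c < C)%N w, acts w x0 == z & L z == L x0 + size w]%N : nat)%:Z.
Proof.
rewrite entry_ev ev_word; case: (all _ w) => /=; last by rewrite mxE.
have [->|nE] := eqVneq (acts w x0) z; first by case: eqP => _; rewrite mxE ?eqxx.
case: eqP => _; rewrite mxE //= (_ : (_ == _) = false) //.
by apply: contra_neqF nE => /eqP /(can_inj rkK).
Qed.

Hypothesis L0 : L x0 = 0%N.
Hypothesis act_even : forall k, (k.*2 < C)%N -> act k.*2 x0 = x0.
Hypothesis act_odd : forall k, (k.*2.+2 < C)%N ->
  acts [:: k.*2.+1; k.*2] x0 = acts [:: k.*2.+1; k.*2.+2] x0.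

Lemma entry_even k M : entry (umx k.*2 * M) = 0.
Proof.
rewrite entry_ev -mulmxE mulmxA ev_umx; case: ifP => [/andP[kC]|]; rewrite ?mul0mx ?mxE //.
by rewrite act_even // L0.
Qed.

Lemma entry_odd k M : (k.*2.+2 < C)%N ->
  entry (umx k.*2.+1 * umx k.*2 * M) = entry (umx k.*2.+1 * umx k.*2.+2 * M).
Proof.
move=> kC; have E a b : umx a * umx b = \prod_(c <- [:: a; b]) umx c.
  by rewrite !big_cons big_nil mulr1.
rewrite !E !entry_ev -!mulmxE !mulmxA !ev_word act_odd //=.
by rewrite !andbT kC (ltnW kC) (ltnW (ltnW kC)).
Qed.
End GeodesicRepresentation.

(** * Permutations of the integers *)

Section FinitarySymmetric.
Implicit Types (w : int -> int) (k i j p q : int) (a : seq int).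

Lemma s_K k : involutive (s_ k).
Proof. by move=> j; rewrite /s_; do !case: eqP => //; lia. Qed.

Lemma in_SZ_id : in_SZ id.
Proof. by split; [exists id | exists 0%N]. Qed.

Lemma in_SZ_s k : in_SZ (s_ k).
Proof.
split; first by exists (s_ k); exact: s_K.
by exists (`|k|.+1)%N => i; rewrite /s_; do !case: eqP => //; lia.
Qed.

Lemma in_SZ_comp w w' : in_SZ w -> in_SZ w' -> in_SZ (w \o w').
Proof.
move=> [bw [N wN]] [bw' [N' wN']]; split; first exact: bij_comp.
exists (maxn N N') => i iN /=; rewrite wN' ?wN //; lia.
Qed.

Lemma in_SZ_word a : in_SZ (word_perm a).
Proof. by elim: a => [|k a IH]; [exact: in_SZ_id | apply: in_SZ_comp => //; exact: in_SZ_s]. Qed.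

Lemma word_perm_rcons a k j : word_perm (rcons a k) j = word_perm a (s_ k j).
Proof. by elim: a => //= x a ->. Qed.

Lemma word_perm_cat a a' j : word_perm (a ++ a') j = word_perm a (word_perm a' j).
Proof. by elim: a => //= x a ->. Qed.

Definition inversion w (p : int * int) := (p.1 < p.2) && (w p.2 < w p.1).

Lemma inversions_finite w : in_SZ w -> exists2 s, uniq s & forall pr, inversion w pr = (pr \in s).
Proof.
move=> [bw [N wN]]; pose win := [seq (n%:Z - N%:Z)%R | n <- iota 0 (N + N).+1].
exists [seq p <- [seq (i, j) | i <- win, j <- win] | inversion w p].
  apply/filter_uniq/allpairs_uniq => [||[? ?] [? ?] _ _ //].
  - by rewrite map_inj_uniq ?iota_uniq // => n n'; lia.
  - by rewrite map_inj_uniq ?iota_uniq // => n n'; lia.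
move=> [i j]; rewrite mem_filter; apply/idP/andP => [ij|[]//]; split=> //.
have inwin (x : int) : - N%:Z <= x <= N%:Z -> x \in win.
  move=> xN; apply/mapP; exists `|(x + N%:Z)%R|%N; first by rewrite mem_iota; lia.
  by lia.
have wi := bij_inj bw; case/andP: ij => ij wij; rewrite /= in ij wij.
have fixw (x : int) : (w x < - N%:Z) \/ (N%:Z < w x) -> w x = x by move=> /wN /wi.
apply: (allpairs_f pair); apply: inwin.
- apply/andP; split; rewrite leNgt; apply/negP => h.
    have E := wN i (or_introl h); have := fixw j; rewrite E in wij; lia.
  have := wN i (or_intror h); have := wN j; lia.
- apply/andP; split; rewrite leNgt; apply/negP => h.
    have := wN j (or_introl h); have := wN i; lia.
  have E := wN j (or_intror h); have := fixw i; rewrite E in wij; lia.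
Qed.

Lemma inv_lenE w s : uniq s -> (forall pr, inversion w pr = (pr \in s)) -> inv_len w = size s.
Proof. by move=> us sP; apply: fcard_eq => // p; rewrite -sP; split=> /andP. Qed.

Lemma eq_inv_len w w' : w =1 w' -> inv_len w = inv_len w'.
Proof. by move=> /functional_extensionality ->. Qed.

Lemma inv_len_right w k : in_SZ w -> w k < w (k + 1) -> inv_len (w \o s_ k) = (inv_len w).+1.
Proof.
move=> wS wk; have [s us sP] := inversions_finite wS.
pose sg (pr : int * int) := (s_ k pr.1, s_ k pr.2).
have sgK : involutive sg by move=> [x y]; rewrite /sg /= !s_K.
rewrite (inv_lenE us sP) -(size_map sg) -[RHS]/(size ((k, k + 1) :: map sg s)).
apply: inv_lenE.
  rewrite /= (map_inj_uniq (can_inj sgK)) us andbT; apply/mapP => -[pr ps /(congr1 sg)].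
  rewrite sgK => pE; move: ps; rewrite -sP -pE /inversion /sg /= /s_.
  by do !case: eqP => //; lia.
move=> pr; rewrite inE -[in X in _ || X](sgK pr) (mem_map (can_inj sgK)) -sP.
case: pr => x y; rewrite /inversion /sg /= xpair_eqE.
case: (eqVneq x k) => [->|xk]; case: (eqVneq y (k + 1)) => [->|yk] /=.
- by rewrite /s_ !eqxx; case: eqP; lia.
- rewrite /s_ eqxx (negPf yk); case: eqP => [->|] ; lia.
- rewrite /s_ eqxx (negPf xk) (_ : (k + 1 == k) = false); last lia.
  case: eqP => [->|]; lia.
rewrite /s_ (negPf xk) (negPf yk).
by case: (eqVneq x (k + 1)) => [->|?]; case: (eqVneq y k) => [->|?]; lia.
Qed.

Lemma inv_len_right_gt w k : in_SZ w -> w (k + 1) < w k -> inv_len w = (inv_len (w \o s_ k)).+1.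
Proof.
move=> wS wk; rewrite -(@inv_len_right _ k); first by apply: eq_inv_len => j /=; rewrite s_K.
- exact/in_SZ_comp/in_SZ_s.
- by rewrite /= /s_ !eqxx (_ : (k + 1 == k) = false) //; lia.
Qed.

Lemma inv_len_left w k p q : in_SZ w -> w p = k -> w q = k + 1 -> p < q ->
  inv_len (s_ k \o w) = (inv_len w).+1.
Proof.
move=> wS wp wq pq; have wi := bij_inj (proj1 wS); have [s us sP] := inversions_finite wS.
rewrite (inv_lenE us sP) -[RHS]/(size ((p, q) :: s)); apply: inv_lenE.
  by rewrite /= us andbT -sP /inversion /= wp wq; lia.
move=> [i j]; rewrite inE -sP /inversion /= xpair_eqE.
rewrite -(inj_eq wi i) -(inj_eq wi j) wp wq /s_.
have [ij|ij] /= := ltP i j.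
  have jp : w j = k -> j = p by rewrite -wp => /wi.
  have iq : w i = k + 1 -> i = q by rewrite -wq => /wi.
  by have nij : w i <> w j by [move/wi; lia]; do !case: eqP => ? //=; lia.
by case: eqP => //= wik; case: eqP => //= wjk; have := wi i p; have := wi j q; lia.
Qed.

Lemma inv_len_left_gt w k p q : in_SZ w -> w p = k -> w q = k + 1 -> q < p ->
  inv_len w = (inv_len (s_ k \o w)).+1.
Proof.
move=> wS wp wq pq; rewrite -(@inv_len_left _ k q p) //.
- by apply: eq_inv_len => j /=; rewrite s_K.
- by apply: in_SZ_comp => //; exact: in_SZ_s.
- by rewrite /= wq /s_ eqxx; case: eqP; lia.
- by rewrite /= wp /s_ eqxx.
Qed.

Lemma inv_len_word_le a : (inv_len (word_perm a) <= size a)%N.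
Proof.
elim: a => [|k a IH].
  by rewrite (@inv_lenE _ [::]) // => -[i j]; rewrite in_nil /inversion /= lt_asym.
have wS := in_SZ_word a; have [g gK Kg] := proj1 wS.
change (inv_len (s_ k \o word_perm a) <= (size a).+1)%N.
have [lt|gt|eq] := ltgtP (g k) (g (k + 1)).
- by rewrite (inv_len_left wS (Kg k) (Kg (k + 1)) lt).
- by have := inv_len_left_gt wS (Kg k) (Kg (k + 1)) gt; lia.
- by have := congr1 (word_perm a) eq; rewrite !Kg; lia.
Qed.

(** Monotonicity propagates w i >= i from the fixed points far left and w i <= i from those far
    right. *)
Lemma increasing_id w : in_SZ w -> (forall k, w k < w (k + 1)) -> w =1 id.
Proof.
move=> [bw [N wN]] inc i.
have up n : (- N%:Z - 1 + n%:Z)%R <= w (- N%:Z - 1 + n%:Z)%R.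
  elim: n => [|n IH]; first by rewrite wN; lia.
  by have := inc (- N%:Z - 1 + n%:Z)%R; rewrite (_ : _ + 1 = - N%:Z - 1 + n.+1%:Z)%R; lia.
have dn n : w (N%:Z + 1 - n%:Z)%R <= (N%:Z + 1 - n%:Z)%R.
  elim: n => [|n IH]; first by rewrite wN; lia.
  have := inc (N%:Z + 1 - n.+1%:Z)%R.
  by rewrite (_ : N%:Z + 1 - n.+1%:Z + 1 = N%:Z + 1 - n%:Z)%R; lia.
case: (ltP i (- N%:Z)) => i1; first by apply: wN; left.
case: (ltP N%:Z i) => i2; first by apply: wN; right.
have := up `|(i + N%:Z + 1)%R|%N; rewrite (_ : - N%:Z - 1 + _ = i); last lia.
have := dn `|(N%:Z + 1 - i)%R|%N; rewrite (_ : N%:Z + 1 - _ = i); last lia.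
by rewrite /=; lia.
Qed.

Lemma reduced_word_exists w : in_SZ w -> exists a, reduced_word w a.
Proof.
move: {2}(inv_len w) (erefl (inv_len w)) => n; elim: n w => [|n IH] w wn wS.
all: have [[k wk]|nd] := excluded_middle_informative (exists k, w (k + 1) < w k).
- by have := inv_len_right_gt wS wk; rewrite wn.
- exists [::]; split; last by rewrite wn.
  apply: increasing_id => // k; case: ltgtP => // [wk|/(bij_inj (proj1 wS))]; last by lia.
  by case: nd; exists k.
- have := inv_len_right_gt wS wk; rewrite wn => -[/esym wn'].
  have [a [wa sa]] := IH _ wn' (in_SZ_comp wS (in_SZ_s k)).
  exists (rcons a k); split; last by rewrite size_rcons sa wn wn'.
  by move=> j; rewrite word_perm_rcons -wa /= s_K.
- exists [::]; split.
    apply: increasing_id => // k; case: ltgtP => // [wk|/(bij_inj (proj1 wS))]; last by lia.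
    by case: nd; exists k.
  have wid : w =1 id.
    apply: increasing_id => // k; case: ltgtP => // [wk|/(bij_inj (proj1 wS))]; last by lia.
    by case: nd; exists k.
  by rewrite (eq_inv_len wid); have := inv_len_word_le [::]; rewrite leqn0 => /eqP ->.
Qed.
End FinitarySymmetric.

(** * Fixed-point-free atoms *)

Section Atoms.
Implicit Types (w z : int -> int) (i j k p q r : int) (a : seq int).

Lemma odd_absz1 i : odd `|(i + 1)%R|%N = ~~ odd `|i|%N.
Proof.
case: i => n; first by rewrite (_ : `|(n%:Z + 1)%R|%N = n.+1) //; lia.
have -> : `|(Negz n + 1)%R|%N = n by lia.
by have -> : `|Negz n|%N = n.+1 by []; rewrite oddS negbK.
Qed.

Lemma ThetaK : involutive Theta.
Proof.
move=> i; rewrite /Theta; have := odd_absz1 i; have := odd_absz1 (i - 1); rewrite subrK.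
by case: (odd `|i|%N) => h1 h2; [rewrite h2 addrK | rewrite -[odd _]negbK -h1 subrK].
Qed.

Lemma Theta_add2 i : Theta (i + 2) = Theta i + 2.
Proof.
rewrite /Theta (_ : i + 2 = i + 1 + 1); last by rewrite -addrA.
by rewrite !odd_absz1 negbK; case: ifP => _; lia.
Qed.

Lemma Theta_pm i : Theta i = i + 1 \/ Theta i = i - 1.
Proof. by rewrite /Theta; case: ifP; [left|right]. Qed.

Lemma Theta_odd i : Theta i = i + 1 <-> odd `|i|%N.
Proof. by rewrite /Theta; case: ifP => h; split=> //; lia. Qed.

Lemma Theta_next i : Theta i = i + 1 -> Theta (i + 1) = i.
Proof. by move=> <-; rewrite ThetaK. Qed.

Definition fpf_word z a : Prop :=
  fpf_conj (word_perm a) z /\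
  forall a', fpf_conj (word_perm a') z -> (size a <= size a')%N.

Lemma eq_fpf_conj w w' z : w =1 w' -> fpf_conj w z -> fpf_conj w' z.
Proof. by move=> ww' c i; rewrite -!ww'. Qed.

(** A shortest word is reduced, so atoms with their reduced words can be described by lengths of
    words alone. This is the quantity measured by distances under conjugation. *)
Lemma AFPF_word z a :
  (exists w, in_AFPF z w /\ reduced_word w a) <-> fpf_word z a.
Proof.
split=> [[w [[wS wz wmin] [wa sa]]]|[az amin]].
  split=> [|a' a'z]; first exact: eq_fpf_conj wz.
  by rewrite sa (leq_trans (wmin _ (in_SZ_word a') a'z)) ?inv_len_word_le.
exists (word_perm a); have aS := in_SZ_word a.
have sa : size a = inv_len (word_perm a).
  apply/eqP; rewrite eqn_leq inv_len_word_le andbT.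
  have [a' [wa' <-]] := reduced_word_exists aS.
  by apply: amin; apply: eq_fpf_conj az.
split=> //; split=> // w' w'S w'z; rewrite -sa.
by have [a' [wa' <-]] := reduced_word_exists w'S; apply: amin; apply: eq_fpf_conj w'z.
Qed.

Section OneAtom.
Variables (z w : int -> int).
Hypothesis wA : in_AFPF z w.
Let wS : in_SZ w. Proof. by case: wA. Qed.
Let wz : fpf_conj w z. Proof. by case: wA. Qed.
Let w_inj : injective w. Proof. exact: bij_inj (proj1 wS). Qed.

Lemma atom_invol : involutive z.
Proof. by move=> i; apply: w_inj; rewrite !wz ThetaK. Qed.

Lemma fpf_conj_odd_s w' k : Theta k = k + 1 -> fpf_conj w' z -> fpf_conj (s_ k \o w') z.
Proof.
move=> kO w'z i /=; rewrite w'z /s_; have := Theta_next kO; have := ThetaK (w' i).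
case: (eqVneq (w' i) k) => [->|ik]; first by rewrite kO; case: eqP; rewrite ?eqxx ?kO; lia.
case: (eqVneq (w' i) (k + 1)) => [->|ik1]; first by rewrite kO => _ ->; rewrite eqxx.
case: eqP => [->|_]; first by rewrite kO; lia.
by case: eqP => // -> + h; rewrite h; lia.
Qed.

(** The value w p + 1 stands at z p. If z p were left of p, exchanging the values w p and w p + 1,
    which commutes with Theta, would shorten w. *)
Lemma atom_opener p : Theta (w p) = w p + 1 -> p < z p.
Proof.
move=> pO; have wzp : w (z p) = w p + 1 by rewrite wz.
case: (ltgtP p (z p)) => // [zp|E]; last by rewrite -E in wzp; lia.
have := inv_len_left_gt wS erefl wzp zp; case: wA => _ _ wmin.
have := wmin _ (in_SZ_comp (in_SZ_s (w p)) wS) (fpf_conj_odd_s pO wz).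
by lia.
Qed.

Lemma atom_opener_iff i : (Theta (w i) = w i + 1) <-> (i < z i).
Proof.
split; first exact: atom_opener.
case: (Theta_pm (w i)) => // E iz.
have := @atom_opener (z i); rewrite wz ThetaK E atom_invol => H.
by have := H ltac:(lia); lia.
Qed.

Ltac s_lia := rewrite ?/s_; repeat (case: eqP => ? //=); lia.

Lemma s_cases k x : (x = k /\ s_ k x = k + 1) \/ (x = k + 1 /\ s_ k x = k)
  \/ (x <> k /\ x <> k + 1 /\ s_ k x = x).
Proof.
by rewrite /s_; case: eqP => [|n0]; [left | case: eqP => [|n1]; right; [left | right]].
Qed.

(* Exchanges the blocks {j, j+1} and {j+2, j+3}. *)
Definition block_swap j : int -> int := s_ (j + 1) \o (s_ j \o (s_ (j + 2) \o s_ (j + 1))).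

Lemma block_swapE j x : block_swap j x =
  if (x == j) || (x == j + 1) then x + 2
  else if (x == j + 2) || (x == j + 3) then x - 2 else x.
Proof.
rewrite /block_swap /=.
have := s_cases (j + 1) x; move: (s_ (j + 1) x) => y1.
have := s_cases (j + 2) y1; move: (s_ (j + 2) y1) => y2.
have := s_cases j y2; move: (s_ j y2) => y3.
have := s_cases (j + 1) y3; move: (s_ (j + 1) y3) => y4.
by case: ifP => h; last case: ifP => h'; lia.
Qed.

Lemma block_swap_Theta j x : Theta j = j + 1 -> block_swap j (Theta x) = Theta (block_swap j x).
Proof.
move=> jO; have T1 := Theta_next jO; have T2 := Theta_add2 j; have T3 := Theta_add2 (j + 1).
have e3 : j + 1 + 2 = j + 3 by lia.
rewrite e3 T1 in T3; rewrite jO e3 in T2.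
have [B0 B1 B2 B3] : [/\ block_swap j j = j + 2, block_swap j (j + 1) = j + 3,
    block_swap j (j + 2) = j & block_swap j (j + 3) = j + 1].
  by split; rewrite block_swapE; case: ifP => h; try case: ifP => h'; lia.
have Bx y : ~ (j <= y <= j + 3) -> block_swap j y = y.
  by move=> yj; rewrite block_swapE; case: ifP => h; try case: ifP => h'; lia.
have [->|n0] := eqVneq x j; first by rewrite jO B1 B0 T2.
have [->|n1] := eqVneq x (j + 1); first by rewrite T1 B0 B1 T3.
have [->|n2] := eqVneq x (j + 2); first by rewrite T2 B3 B2 jO.
have [->|n3] := eqVneq x (j + 3); first by rewrite T3 B2 B3 T1.
rewrite !Bx //; first by lia.
move=> H; have K := ThetaK x.
have : Theta x = j \/ (Theta x = j + 1 \/ (Theta x = j + 2 \/ Theta x = j + 3)) by lia.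
by case=> [E|[E|[E|E]]]; rewrite E ?jO ?T1 ?T2 ?T3 in K; lia.
Qed.

Lemma fpf_conj_block_swap j : Theta j = j + 1 -> fpf_conj (block_swap j \o w) z.
Proof. by move=> jO i /=; rewrite wz block_swap_Theta. Qed.

Lemma in_SZ_block_swap j : in_SZ (block_swap j \o w).
Proof. by do !(apply: in_SZ_comp => //); exact: in_SZ_s. Qed.

(** The four letters of the swap act in turn: the first and the third remove an inversion, the
    second adds or removes one according to the order of z p and z r, and the last one changes the
    length by 1, upwards if z p < z r. *)
Lemma inv_len_block_swap p r : Theta (w p) = w p + 1 -> w r = w p + 2 -> r < p ->
  (z p < z r -> inv_len (block_swap (w p) \o w) = inv_len w) /\
  (z r < z p -> (inv_len (block_swap (w p) \o w) < inv_len w)%N).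
Proof.
move=> pO wr rp; set j := w p.
have wq : w (z p) = j + 1 by rewrite wz.
have ws : w (z r) = j + 3 by rewrite wz wr Theta_add2 pO -/j; lia.
have rO : Theta (w r) = w r + 1 by rewrite wr Theta_add2 pO; lia.
have pq := atom_opener pO; have rs := atom_opener rO.
pose w1 := s_ (j + 1) \o w; pose w2 := s_ (j + 2) \o w1; pose w3 := s_ j \o w2.
have S1 : in_SZ w1 by apply: in_SZ_comp => //; exact: in_SZ_s.
have S2 : in_SZ w2 by apply: in_SZ_comp => //; exact: in_SZ_s.
have S3 : in_SZ w3 by apply: in_SZ_comp => //; exact: in_SZ_s.
have v1 : [/\ w1 p = j, w1 r = j + 1, w1 (z p) = j + 2 & w1 (z r) = j + 3].
  rewrite /w1 /= wr wq ws -/j ; split; s_lia.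
have v2 : [/\ w2 p = j, w2 r = j + 1, z p < z r -> w2 (z p) = j + 3 & z p < z r -> w2 (z r) = j + 2].
  case: v1 => e1 e2 e3 e4; rewrite /w2 /= e1 e2 e3 e4 ; split; s_lia.
have v2' : w2 (z p) = j + 3 /\ w2 (z r) = j + 2.
  case: v1 => e1 e2 e3 e4; rewrite /w2 /= e3 e4 ; split; s_lia.
have v3 : w3 p = j + 1 /\ w3 (z r) = j + 2.
  case: v2 => e1 _ _ _; case: v2' => _ e4; rewrite /w3 /= e1 e4 ; split; s_lia.
have l1 : inv_len w = (inv_len w1).+1.
  by apply: (@inv_len_left_gt w _ (z p) r) => //; [rewrite wr -/j; lia | lia].
have l3 : inv_len w2 = (inv_len w3).+1.
  by case: v2 => e1 e2 _ _; apply: (@inv_len_left_gt _ _ p r).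
have E4 : inv_len (block_swap j \o w) = inv_len (s_ (j + 1) \o w3).
  apply: eq_inv_len => x; rewrite /w3 /w2 /w1 /= block_swapE.
  have := s_cases (j + 1) (w x); move: (s_ (j + 1) (w x)) => y1.
  have := s_cases (j + 2) y1; move: (s_ (j + 2) y1) => y2.
  have := s_cases j y2; move: (s_ j y2) => y3.
  have := s_cases (j + 1) y3; move: (s_ (j + 1) y3) => y4.
  by case: ifP => h; last case: ifP => h'; lia.
case: v1 => _ _ e3 e4; case: v3 => f1 f2.
split.
  move=> zpr; rewrite E4.
  have l2 : inv_len w2 = (inv_len w1).+1.
    by apply: (@inv_len_left _ _ (z p) (z r)) => //; rewrite e4; lia.
  have l4 : inv_len (s_ (j + 1) \o w3) = (inv_len w3).+1.
    by apply: (@inv_len_left _ _ p (z r)) => //; [rewrite f2 |]; lia.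
  by lia.
move=> zrp; rewrite E4.
have l2 : inv_len w1 = (inv_len w2).+1.
  by apply: (@inv_len_left_gt _ _ (z p) (z r)) => //; rewrite e4; lia.
have [lt|gt|eq] := ltgtP p (z r).
- by rewrite (@inv_len_left _ _ p (z r)) ?f2 //; lia.
- have := @inv_len_left_gt w3 (j + 1) p (z r) S3 f1 _ gt; rewrite f2 => /(_ ltac:(lia)); lia.
- by move: ws; rewrite -eq -/j; lia.
Qed.

(** If r < p, a block swap would shorten w unless the pair of p is nested in the pair of r. *)
Lemma atom_adjacent p r : Theta (w p) = w p + 1 -> w r = w p + 2 ->
  p < r \/ (r < p /\ z p < z r).
Proof.
move=> pO wr; case: (ltgtP p r) => [|rp|E]; [by left| |by rewrite E in wr; lia].
right; split=> //; case: (ltgtP (z p) (z r)) => // [zrp|/(can_inj atom_invol) E]; last by lia.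
have := proj2 (inv_len_block_swap pO wr rp) zrp; case: wA => _ _ wmin.
have := wmin _ (in_SZ_block_swap (w p)) (fpf_conj_block_swap pO); lia.
Qed.

Lemma atom_block_swap p r : Theta (w p) = w p + 1 -> w r = w p + 2 -> r < p ->
  in_AFPF z (block_swap (w p) \o w).
Proof.
move=> pO wr rp; have [|[_ zpr]] := atom_adjacent pO wr; first by lia.
have [/(_ zpr) E _] := inv_len_block_swap pO wr rp.
split; [exact: in_SZ_block_swap | exact: fpf_conj_block_swap|].
by rewrite E; case: wA.
Qed.
End OneAtom.
End Atoms.

(** * Atoms are the identity outside the window *)

Definition fixes_outside (N : nat) (w : int -> int) := forall i, (i <= 0) || (N%:Z < i) -> w i = i.

Lemma opener_gap (i r : int) : Theta i = i + 1 -> Theta r = r + 1 -> i < r -> i + 2 <= r.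
Proof. move=> iO rO ir; suff : r <> i + 1 by lia. by move=> E; move: rO; rewrite E -iO ThetaK; lia. Qed.

Section Window.
Variables (z w : int -> int) (N : nat).
Hypothesis wA : in_AFPF z w.
Hypothesis N_even : ~~ odd N.
Hypothesis z_out : forall i, (i <= 0) || (N%:Z < i) -> z i = Theta i.
Let wS : in_SZ w. Proof. by case: wA. Qed.
Let wz : fpf_conj w z. Proof. by case: wA. Qed.
Let w_inj : injective w. Proof. exact: bij_inj (proj1 wS). Qed.
Let zK : involutive z. Proof. exact: atom_invol wA. Qed.

Lemma outer_opener (i : int) : (i <= 0) || (N%:Z < i) -> (Theta (w i) = w i + 1 <-> Theta i = i + 1).
Proof.
by move=> io; rewrite (atom_opener_iff wA) z_out //; case: (Theta_pm i) => ->; split; lia.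
Qed.

(** A pair enclosing an outer one would itself have a point outside the window, where z only joins
    neighbours. *)
Lemma outer_unnested (i r : int) : (i <= 0) || (N%:Z < i) -> Theta i = i + 1 -> r < i -> z i < z r -> False.
Proof.
move=> io iO ri; rewrite z_out // iO => zr.
have [iN|i0] : N%:Z < i \/ i <= 0 by lia.
  by have := z_out (i := z r); rewrite zK; case: (Theta_pm (z r)) => ->; lia.
by have := z_out (i := r); case: (Theta_pm r) => E; rewrite E in zr *; lia.
Qed.

(** The opener carrying the next larger odd value stands further right, by at least 2, because an
    outer opener is never nested in another pair. *)
Lemma right_step (k : nat) (p : int) : N%:Z < p -> Theta p = p + 1 ->
  exists r, [/\ w r = w p + (k + k)%N%:Z, p + (k + k)%N%:Z <= r & Theta r = r + 1].
Proof.
move=> pN pO; elim: k => [|k [r [wr pr rO]]]; first by exists p; split=> //; lia.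
have [g gK Kg] := proj1 wS.
have rN : (r <= 0) || (N%:Z < r) by lia.
have wrO : Theta (w r) = w r + 1 by apply/outer_opener.
pose r' := g (w r + 2); have wr' : w r' = w r + 2 by rewrite /r' Kg.
have wr'O : Theta (w r') = w r' + 1 by rewrite wr' Theta_add2 wrO; lia.
have rr' : r < r'.
  have [//|[r'r zz]] := atom_adjacent wA wrO wr'.
  by case: (outer_unnested rN rO r'r zz).
exists r'; split; [by rewrite wr' wr; lia | | by apply/outer_opener => //; lia].
have := opener_gap rO (_ : Theta r' = r' + 1) rr'.
have -> : Theta r' = r' + 1 by apply/outer_opener => //; lia.
by move=> /(_ erefl); lia.
Qed.

Lemma left_step (k : nat) (p : int) : p <= 0 -> Theta p = p + 1 ->
  exists r, [/\ w r = w p - (k + k)%N%:Z, r <= p - (k + k)%N%:Z & Theta r = r + 1].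
Proof.
move=> pN pO; elim: k => [|k [r [wr pr rO]]]; first by exists p; split=> //; lia.
have [g gK Kg] := proj1 wS.
have rN : (r <= 0) || (N%:Z < r) by lia.
have wrO : Theta (w r) = w r + 1 by apply/outer_opener.
pose r' := g (w r - 2); have wr' : w r' = w r - 2 by rewrite /r' Kg.
have wr'O : Theta (w r') = w r' + 1.
  by have := Theta_add2 (w r'); rewrite {1}wr' subrK wrO; lia.
have rr' : r' < r.
  have wr2 : w r = w r' + 2 by rewrite wr' subrK.
  have [//|[rr' zz]] := atom_adjacent wA wr'O wr2.
  exfalso; rewrite (z_out rN) rO in zz.
  have : z r' <> r.
    by move=> E; have := wz r'; rewrite E wr'O; lia.
  by have := z_out (i := z r'); rewrite zK; case: (Theta_pm (z r')) => ->; lia.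
have r'O : Theta r' = r' + 1 by apply/outer_opener => //; lia.
have gap := opener_gap r'O rO rr'.
exists r'; split => //; [by rewrite wr' wr; lia | lia].
Qed.

(** Following [right_step] until the value lies beyond the support of w gives p <= w p. A value w p
    > p would already belong to the fixed opener at w p, by downward induction on p. *)
Lemma right_fixed (p : int) : N%:Z < p -> Theta p = p + 1 -> w p = p.
Proof.
case: (wS) => _ [M wM].
have big q : N%:Z < q -> Theta q = q + 1 -> q <= w q.
  move=> qN qO; have [r [wr qr _]] := right_step (M + `|w q| + `|q|)%N qN qO.
  have E : w (w r) = w r by apply: wM; right; lia.
  by have := w_inj E; lia.
move=> pN pO; move: {2}`|M%:Z - p|%N (leqnn `|M%:Z - p|%N) => n.
case: (ltP M%:Z p) => Mp; first by move=> _; apply: wM; right.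
elim: n p pN pO Mp => [|n IH] p pN pO Mp np.
all: have pw := big p pN pO.
all: have [//|nE] := eqVneq (w p) p.
all: have wpO : Theta (w p) = w p + 1 by apply/outer_opener => //; lia.
all: have wpN : N%:Z < w p by lia.
all: have H : w (w p) = w p by [case: (ltP M%:Z (w p)) => Mw; [apply: wM; right | try (apply: IH => //; lia); try lia]].
all: by have := w_inj H; lia.
Qed.

Lemma left_fixed (p : int) : p <= 0 -> Theta p = p + 1 -> w p = p.
Proof.
case: (wS) => _ [M wM].
have big q : q <= 0 -> Theta q = q + 1 -> w q <= q.
  move=> qN qO; have [r [wr qr _]] := left_step (M + `|w q| + `|q|).+1 qN qO.
  have E : w (w r) = w r by apply: wM; left; lia.
  by have := w_inj E; lia.
move=> pN pO; move: {2}`|(M%:Z + p)%R|%N (leqnn `|(M%:Z + p)%R|%N) => n.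
case: (ltP p (- M%:Z)) => Mp; first by move=> _; apply: wM; left.
elim: n p pN pO Mp => [|n IH] p pN pO Mp np.
all: have pw := big p pN pO.
all: have [//|nE] := eqVneq (w p) p.
all: have wpO : Theta (w p) = w p + 1 by apply/outer_opener => //; lia.
all: have wpN : w p <= 0 by lia.
all: have H : w (w p) = w p by [case: (ltP (w p) (- M%:Z)) => Mw; [apply: wM; left | try (apply: IH => //; lia); try lia]].
all: by have := w_inj H; lia.
Qed.

Lemma atom_fixes_outside : fixes_outside N w.
Proof.
move=> i io; case: (Theta_pm i) => iO.
  by case: (ltP N%:Z i) => iN; [exact: right_fixed | apply: left_fixed => //; lia].
have jO : Theta (i - 1) = (i - 1) + 1 by rewrite -iO ThetaK; lia.
(* N is even, so N + 1 opens a pair of Theta and no such pair straddles the end of the window. *)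
have iN1 : i <> N%:Z + 1.
  move=> E; move: iO; rewrite E /Theta; have -> : `|(N%:Z + 1)%R|%N = N.+1 by lia.
  by rewrite oddS N_even; lia.
have E : w (i - 1) = i - 1.
  have : (i - 1 <= 0) || (N%:Z < i - 1) by lia.
  by case: (ltP N%:Z (i - 1)) => iN; [move=> _; exact: right_fixed | move=> ?; apply: left_fixed => //; lia].
by have := wz (i - 1); rewrite E z_out ?jO; [rewrite subrK | lia].
Qed.
End Window.

Lemma fixes_outside_range N (w : int -> int) i : injective w -> fixes_outside N w ->
  0 < i <= N%:Z -> 0 < w i <= N%:Z.
Proof.
move=> wi fw iN; have [//|out] : (0 < w i <= N%:Z) \/ ((w i <= 0) || (N%:Z < w i)) by lia.
by have := wi _ _ (fw _ out); lia.
Qed.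

Lemma reduced_rcons w (a : seq int) k : reduced_word w (rcons a k) ->
  [/\ reduced_word (w \o s_ k) a & w (k + 1) < w k].
Proof.
move=> [wa sa]; have wS : in_SZ (word_perm a) := in_SZ_word a.
have E1 : inv_len w = inv_len (word_perm a \o s_ k).
  by apply: eq_inv_len => j; rewrite wa word_perm_rcons.
have skk : s_ k k = k + 1 by rewrite /s_ eqxx.
have sk1 : s_ k (k + 1) = k by rewrite /s_ eqxx; case: eqP; lia.
have le := inv_len_word_le a; rewrite size_rcons E1 in sa.
have asc : word_perm a k < word_perm a (k + 1).
  case: ltgtP => // [gt|/(bij_inj (proj1 wS))]; last by lia.
  by have := inv_len_right_gt wS gt; lia.
split; last by rewrite !wa !word_perm_rcons skk sk1.
split; first by move=> j /=; rewrite wa word_perm_rcons s_K.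
rewrite (@eq_inv_len _ (word_perm a)) => [|j]; last by rewrite /= wa word_perm_rcons s_K.
by have := inv_len_right wS asc; lia.
Qed.

Lemma reduced_letters N w (a : seq int) : injective w -> fixes_outside N w -> reduced_word w a ->
  all (fun k => 0 < k < N%:Z) a.
Proof.
elim/last_ind: a w => // a k IH w wi fw red; have [red' wk] := reduced_rcons red.
have kN : 0 < k < N%:Z.
  have f1 := fw k; have f2 := fw (k + 1); have g1 := fixes_outside_range wi fw (i := k).
  have g2 := fixes_outside_range wi fw (i := k + 1).
  by lia.
rewrite all_rcons kN /=; apply: IH red'.
  by apply: inj_comp => //; exact: can_inj (s_K k).
by move=> i io /=; rewrite fw /s_; do !(case: eqP => ? //=); lia.
Qed.

(** * Codes of atoms *)
Local Open Scope nat_scope.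

Section Codes.
Variable N : nat.
Implicit Types (w : int -> int) (i j a b t : nat) (v : seq nat).

Definition code w i : nat := \sum_(1 <= j < N.+1) ((i < j) && (w j%:Z < w i%:Z)%R).
Definition capped t w := \sum_(1 <= i < N.+1) minn t (code w i).

Definition swapn a j := if j == a then a.+1 else if j == a.+1 then a else j.

Lemma s_swapn a j : s_ a%:Z j%:Z = (swapn a j)%:Z.
Proof. by rewrite /s_ /swapn; do !(case: eqP => ? //=); lia. Qed.

Lemma swapnK a : involutive (swapn a).
Proof.
move=> j; rewrite /swapn; have aS : (a.+1 == a) = false by lia.
case: (eqVneq j a) => [->|ja]; first by rewrite aS eqxx.
by case: (eqVneq j a.+1) => [->|ja1]; rewrite ?eqxx // (negPf ja) (negPf ja1).
Qed.

Lemma sum_swapn a (F : nat -> nat) : 0 < a < N ->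
  \sum_(1 <= j < N.+1) F (swapn a j) = \sum_(1 <= j < N.+1) F j.
Proof.
move=> /andP[a0 aN].
have split (G : nat -> nat) : \sum_(1 <= j < N.+1) G j =
   \sum_(1 <= j < a) G j + (G a + G a.+1) + \sum_(a.+2 <= j < N.+1) G j.
  rewrite (@big_cat_nat _ _ _ a) //=; last lia.
  by rewrite -addnA; congr (_ + _); rewrite big_ltn; [rewrite big_ltn ?addnA //; lia | lia].
rewrite !split /swapn !eqxx (_ : (a.+1 == a) = false); last lia.
congr (_ + _ + _); [|lia|].
  by rewrite big_nat [RHS]big_nat; apply: eq_bigr => j ja; rewrite !ifF //; lia.
by rewrite big_nat [RHS]big_nat; apply: eq_bigr => j ja; rewrite !ifF //; lia.
Qed.

Lemma sum_eq1 b : 0 < b <= N -> \sum_(1 <= j < N.+1) (j == b) = 1.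
Proof.
move=> bN; rewrite (bigD1_seq b) ?mem_index_iota ?iota_uniq //= eqxx big1 ?addn0 // => j /negPf ->.
by [].
Qed.

Lemma code_swap w a i : 0 < a < N ->
  code (w \o s_ a%:Z) i = \sum_(1 <= j < N.+1) ((i < swapn a j) && (w j%:Z < w (swapn a i)%:Z)%R).
Proof.
move=> aN; rewrite -(sum_swapn _ aN); apply: eq_bigr => j _.
by rewrite /= !s_swapn swapnK.
Qed.

Section Descent.
Variables (w : int -> int) (a : nat).
Hypotheses (aN : 0 < a < N) (wa : (w a.+1%:Z < w a%:Z)%R).

Lemma code_descent_at : code (w \o s_ a%:Z) a = code w a.+1.
Proof.
rewrite code_swap //; apply: eq_bigr => j _; congr nat_of_bool.
rewrite /swapn eqxx; case: eqP => [->|ja]; first by lia.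
by case: eqP => [->|ja1]; lia.
Qed.

Lemma code_descent_succ : code w a = (code (w \o s_ a%:Z) a.+1).+1.
Proof.
rewrite code_swap // -[RHS]add1n -[X in X + _](@sum_eq1 a.+1); last by lia.
rewrite -big_split /=; apply: eq_bigr => j _.
rewrite /swapn eqxx (_ : (a.+1 == a) = false); last lia.
case: (eqVneq j a) => [->|ja]; first by rewrite !ltnn; lia.
by case: (eqVneq j a.+1) => [->|ja1]; lia.
Qed.

Lemma code_descent_other i : i != a -> i != a.+1 -> code (w \o s_ a%:Z) i = code w i.
Proof.
move=> ia ia1; rewrite code_swap //; apply: eq_bigr => j _; congr nat_of_bool.
rewrite [in swapn a i]/swapn (negPf ia) (negPf ia1); congr (_ && _).
by rewrite /swapn; do !(case: eqP => ? //=); lia.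
Qed.
End Descent.

Lemma code_out w i : N <= i -> code w i = 0.
Proof. by move=> iN; rewrite /code big_nat big1 // => j jN; rewrite ltnNge (_ : j <= i) //; lia. Qed.

Lemma code_gt_descent w i : code w i.+1 < code w i -> (w i.+1%:Z < w i%:Z)%R.
Proof.
move=> c; rewrite ltNge; apply/negP => wi; move: c; rewrite ltnNge => /negP; apply.
by apply: leq_sum => j _; case: (eqVneq j i.+1) => [->|]; lia.
Qed.

(* Interpolates between [capped t] and [capped t.+1]: only positions below [b] are
   capped at t+1. *)
Definition mix t b w := \sum_(1 <= i < N.+1) minn (t + (i < b)) (code w i).

Lemma mix_full t w : mix t N.+1 w = capped t.+1 w.
Proof. by rewrite /mix big_nat [RHS]big_nat; apply: eq_bigr => i iN; rewrite (_ : i < N.+1) ?addn1 //; lia. Qed.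

(** Removing the descent at a moves [code w a], less 1, to position a+1, where the cap is t instead
    of the t+1 it had at a: this is the unit gained. *)
Lemma mix_step t b w a : 0 < a < N -> (w a.+1%:Z < w a%:Z)%R -> a < b ->
  mix t a (w \o s_ a%:Z) + 1 <= mix t b w.
Proof.
move=> aN wa ab; rewrite /mix -[X in _ <= X](sum_swapn _ aN) -[X in _ + X <= _](@sum_eq1 a.+1); last by lia.
rewrite -big_split /=; apply: leq_sum => i _.
case: (eqVneq i a) => [->|ia].
  by rewrite code_descent_at // ltnn /swapn eqxx; lia.
case: (eqVneq i a.+1) => [->|ia1].
  have := code_descent_succ aN wa; rewrite /swapn eqxx (_ : (a.+1 == a) = false); last lia.
  by move=> ->; rewrite (_ : a < b) //; lia.
by rewrite code_descent_other // /swapn (negPf ia) (negPf ia1); lia.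
Qed.

Definition zword v : seq int := [seq i%:Z | i <- v].
Definition window_letters v := all (fun a => 0 < a < N) v.

Lemma zword_rcons v a : zword (rcons v a) = rcons (zword v) a%:Z.
Proof. exact: map_rcons. Qed.

(** Read from the right, the letters of an increasing block decrease, so each still finds the cap
    t+1 at its position; b records the last letter read. *)
Lemma mix_suffix t v b w (a' : seq int) : window_letters v -> sorted ltn v -> all (fun a => a < b) v ->
  reduced_word w (a' ++ zword v) -> capped t (word_perm a') + size v <= mix t b w.
Proof.
elim/last_ind: v b w => [|v a IH] b w.
  rewrite cats0 => _ _ _ [wa _]; rewrite addn0; apply: leq_sum => i _.
  rewrite (_ : code (word_perm a') i = code w i); first by lia.
  by apply: eq_bigr => j _; rewrite !wa.
rewrite /window_letters !all_rcons => /andP[aN vN] vs /andP[ab vb].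
rewrite zword_rcons -rcons_cat => /reduced_rcons [red wa].
rewrite size_rcons addnS -addn1; apply: leq_trans (mix_step t aN _ ab); last first.
  by rewrite (_ : a.+1%:Z = (a%:Z + 1)%R) //; lia.
rewrite leq_add2r; apply: IH => //.
- by move: vs; rewrite -cats1 => /cat_sorted2 [].
- by move: vs; rewrite sorted_pairwise ?pairwise_rcons; [case/andP | exact: ltn_trans].
Qed.

Lemma capped_suffix t v w (a' : seq int) : window_letters v -> sorted ltn v ->
  reduced_word w (a' ++ zword v) -> capped t (word_perm a') + size v <= capped t.+1 w.
Proof.
move=> vN vs red; rewrite -mix_full; apply: mix_suffix red => //.
by apply: sub_all vN => a; lia.
Qed.

Lemma reduced_prefix w (a a' : seq int) : reduced_word w (a ++ a') -> reduced_word (word_perm a) a.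
Proof.
elim/last_ind: a' w => [|a' k IH] w.
  by rewrite cats0 => -[wa sa]; split=> //; rewrite sa; apply: eq_inv_len.
by rewrite -rcons_cat => /reduced_rcons [/IH].
Qed.

Definition increasing_blocks (bs : seq (seq nat)) := all (sorted ltn) bs && all window_letters bs.

(** The blocks are listed in the order of removal, from the right end of the word; hence [rev]. *)
Lemma capped_blocks t bs w : increasing_blocks bs -> reduced_word w (zword (flatten (rev bs))) ->
  sumn (take t (map size bs)) <= capped t w.
Proof.
elim: bs t w => [|v bs IH] [|t] w //=; rewrite /increasing_blocks /= => /andP[/andP[vs bss] /andP[vN bsN]].
rewrite rev_cons -cats1 flatten_cat /= cats0 /zword map_cat -/(zword _) -/(zword _) => red.
apply: leq_trans (capped_suffix t vN vs red); rewrite addnC leq_add2r.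
by apply: IH; [rewrite /increasing_blocks bss | exact: reduced_prefix red].
Qed.
End Codes.

(** * Factorizations attaining the code bound *)

Section TightFactorizations.
Variable N : nat.
Implicit Types (w : int -> int) (i j a b t : nat) (v : seq nat) (bs : seq (seq nat)).
Local Notation code := (code N).
Local Notation capped := (capped N).

Lemma window_letters_rcons v a : window_letters N (rcons v a) = (0 < a < N) && window_letters N v.
Proof. exact: all_rcons. Qed.

Lemma sorted_ltn_rcons v a : sorted ltn (rcons v a) = all (fun x => x < a) v && sorted ltn v.
Proof. by rewrite !(sorted_pairwise ltn_trans) pairwise_rcons. Qed.

Lemma reduced_zrcons w (a' : seq int) v a : reduced_word w (a' ++ zword (rcons v a)) ->
  reduced_word (w \o s_ a%:Z) (a' ++ zword v) /\ (w a.+1%:Z < w a%:Z)%R.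
Proof.
rewrite zword_rcons -rcons_cat => /reduced_rcons [red wa]; split=> //.
by rewrite (_ : a.+1%:Z = (a%:Z + 1)%R) //; lia.
Qed.

Lemma suffix_letters w (a' : seq int) v a : window_letters N v -> sorted ltn v ->
  reduced_word w (a' ++ zword v) -> a \in v -> 0 < code w a.
Proof.
elim/last_ind: v w => // v x IH w.
rewrite window_letters_rcons sorted_ltn_rcons => /andP[xN vN] /andP[/allP vx vs] /reduced_zrcons [red wx].
rewrite mem_rcons inE => /predU1P[->|av]; first by rewrite (code_descent_succ xN wx).
have := IH _ vN vs red av; rewrite code_descent_other //; have := vx _ av; lia.
Qed.

Lemma suffix_code w1 w2 (a1 a2 : seq int) v : window_letters N v ->
  reduced_word w1 (a1 ++ zword v) -> reduced_word w2 (a2 ++ zword v) ->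
  (forall i, code w1 i = code w2 i) -> forall i, code (word_perm a1) i = code (word_perm a2) i.
Proof.
elim/last_ind: v w1 w2 => [|v x IH] w1 w2.
  rewrite !cats0 => _ [e1 _] [e2 _] c i.
  have E w (a : seq int) : w =1 word_perm a -> code (word_perm a) i = code w i.
    by move=> e; apply: eq_bigr => j _; rewrite !e.
  by rewrite (E _ _ e1) (E _ _ e2).
rewrite window_letters_rcons => /andP[xN vN] /reduced_zrcons [r1 d1] /reduced_zrcons [r2 d2] c.
apply: IH r1 r2 _ => // i; case: (eqVneq i x) => [->|ix]; first by rewrite !code_descent_at.
case: (eqVneq i x.+1) => [->|ix1]; last by rewrite !code_descent_other.
by have := code_descent_succ xN d1; have := code_descent_succ xN d2; rewrite c; lia.
Qed.

Definition tight bs w := forall t, capped t w = sumn (take t (map size bs)).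

Lemma capped1 w : capped 1 w = size [seq i <- iota 1 N | 0 < code w i].
Proof.
have -> : iota 1 N = index_iota 1 N.+1 by rewrite /index_iota subn1.
rewrite size_filter -sum1_count big_mkcond.
by apply: eq_bigr => i _; case: (code w i) => //= n; lia.
Qed.

(** Tightness at t = 1 makes the last block as long as the list of positions with positive code, and
    its letters are such positions; so it is that list. The rest is tight again, and its code is
    determined by the code and the block. *)
Lemma tight_unique bs1 bs2 w1 w2 : map size bs1 = map size bs2 ->
  increasing_blocks N bs1 -> increasing_blocks N bs2 ->
  reduced_word w1 (zword (flatten (rev bs1))) -> reduced_word w2 (zword (flatten (rev bs2))) ->
  (forall i, code w1 i = code w2 i) -> tight bs1 w1 -> bs1 = bs2.
Proof.
elim: bs1 bs2 w1 w2 => [|v1 bs1 IH] [|v2 bs2] w1 w2 //= [s12 ss].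
move=> /andP[/= /andP[v1s b1s] /andP[v1N b1N]] /andP[/= /andP[v2s b2s] /andP[v2N b2N]].
rewrite !rev_cons -!cats1 !flatten_cat /= !cats0 /zword !map_cat -!/(zword _) => r1 r2 c ti.
have cap w t : (forall i, code w1 i = code w i) -> capped t w = capped t w1.
  by move=> e; apply: eq_bigr => i _; rewrite e.
pose P := [seq i <- iota 1 N | 0 < code w1 i].
have vP v w (a' : seq int) : size v = size v1 -> (forall i, code w1 i = code w i) ->
    window_letters N v -> sorted ltn v -> reduced_word w (a' ++ zword v) -> v = P.
  move=> sv cw vN vs red; apply: (irr_sorted_eq ltn_trans ltnn) => //.
    by apply: sorted_filter; [exact: ltn_trans | exact: iota_ltn_sorted].
  have sub : {subset v <= P}.
    move=> a av; rewrite mem_filter cw (suffix_letters vN vs red av) mem_iota.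
    by have := allP vN _ av; lia.
  have uv : uniq v by apply: sorted_uniq vs; [exact: ltn_trans | exact: ltnn].
  apply: (uniq_min_size uv sub _).2.
  by rewrite -capped1 (ti 1) /= take0 addn0 sv.
have e1 : v1 = P by apply: vP r1.
have e2 : v2 = P by apply: vP r2.
have e12 : v1 = v2 by rewrite e2; exact: e1.
clear e1 e2; subst v2; congr (_ :: _).
apply: (IH bs2 (word_perm (zword (flatten (rev bs1)))) (word_perm (zword (flatten (rev bs2))))) => //.
- by rewrite /increasing_blocks b1s.
- by rewrite /increasing_blocks b2s.
- exact: reduced_prefix r1.
- exact: reduced_prefix r2.
- by apply: suffix_code r1 r2 c.
move=> t; apply/eqP; rewrite eqn_leq; apply/andP; split; last first.
  by apply: capped_blocks (reduced_prefix r1); rewrite /increasing_blocks b1s.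
by have := capped_suffix t v1N v1s r1; rewrite (ti t.+1) /= addnC leq_add2l.
Qed.

Lemma sumS_ge (F : nat -> nat) p : 0 < p <= N ->
  \sum_(p <= i < N.+1) F i = F p + \sum_(p.+1 <= i < N.+1) F i.
Proof. by move=> pN; rewrite big_ltn //; lia. Qed.

(** Positions are treated from the right. The one treated last has code 0, so a positive code at b
    makes b a descent; removing it leaves 0 at b and [code w b] less 1 at b+1. *)
Lemma peel_state w b : in_SZ w -> fixes_outside N w -> 0 < b <= N.+1 ->
  exists w' v, [/\ in_SZ w' /\ fixes_outside N w', w =1 w' \o word_perm (zword v),
    inv_len w = inv_len w' + size v,
    [/\ sorted ltn v, window_letters N v & all (leq b) v] &
    [/\ forall i, i < b -> code w' i = code w i, code w' b = 0,
       forall t, \sum_(b <= i < N.+1) minn t (code w' i) = \sum_(b <= i < N.+1) minn t (code w i).-1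
     & size v = \sum_(b <= i < N.+1) (0 < code w i)]].
Proof.
move=> wS wf; move: {2}(N.+1 - b) (erefl (N.+1 - b)) => n; elim: n b => [|n IH] b nb bN.
  have -> : b = N.+1 by lia.
  exists w, [::]; split=> //=; first by rewrite addn0.
  by split=> //; [rewrite code_out | move=> t; rewrite !big_geq | rewrite big_geq].
have [w' [v [[w'S w'f] wE wl [vs vN vb] [ce c0 cs sv]]]] := IH b.+1 ltac:(lia) ltac:(lia).
have bN' : 0 < b <= N by lia.
case: (posnP (code w b)) => cb.
  exists w', v; split=> //.
    by split=> //; apply: sub_all vb => x; lia.
  split=> [i ib||t|]; [by apply: ce; lia | by rewrite ce | |].
  - by rewrite [LHS]sumS_ge // [RHS]sumS_ge // cs ce // cb.
  - by rewrite sumS_ge // cb sv.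
have bN1 : 0 < b < N.
  by case: (ltnP b N) => bn; [lia | rewrite code_out in cb].
have cb' : code w' b = code w b by apply: ce.
have db : (w' b.+1%:Z < w' b%:Z)%R by apply: (@code_gt_descent N); rewrite c0 cb'.
have db1 : (w' (b%:Z + 1) < w' b%:Z)%R by rewrite (_ : (b%:Z + 1)%R = b.+1%:Z) //; lia.
exists (w' \o s_ b%:Z), (b :: v); split.
- split; first by apply: in_SZ_comp => //; exact: in_SZ_s.
  by move=> i io /=; rewrite w'f /s_; do !(case: eqP => ? //=); lia.
- by move=> i; rewrite wE /= s_K.
- by rewrite wl (inv_len_right_gt w'S db1) /= addSnnS.
- split; last by rewrite /= leqnn; apply: sub_all vb => x; lia.
    by rewrite /= path_min_sorted.
  by rewrite /window_letters /= bN1.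
split=> [i ib||t|].
- by rewrite code_descent_other ?ce //; lia.
- by rewrite code_descent_at.
- rewrite sumS_ge // sumS_ge; last by lia.
  rewrite code_descent_at // c0 minn0 add0n [RHS]sumS_ge // -cs [in RHS]sumS_ge; last by lia.
  rewrite c0 minn0 add0n -cb' (code_descent_succ bN1 db) /=; congr (_ + _).
  rewrite big_nat [RHS]big_nat; apply: eq_bigr => i ib.
  by rewrite code_descent_other //; lia.
- by rewrite sumS_ge // cb /= sv.
Qed.

Lemma tight_nil w : reduced_word w [::] -> tight [::] w.
Proof.
move=> [wa _] t; rewrite /capped big1 // => i _; rewrite /code big1 ?minn0 // => j _.
by rewrite !wa /=; lia.
Qed.

(** A round of [peel_state] at b = 1 takes 1 from every positive code at the cost of one letter
    each, just what lowering the cap from t+1 to t takes from the capped sum. *)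
Lemma tight_exists w : in_SZ w -> fixes_outside N w ->
  exists bs, [/\ increasing_blocks N bs, reduced_word w (zword (flatten (rev bs))), tight bs w
    & all (fun v => 0 < size v) bs].
Proof.
move: {2}(inv_len w) (leqnn (inv_len w)) => n; elim: n w => [|n IH] w wn wS wf.
all: have [a [wa sa]] := reduced_word_exists wS.
  move: wn; rewrite leqn0 -sa => /eqP/size0nil a0; rewrite a0 in wa sa.
  by exists [::]; split=> //; exact: tight_nil.
have [w0|wpos] : inv_len w = 0 \/ 0 < inv_len w by lia.
  move: sa; rewrite w0 => /size0nil a0; rewrite a0 in wa.
  by exists [::]; split=> //; apply: tight_nil.
have wi : injective w := bij_inj (proj1 wS).
have [w' [v [[w'S w'f] wE wl [vs vN vb] [ce c0 cs sv]]]] := peel_state wS wf (isT : 0 < 1 <= N.+1).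
have vpos : 0 < size v.
  move: sa wa; case/lastP: a => [|a k] sa wa; first by rewrite -sa in wpos.
  have red : reduced_word w (rcons a k) by [].
  have [_ dk] := reduced_rcons red.
  have /allP/(_ k) := reduced_letters wi wf red; rewrite mem_rcons mem_head => /(_ isT) kN.
  case: k kN dk {red wa sa} => // k kN dk.
  have kN' : 0 < k < N by lia.
  rewrite sv (bigD1_seq k) ?mem_index_iota ?iota_uniq //=; last by lia.
  rewrite (code_descent_succ kN') //.
  by rewrite (_ : k.+1%:Z = (k%:Z + 1)%R) //; lia.
have [bs [bsi red ti bpos]] := IH w' ltac:(lia) w'S w'f.
exists (v :: bs); split.
- by move: bsi; rewrite /increasing_blocks /= vs vN => /andP[-> ->].
- rewrite rev_cons -cats1 flatten_cat /= cats0 /zword map_cat -!/(zword _); split.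
    by case: red => w'a _ i; rewrite wE /= word_perm_cat w'a.
  by rewrite size_cat (proj2 red) wl /zword size_map.
2: by rewrite /= vpos.
move=> [|t]; first by rewrite take0 /capped big1 // => i _; rewrite min0n.
rewrite /= -ti /capped cs sv -big_split /=; apply: eq_bigr => i _.
by case: (code w i) => [|c]; lia.
Qed.
End TightFactorizations.

(** * Codes of the atoms of one involution *)

Section AtomCodes.
Variables (z : int -> int) (N : nat).
Hypothesis N_even : ~~ odd N.
Hypothesis z_out : forall i : int, ((i <= 0) || (N%:Z < i))%R -> z i = Theta i.
Local Notation code := (code N).
Local Notation capped := (capped N).

Lemma atom_window w : in_AFPF z w ->
  [/\ in_SZ w, fpf_conj w z, injective w & fixes_outside N w].
Proof.
move=> wA; case: (wA) => wS wz _; split=> //; first exact: bij_inj (proj1 wS).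
exact: atom_fixes_outside wA N_even z_out.
Qed.

Section Swap.
Variables (w : int -> int) (P R : nat).
Hypothesis wA : in_AFPF z w.
Hypotheses (pO : Theta (w P%:Z) = (w P%:Z + 1)%R) (wr : w R%:Z = (w P%:Z + 2)%R) (RP : R < P).
Hypotheses (R0 : 0 < R) (zRN : (z R%:Z <= N%:Z)%R).
Let J := w P%:Z.
Let w2 := block_swap J \o w.

(** The two pairs occupy R < P < Q < S. The swap trades the inversions of R with P and Q for those
    of P and Q with S; all other values lie below or above these four. *)
Lemma swap_codes : exists Q, [/\ R < P < Q, Q < N.+1, forall i, i != P -> i != Q -> i != R -> code w2 i = code w i,
  [/\ code w2 P = (code w P).+1, code w2 Q = (code w Q).+1 & code w R = (code w2 R).+2] &
  code w P <= code w2 R /\ code w Q <= code w2 R].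
Proof.
have [wS wz wi wf] := atom_window wA; have zK := atom_invol wA.
have rO : Theta (w R%:Z) = (w R%:Z + 1)%R by rewrite wr Theta_add2 pO; lia.
have Rp : (R%:Z < P%:Z)%R by lia.
have [|[_ zpr]] := atom_adjacent wA pO wr; first by lia.
have pq := atom_opener wA pO.
have [Q EQ] : exists Q, z P%:Z = Q%:Z by exists `|z P%:Z|; lia.
have [S ES] : exists S, z R%:Z = S%:Z by exists `|z R%:Z|; lia.
have zRN' := zRN; rewrite EQ in zpr pq; rewrite ES in zpr zRN'.
have wQ : w Q%:Z = (J + 1)%R by rewrite -EQ wz.
have wS' : w S%:Z = (J + 3)%R by rewrite -ES wz rO wr /J; lia.
have val (j : nat) : [/\ (w j%:Z = J -> j = P), (w j%:Z = J + 1 -> j = Q)%R,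
    (w j%:Z = J + 2 -> j = R)%R & (w j%:Z = J + 3 -> j = S)%R].
  by split=> E; [have := wi j%:Z P%:Z | have := wi j%:Z Q%:Z | have := wi j%:Z R%:Z | have := wi j%:Z S%:Z];
     rewrite E ?wQ ?wS' ?wr -/J => /(_ erefl); lia.
have w2E (j : nat) : [/\ w2 P%:Z = (J + 2)%R, w2 Q%:Z = (J + 3)%R, w2 R%:Z = J, w2 S%:Z = (J + 1)%R
   & j != P -> j != Q -> j != R -> j != S -> w2 j%:Z = w j%:Z /\ ((w j%:Z < J) \/ (J + 3 < w j%:Z))%R].
  split; rewrite /w2 /= ?wQ ?wS' ?wr -/J ?block_swapE.
  1-4: by case: ifP => h; try case: ifP => h'; lia.
  move=> jP jQ jR jS; have [v1 v2 v3 v4] := val j.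
  by split; [case: ifP => h; try case: ifP => h' |]; lia.
have SN : S < N.+1 by lia.
have [e1 e2 e3 e4 _] := w2E 0.
have cmp (j : nat) : (w2 j%:Z = w j%:Z /\ (((w j%:Z < J) \/ (J + 3 < w j%:Z))%R /\ (j <> P /\ j <> Q /\ j <> R /\ j <> S))) \/ (j = P \/ j = Q \/ j = R \/ j = S).
  have [_ _ _ _ H] := w2E j.
  case: (eqVneq j P) => [|nP]; first by right; left.
  case: (eqVneq j Q) => [|nQ]; first by right; right; left.
  case: (eqVneq j R) => [|nR]; first by do 3!right; left.
  case: (eqVneq j S) => [|nS]; first by do 4!right.
  by left; have [E h] := H nP nQ nR nS; split=> //; split=> //; lia.
have sum1 (s : nat) : 0 < s <= N -> 1 = \sum_(1 <= j < N.+1) (j == s) by move=> sN; rewrite sum_eq1.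
have JE : w P%:Z = J by [].
exists Q; split; [lia | lia | | |].
- move=> i iP iQ iR; apply: eq_bigr => j _; congr nat_of_bool.
  have [[-> iJ]|[E|[E|[E|E]]]] := cmp i; try by rewrite E eqxx in iP iQ iR.
    by have [[-> jJ]|[E|[E|[E|E]]]] := cmp j; rewrite ?E ?e1 ?e2 ?e3 ?e4 ?wQ ?wS' ?wr ?JE; lia.
  by rewrite E; have [[-> jJ]|[E'|[E'|[E'|E']]]] := cmp j; rewrite ?E' ?e1 ?e2 ?e3 ?e4 ?wQ ?wS' ?wr ?JE; lia.
- split.
  + rewrite -addn1 [X in _ = _ + X](sum1 S); last lia.
    rewrite -big_split /=; apply: eq_bigr => j _.
    by have [[-> jJ]|[E'|[E'|[E'|E']]]] := cmp j; rewrite ?E' ?e1 ?e2 ?e3 ?e4 ?wQ ?wS' ?wr ?JE; lia.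
  + rewrite -addn1 [X in _ = _ + X](sum1 S); last lia.
    rewrite -big_split /=; apply: eq_bigr => j _.
    by have [[-> jJ]|[E'|[E'|[E'|E']]]] := cmp j; rewrite ?E' ?e1 ?e2 ?e3 ?e4 ?wQ ?wS' ?wr ?JE; lia.
  + rewrite -addn2 -[X in _ + X]addn1 [X in _ = _ + (X + _)](sum1 P); last lia.
    rewrite [X in _ = _ + (_ + X)](sum1 Q); last lia.
    rewrite -!big_split /=; apply: eq_bigr => j _.
    by have [[-> jJ]|[E'|[E'|[E'|E']]]] := cmp j; rewrite ?E' ?e1 ?e2 ?e3 ?e4 ?wQ ?wS' ?wr ?JE; lia.
- split; apply: leq_sum => j _.
  + by have [[-> jJ]|[E'|[E'|[E'|E']]]] := cmp j; rewrite ?E' ?e1 ?e2 ?e3 ?e4 ?wQ ?wS' ?wr ?JE; lia.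
  + by have [[-> jJ]|[E'|[E'|[E'|E']]]] := cmp j; rewrite ?E' ?e1 ?e2 ?e3 ?e4 ?wQ ?wS' ?wr ?JE; lia.
Qed.

Lemma sum_three (G : nat -> nat) p q r : 0 < p <= N -> 0 < q <= N -> 0 < r <= N ->
  p != q -> p != r -> q != r ->
  \sum_(1 <= i < N.+1) G i = G p + (G q + (G r +
    \sum_(1 <= i < N.+1) if (i == p) || (i == q) || (i == r) then 0 else G i)).
Proof.
move=> pN qN rN pq pr qr.
have one s : 0 < s <= N -> G s = \sum_(1 <= i < N.+1) (i == s) * G s.
  by move=> sN; rewrite -big_distrl /= sum_eq1 // mul1n.
rewrite [X in _ = X + _](one p) // [X in _ = _ + (X + _)](one q) //.
rewrite [X in _ = _ + (_ + (X + _))](one r) // -!big_split /=; apply: eq_bigr => i _.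
case: (eqVneq i p) => [->|ip]; first by rewrite (negPf pq) (negPf pr) /= mul1n !mul0n !addn0.
case: (eqVneq i q) => [->|iq]; first by rewrite (negPf qr) /= mul1n !mul0n !addn0.
by case: (eqVneq i r) => [->|ir]; rewrite /= ?mul1n !mul0n ?addn0.
Qed.

Lemma swap_sum (F : nat -> nat) : exists x y v c, [/\ y <= x, v <= x,
  \sum_(1 <= i < N.+1) F (code w i) = F x.+2 + (F y + (F v + c)) &
  \sum_(1 <= i < N.+1) F (code w2 i) = F x + (F y.+1 + (F v.+1 + c))].
Proof.
have [Q [RPQ QN eqc [cP cQ cR] [le1 le2]]] := swap_codes.
pose c := \sum_(1 <= i < N.+1) if (i == R) || (i == P) || (i == Q) then 0 else F (code w i).
exists (code w2 R), (code w P), (code w Q), c; split=> //.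
  rewrite (@sum_three (fun i => F (code w i)) R P Q) ?cR //; lia.
rewrite (@sum_three (fun i => F (code w2 i)) R P Q) ?cP ?cQ; try lia.
congr (_ + (_ + (_ + _))); apply: eq_bigr => i _; case: ifP => // /negbT.
by rewrite !negb_or => /andP[/andP[iR iP] iQ]; rewrite eqc.
Qed.
End Swap.

(* The opening points i < z i, read in the order of their values, are increasing. *)
Definition sorted_atom w := forall p r : int, Theta (w p) = (w p + 1)%R -> w r = (w p + 2)%R -> (p < r)%R.

(** Two units pass from a code x + 2 to two codes that are at most x. The sum of squares falls, no
    capped sum falls, and the one at t = x + 1 rises. *)
Lemma unsorted_swap w : in_AFPF z w -> ~ sorted_atom w ->
  exists w2, [/\ in_AFPF z w2, \sum_(1 <= i < N.+1) code w2 i * code w2 i < \sum_(1 <= i < N.+1) code w i * code w i,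
    forall t, capped t w <= capped t w2 & exists t, capped t w < capped t w2].
Proof.
move=> wA ns; have [wS wz wi wf] := atom_window wA; have zK := atom_invol wA.
have [p [r [pO wr rp]]] : exists p r : int, [/\ Theta (w p) = (w p + 1)%R, w r = (w p + 2)%R & (r < p)%R].
  case: (excluded_middle_informative (exists p r : int, [/\ Theta (w p) = (w p + 1)%R, w r = (w p + 2)%R & (r < p)%R])) => // ne.
  case: ns => p r pO wr; case: (ltgtP p r) => // [rp|E]; last by move: wr; rewrite E; lia.
  by case: ne; exists p, r.
have rO : Theta (w r) = (w r + 1)%R by rewrite wr Theta_add2 pO; lia.
have [|[_ zpr]] := atom_adjacent wA pO wr; first by lia.
have pq := atom_opener wA pO.
(* The pair of r encloses that of p, which no pair of Theta could do; so r and z r lie in the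
   window. *)
have r0 : (0 < r)%R.
  rewrite ltNge; apply/negP => r0; have := z_out (i := r); rewrite r0 => /(_ isT).
  by case: (Theta_pm r) => ->; lia.
have zrN : (z r <= N%:Z)%R.
  rewrite leNgt; apply/negP => zN; have := z_out (i := z r); rewrite zN orbT zK => /(_ isT).
  by case: (Theta_pm (z r)) => ->; lia.
have [R ER] : exists R, r = R%:Z by exists `|r|; lia.
have [P EP] : exists P, p = P%:Z by exists `|p|; lia.
subst r p; have RP : R < P by lia.
have R0 : 0 < R by lia.
have SS := swap_sum wA pO wr RP R0 zrN.
exists (block_swap (w P%:Z) \o w); split.
- by have := atom_block_swap wA pO wr rp.
- by have [x [y [v [c [yx vx -> ->]]]]] := SS (fun n => n * n); nia.
- by move=> t; rewrite /capped; have [x [y [v [c [yx vx -> ->]]]]] := SS (minn t); lia.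
have [Q [RPQ QN eqc [cP cQ cR] [le1 le2]]] := swap_codes wA pO wr RP R0 zrN.
set w2 := block_swap _ \o w in eqc cP cQ cR le1 le2 *.
exists (code w2 R).+1; rewrite /capped.
rewrite (@sum_three (fun i => minn _ (code w i)) R P Q); try lia.
rewrite (@sum_three (fun i => minn _ (code w2 i)) R P Q); try lia.
rewrite cP cQ cR.
have -> : \sum_(1 <= i < N.+1) (if (i == R) || (i == P) || (i == Q) then 0 else minn (code w2 R).+1 (code w i)) =
   \sum_(1 <= i < N.+1) (if (i == R) || (i == P) || (i == Q) then 0 else minn (code w2 R).+1 (code w2 i)).
  apply: eq_bigr => i _; case: ifP => // /negbT.
  by rewrite !negb_or => /andP[/andP[iR iP] iQ]; rewrite (eqc i).
lia.
Qed.

Lemma sorted_atom_above w : in_AFPF z w -> exists w', [/\ in_AFPF z w', sorted_atom w',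
   forall t, capped t w <= capped t w' & ~ sorted_atom w -> exists t, capped t w < capped t w'].
Proof.
move: {2}(\sum_(1 <= i < N.+1) code w i * code w i) (leqnn (\sum_(1 <= i < N.+1) code w i * code w i)) => n.
elim: n w => [|n IH] w wn wA.
all: case: (excluded_middle_informative (sorted_atom w)) => [so|ns]; first by exists w; split.
all: have [w2 [w2A lt le [t lt_t]]] := unsorted_swap wA ns.
  by lia.
have [w3 [w3A so le3 _]] := IH w2 ltac:(lia) w2A.
exists w3; split=> // [s|_]; first exact: leq_trans (le s) (le3 s).
by exists t; apply: leq_trans lt_t (le3 t).
Qed.

Lemma sorted_openers w (p r : int) : in_AFPF z w -> sorted_atom w ->
  Theta (w p) = (w p + 1)%R -> Theta (w r) = (w r + 1)%R -> (w p < w r)%R -> (p < r)%R.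
Proof.
move=> wA so; have [wS wz wi wf] := atom_window wA; have [g gK Kg] := proj1 wS.
move=> pO; move: {2}`|(w r - w p)%R| (leqnn `|(w r - w p)%R|) => n.
elim: n r => [|n IH] r wn rO pr; first by lia.
have w2 : (w p + 2 <= w r)%R.
  exact: opener_gap pO rO pr.
have [E|ne] := eqVneq (w r) (w p + 2)%R; first exact: so E.
pose r' := g (w r - 2)%R; have wr' : w r' = (w r - 2)%R by rewrite /r' Kg.
have r'O : Theta (w r') = (w r' + 1)%R by have := Theta_add2 (w r'); rewrite {1}wr' subrK rO; lia.
have pr' : (p < r')%R by apply: IH => //; lia.
by apply: lt_trans pr' _; apply: so => //; rewrite wr' subrK.
Qed.

Lemma z_window (j : nat) : involutive z -> 0 < j <= N -> exists2 k : nat, z j%:Z = k%:Z & 0 < k <= N.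
Proof.
move=> zK jN; have [zj|out] : (0 < z j%:Z <= N%:Z)%R \/ ((z j%:Z <= 0) || (N%:Z < z j%:Z))%R by lia.
  by exists `|z j%:Z|; lia.
have := z_out out; rewrite zK /Theta => E; exfalso.
move: E out; case: (z j%:Z) => k; case: ifP => h E out.
- lia.
- have kN : k = N.+1 by lia.
  by move: h; rewrite /= kN /= N_even.
- by move: h; have -> : Negz k = 0%R by lia.
- lia.
Qed.

(** A later opener has a larger value, so only closing points z j can be inverted with i, and they
    are when the opener j precedes the opener of the pair of i, that is j < i and j < z i. Hence the
    reindexing by z. *)
Lemma sorted_atom_code w (i : nat) : in_AFPF z w -> sorted_atom w -> 0 < i <= N ->
  code w i = fpf_code z i%:Z.
Proof.
move=> wA so iN; have [wS wz wi wf] := atom_window wA; have zK := atom_invol wA.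
have zw := z_window zK.
pose s := [seq k <- index_iota 1 N.+1 | [&& k < i, (i%:Z < z k%:Z)%R & (k%:Z < z i%:Z)%R]].
transitivity (size s); last first.
  rewrite -(size_map Posz); apply/esym/fcard_eq => [|x].
    rewrite map_inj_uniq ?filter_uniq ?iota_uniq // => a b; lia.
  split=> [[x0 xi ix xz]|/mapP[k]].
    have [k kE] : exists k : nat, x = k%:Z by exists `|x|; lia.
    by rewrite kE in x0 xi ix xz *; apply: map_f; rewrite mem_filter mem_index_iota; lia.
  by rewrite mem_filter mem_index_iota => ki ->; split; lia.
have perm_z : perm_eq (index_iota 1 N.+1) [seq `|z k%:Z| | k <- index_iota 1 N.+1].
  have inj : {in index_iota 1 N.+1 &, injective (fun k : nat => `|z k%:Z|)}.
    move=> a b; rewrite !mem_index_iota => aN bN E.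
    have [a' ea _] := zw a ltac:(lia); have [b' eb _] := zw b ltac:(lia).
    have : z a%:Z = z b%:Z by rewrite ea eb in E *; lia.
    by move/(can_inj zK); lia.
  apply: uniq_perm; rewrite ?iota_uniq ?(map_inj_in_uniq inj) ?iota_uniq // => k.
  apply/idP/mapP => [kN|[a aN ->]].
    have kN' : 0 < k <= N by move: kN; rewrite mem_index_iota; lia.
    have [k' ek k'N] := zw k kN'; exists k'; first by rewrite mem_index_iota; lia.
    by have := zK k%:Z; rewrite ek; lia.
  have aN' : 0 < a <= N by move: aN; rewrite mem_index_iota; lia.
  by have [a' -> ?] := zw a aN'; rewrite mem_index_iota; lia.
rewrite /code (perm_big _ perm_z) big_map /= /s size_filter -sum1_count [RHS]big_mkcond /=.
rewrite big_nat [RHS]big_nat; apply: eq_bigr => j jN.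
have jN' : 0 < j <= N by lia.
have [j' ej j'N] := zw j jN'; have [i' ei i'N] := zw i iN.
rewrite ej ei absz_nat; have wj : w j'%:Z = Theta (w j%:Z) by rewrite -ej wz.
have wi' : w i'%:Z = Theta (w i%:Z) by rewrite -ei wz.
have ej' : z j'%:Z = j%:Z by rewrite -ej zK.
have ei' : z i'%:Z = i%:Z by rewrite -ei zK.
have [o [oi oO wo]] : exists o : nat, [/\ o <= i /\ o <= i' /\ (o = i \/ o = i'), Theta (w o%:Z) = (w o%:Z + 1)%R & (w o%:Z = w i%:Z \/ w o%:Z = w i%:Z - 1)%R].
  case: (Theta_pm (w i%:Z)) => E.
    exists i; split=> //; last by left.
    by have := atom_opener wA E; rewrite ei; lia.
  have E' : Theta (w i'%:Z) = (w i'%:Z + 1)%R by rewrite wi' ThetaK E; lia.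
  exists i'; split=> //; last by right; rewrite wi' E.
  by have := atom_opener wA E'; rewrite ei'; lia.
have mono := sorted_openers wA so.
case: (Theta_pm (w j%:Z)) => E.
  have jj' := atom_opener wA E; rewrite ej in jj'.
  have H : (w j%:Z < w o%:Z)%R = (j < o).
    apply/idP/idP => [h|h]; first by have := mono _ _ E oO h; lia.
    rewrite ltNge; apply/negP => h'.
    have : (w o%:Z < w j%:Z)%R by rewrite lt_neqAle h' andbT; apply/eqP => /wi; lia.
    by move/(mono _ _ oO E); lia.
  have gap : (w o%:Z <> w j%:Z + 1)%R.
    by move=> F; move: oO; rewrite F -E ThetaK; lia.
  by case: ifP; rewrite wj E; lia.
have E' : Theta (w j'%:Z) = (w j'%:Z + 1)%R by rewrite wj ThetaK E; lia.
have j'j := atom_opener wA E'; rewrite ej' in j'j.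
case: ifP => [|_]; first by lia.
case: (boolP (i < j')) => //= ij'; case: (boolP (w j'%:Z < w i%:Z)%R) => // h.
have : (w j'%:Z < w o%:Z)%R.
  rewrite lt_neqAle; apply/andP; split; last by lia.
  by apply/eqP => /wi; lia.
by move/(mono _ _ E' oO); lia.
Qed.
End AtomCodes.

(** * Monotone words *)

Fixpoint dec_words c r : seq (seq nat) :=
  if c is c'.+1 then dec_words c' r ++ (if r is r'.+1 then map (cons c') (dec_words c' r') else [::])
  else if r is 0 then [:: [::]] else [::].

Fixpoint inc_words c r : seq (seq nat) :=
  if c is c'.+1 then inc_words c' r ++ (if r is r'.+1 then map (rcons^~ c') (inc_words c' r') else [::])
  else if r is 0 then [:: [::]] else [::].

Fixpoint dec_concat c (al : seq nat) : seq (seq nat) :=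
  if al is r :: al' then [seq v ++ v' | v <- dec_words c r, v' <- dec_concat c al'] else [:: [::]].

Fixpoint inc_blocks c (al : seq nat) : seq (seq (seq nat)) :=
  if al is r :: al' then [seq v :: vs | v <- inc_words c r, vs <- inc_blocks c al'] else [:: [::]].

Lemma mem_dec_words c r v :
  (v \in dec_words c r) = [&& sorted gtn v, all (fun a => a < c) v & size v == r].
Proof.
elim: c r v => [|c IH] r v /=.
  by case: r v => [|r] [|a v]; rewrite /= ?inE ?in_nil ?andbF.
rewrite mem_cat IH; case: v => [|a v].
  case: r => [|r] /=; rewrite ?orbF //; apply/mapP => -[].
  by move=> ? _.
apply/idP/idP => [/orP[/and3P[av ac ->]|]|/and3P[/= av /andP[ac vc] sv]].
- by rewrite av /=; apply/andP; split=> //; apply: sub_all ac => x; lia.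
- case: r => [|r] // /mapP[v']; rewrite IH => /and3P[sv' vc /eqP sr] [-> ->]; rewrite /= sr eqxx ltnSn !andbT.
  apply/andP; split; last by apply: sub_all vc => x; lia.
  by rewrite path_min_sorted.
move: ac; rewrite ltnS leq_eqVlt => /predU1P[ac|ac]; apply/orP.
  right; case: r sv => // r sv; rewrite ac; apply: map_f; rewrite IH.
  move: av; rewrite (path_sortedE (rev_trans ltn_trans)) ac => /andP[-> ->]; exact: sv.
left; rewrite av sv andbT /= ac /=.
by move: av; rewrite (path_sortedE (rev_trans ltn_trans)) => /andP[h _]; apply: sub_all h => x /=; lia.
Qed.

Lemma mem_inc_words c r v :
  (v \in inc_words c r) = [&& sorted ltn v, all (fun a => a < c) v & size v == r].
Proof.
elim: c r v => [|c IH] r v /=.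
  by case: r v => [|r] [|a v]; rewrite /= ?inE ?in_nil ?andbF.
have srcons (x : seq nat) a : sorted ltn (rcons x a) = all (fun y => y < a) x && sorted ltn x.
  by rewrite !(sorted_pairwise ltn_trans) pairwise_rcons.
rewrite mem_cat IH; case/lastP: v => [|v a].
  case: r => [|r] /=; rewrite ?orbF //; apply/mapP => -[].
  by case.
rewrite srcons !all_rcons size_rcons.
apply/idP/idP => [/orP[/and3P[/andP[va vs] /andP[ac vc] ->]|]|/and3P[/andP[va vs] /andP[ac vc] sv]].
- by rewrite va vs ltnS (ltnW ac) !andbT /=; apply: sub_all vc => x; lia.
- case: r => [|r] // /mapP[v']; rewrite IH => /and3P[sv' vc /eqP sr] /rcons_inj [-> ->].
  rewrite sr eqxx ltnSn sv' vc !andbT; apply: sub_all vc => x; lia.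
move: ac; rewrite ltnS leq_eqVlt => /predU1P[ac|ac]; apply/orP.
  right; case: r sv => // r sv; rewrite ac; apply: (map_f (rcons^~ c)); rewrite IH vs.
  by rewrite -{1}ac va; lia.
left; rewrite va vs sv ac !andbT /=; apply: sub_all va => x; lia.
Qed.

Lemma uniq_dec_words c r : uniq (dec_words c r).
Proof.
elim: c r => [|c IH] [|r] //=; first by rewrite cats0.
rewrite cat_uniq !IH map_inj_uniq ?IH ?andbT /=; last by move=> ? ? [].
apply/hasPn => v /mapP[v' _ ->]; apply/negP; rewrite mem_dec_words => /and3P[_ /=].
by rewrite ltnn.
Qed.

Lemma uniq_inc_words c r : uniq (inc_words c r).
Proof.
elim: c r => [|c IH] [|r] //=; first by rewrite cats0.
rewrite cat_uniq !IH map_inj_uniq ?IH ?andbT /=; last by move=> ? ? /rcons_inj [].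
apply/hasPn => v /mapP[v' _ ->]; apply/negP; rewrite mem_inc_words => /and3P[_ ].
by rewrite all_rcons ltnn.
Qed.

Lemma mem_dec_concat c al v : v \in dec_concat c al ->
  size v = sumn al /\ all (fun a => a < c) v.
Proof.
elim: al v => [|r al IH] v /=; first by rewrite inE => /eqP ->.
move=> /allpairsP[[x y] /= [+ /IH [sy yc] ->]]; rewrite mem_dec_words => /and3P[_ xc /eqP <-].
by rewrite size_cat sy all_cat xc.
Qed.

Lemma uniq_dec_concat c al : uniq (dec_concat c al).
Proof.
elim: al => //= r al IH; apply: allpairs_uniq; rewrite ?uniq_dec_words //.
move=> [x y] [x' y'] /allpairsP[[x1 y1] /= [+ _ [-> ->]]] /allpairsP[[x2 y2] /= [+ _ [-> ->]]].
rewrite !mem_dec_words => /and3P[_ _ /eqP s1] /and3P[_ _ /eqP s2] /eqP.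
by rewrite eqseq_cat ?s1 ?s2 // => /andP[/eqP -> /eqP ->].
Qed.

Lemma mem_inc_blocks c al vs : (vs \in inc_blocks c al) =
  [&& all (sorted ltn) vs, all (all (fun a => a < c)) vs & map size vs == al].
Proof.
elim: al vs => [|r al IH] [|v vs] //=.
- by rewrite inE !andbF.
- by apply/allpairsP => -[[x y] []].
apply/allpairsP/idP => [[[x y] /= []]|].
  rewrite mem_inc_words IH => /and3P[xs xc /eqP sx] /and3P[ys yc /eqP sy] [-> ->].
  by rewrite xs xc ys yc sx sy eqxx.
rewrite eqseq_cons => /and3P[/andP[v1 v2] /andP[v3 v4] /andP[v5 v6]].
by exists (v, vs); rewrite /= mem_inc_words IH v1 v2 v3 v4 v5 v6.
Qed.

Lemma uniq_inc_blocks c al : uniq (inc_blocks c al).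
Proof.
elim: al => //= r al IH; apply: allpairs_uniq; rewrite ?uniq_inc_words //.
by move=> [x y] [x' y'] _ _ [-> ->].
Qed.

Section WordProducts.
Variables (A : nzRingType) (u : nat -> A).
Local Notation uprod v := (\prod_(c <- v) u c)%R.

Lemma hh_words c (r : nat) : hh u c r%:Z = (\sum_(v <- dec_words c r) uprod v)%R.
Proof.
elim: c r => [|c IH] r.
  by case: r => [|r] /=; rewrite ?big_seq1 ?big_nil.
rewrite hhS /= big_cat IH; congr (_ + _)%R; case: r => [|r].
  by rewrite big_nil hh_neg ?mulr0.
rewrite big_map (_ : (r.+1%:Z - 1 = r%:Z)%R); last by lia.
by rewrite IH mulr_sumr; apply: eq_bigr => v _; rewrite big_cons.
Qed.

Lemma ee_words c (r : nat) : ee u c r%:Z = (\sum_(v <- inc_words c r) uprod v)%R.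
Proof.
elim: c r => [|c IH] r.
  by case: r => [|r] /=; rewrite ?big_seq1 ?big_nil.
rewrite eeS /= big_cat IH; congr (_ + _)%R; case: r => [|r].
  by rewrite big_nil ee_neg ?mul0r.
rewrite big_map (_ : (r.+1%:Z - 1 = r%:Z)%R); last by lia.
by rewrite IH mulr_suml; apply: eq_bigr => v _; rewrite -cats1 big_cat big_seq1.
Qed.

Lemma prod_hh_words c al : (\prod_(r <- al) hh u c r%:Z = \sum_(v <- dec_concat c al) uprod v)%R.
Proof.
elim: al => [|r al IH] /=; first by rewrite big_nil big_seq1 big_nil.
rewrite big_cons IH hh_words big_allpairs_dep mulr_suml; apply: eq_bigr => v _.
by rewrite mulr_sumr; apply: eq_bigr => v' _; rewrite big_cat.
Qed.

Lemma prod_ee_words c al : (\prod_(r <- al) ee u c r%:Z = \sum_(vs <- inc_blocks c al) uprod (flatten vs))%R.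
Proof.
elim: al => [|r al IH] /=; first by rewrite big_nil big_seq1 big_nil.
rewrite big_cons IH ee_words big_allpairs_dep mulr_suml; apply: eq_bigr => v _.
by rewrite mulr_sumr; apply: eq_bigr => v' _; rewrite big_cat.
Qed.
End WordProducts.

(** * Atoms as geodesics *)

Section AdjacentTranspositions.
Variable C : nat.
Implicit Types (c : nat) (v : seq nat) (y : {perm 'I_C.+1}).
Local Open Scope group_scope.

Definition tp c : {perm 'I_C.+1} := tperm (inord c) (inord c.+1).
Definition pact c y := y ^ tp c.

Lemma inord_eq (a c : nat) : (a <= C)%N -> (c <= C)%N -> (inord a == inord c :> 'I_C.+1) = (a == c)%N.
Proof. by move=> aC cC; rewrite -val_eqE /= !inordK. Qed.

Lemma tpV c : (tp c)^-1 = tp c. Proof. exact: tpermV. Qed.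

Lemma tp_in c x : (c < C)%N -> (x <= C)%N -> tp c (inord x) = inord (swapn c x).
Proof.
move=> cC xC; rewrite /tp /swapn; case: (eqVneq x c) => [->|xc]; first by rewrite tpermL.
case: (eqVneq x c.+1) => [->|xc1]; first by rewrite tpermR.
by rewrite tpermD // inord_eq //; [rewrite eq_sym | lia | rewrite eq_sym].
Qed.

Lemma pactK c y : pact c (pact c y) = y.
Proof. by rewrite /pact -conjgM -{2}tpV mulgV conjg1. Qed.

Lemma tp_far a c : (a.+1 < c)%N -> (c < C)%N -> commute (tp a) (tp c).
Proof.
move=> ac cC; apply/commgP/conjg_fixP; rewrite {1}/tp tpermJ !tp_in //; try lia.
by rewrite /swapn !ifF //; lia.
Qed.

Lemma pact_far a c y : (a.+1 < c)%N -> (c < C)%N -> pact c (pact a y) = pact a (pact c y).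
Proof. by move=> ac cC; rewrite /pact -!conjgM tp_far. Qed.

Lemma pact_braid a y : (a.+1 < C)%N -> pact a (pact a.+1 (pact a y)) = pact a.+1 (pact a (pact a.+1 y)).
Proof.
move=> aC; rewrite /pact -!conjgM; congr (_ ^ _).
have -> : tp a * (tp a.+1 * tp a) = tp a.+1 ^ tp a by rewrite conjgE tpV.
have -> : tp a.+1 * (tp a * tp a.+1) = tp a ^ tp a.+1 by rewrite conjgE tpV.
rewrite {1}/tp tpermJ [in RHS]/tp tpermJ -!/(tp _) !tp_in //; try lia.
rewrite /swapn !eqxx; do !(rewrite ifF; last by lia).
by [].
Qed.

Definition word_tp v := \prod_(c <- v) tp c.

Lemma acts_conj v y : acts pact v y = y ^ word_tp v.
Proof.
elim: v y => [|c v IH] y /=; first by rewrite /word_tp big_nil conjg1.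
by rewrite IH /pact -conjgM /word_tp big_cons.
Qed.

(* Letters 0, ..., C-1 index the generators s_1, ..., s_C of the window. *)
Definition zw v := zword (map S v).

(** Elements of the permutation group compose from left to right, functions from right to left;
    hence the inverse. *)
Lemma word_perm_tp v (i : 'I_C.+1) : all (fun c => c < C)%N v ->
  word_perm (zw v) i.+1%:Z = ((word_tp v)^-1 i).+1%:Z.
Proof.
elim: v i => [|c v IH] i /=; first by rewrite /word_tp big_nil invg1 perm1.
move=> /andP[cC vC]; rewrite IH // /word_tp big_cons invMg permM tpV.
set x := ((word_tp v)^-1)%g i; have xC : (x <= C)%N by rewrite -ltnS.
rewrite s_swapn -{2}(inord_val x) tp_in // inordK; last by rewrite /swapn; do !case: eqP; lia.
by congr Posz; rewrite /swapn !eqSS; do !case: eqP.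
Qed.
End AdjacentTranspositions.

Section ThetaPermutation.
Variable K : nat.
Local Notation C := K.*2.+1.
Local Open Scope group_scope.

(** Index i stands for the integer i + 1, so the parity test is opposite to that of [Theta]. *)
Definition theta_ord (i : 'I_C.+1) : 'I_C.+1 := inord (if odd i then i.-1 else i.+1).
Lemma theta_ordE i : theta_ord i = (if odd i then i.-1 else i.+1) :> nat.
Proof.
rewrite inordK //; have iC := ltn_ord i; case: ifP => o; first by lia.
have : i != C :> nat by apply: contraFneq o => ->; rewrite /= odd_double.
by lia.
Qed.
Lemma theta_ordK : involutive theta_ord.
Proof.
move=> i; apply: val_inj; rewrite /= theta_ordE theta_ordE.
case: (nat_of_ord i) => //= n.
by case o: (odd n); rewrite /= o.
Qed.
Definition thp : {perm 'I_C.+1} := perm (inv_inj theta_ordK).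

Lemma thp_even k : (k.*2 < C)%N -> thp (inord k.*2) = inord k.*2.+1 /\ thp (inord k.*2.+1) = inord k.*2.
Proof.
move=> kC; split; rewrite permE; apply: val_inj; rewrite /= theta_ordE !inordK //=; try lia.
  by rewrite odd_double.
by rewrite odd_double.
Qed.

Lemma thp_Theta (i : 'I_C.+1) : Theta i.+1%:Z = (thp i).+1%:Z.
Proof.
rewrite permE theta_ordE /Theta /=; case: (nat_of_ord i) => [|n] //=.
by case: (odd n) => /=; lia.
Qed.

Lemma pact_even k : (k.*2 < C)%N -> pact k.*2 thp = thp.
Proof.
move=> kC; have [e1 e2] := thp_even kC; apply/conjg_fixP/commgP/commute_sym/commgP/conjg_fixP.
by rewrite /tp tpermJ e1 e2 tpermC.
Qed.

(** Moving all letters to one side leaves a word that exchanges two neighbouring pairs of Theta, and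
    conjugation by it fixes Theta. *)
Lemma pact_odd k : (k.*2.+2 < C)%N ->
  acts (@pact C) [:: k.*2.+1; k.*2] thp = acts (@pact C) [:: k.*2.+1; k.*2.+2] thp.
Proof.
move=> kC /=; apply: (can_inj (@pactK C k.*2.+2)); rewrite pactK.
apply: (can_inj (@pactK C k.*2.+1)); rewrite pactK /pact -!conjgM.
have [e0 e1] := @thp_even k ltac:(lia); have := @thp_even k.+1; rewrite doubleS => /(_ ltac:(lia)) [e2 e3].
set p := k.*2 in e0 e1 e2 e3 kC *.
have -> : tp C p.+1 * (tp C p * (tp C p.+2 * tp C p.+1)) = tp C p ^ tp C p.+1 * tp C p.+2 ^ tp C p.+1.
  by rewrite -conjMg conjgE tpV !mulgA.
have -> : tp C p ^ tp C p.+1 = tperm (inord p) (inord p.+2).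
  rewrite {1}/tp tpermJ !tp_in //; try lia.
  by rewrite /swapn eqxx !ifF //; lia.
have -> : tp C p.+2 ^ tp C p.+1 = tperm (inord p.+1) (inord p.+3).
  rewrite {1}/tp tpermJ !tp_in //; try lia.
  by rewrite /swapn eqxx; do !(rewrite ifF; last by lia).
apply/conjg_fixP/commgP/commute_sym/commgP/conjg_fixP; rewrite conjMg !tpermJ e0 e1 e2 e3.
suff: commute (tperm (inord p.+1) (inord p.+3)) (tperm (inord p) (inord p.+2) : {perm 'I_C.+1}) by [].
by apply/commgP/conjg_fixP; rewrite tpermJ !tpermD // inord_eq //; lia.
Qed.

Definition reach (y : {perm 'I_C.+1}) n := [exists v : n.-tuple 'I_C, acts (@pact C) (map val v) thp == y].
(** The value 0 at unreachable permutations is compatible with [dist_act], because [pact c], an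
    involution, preserves unreachability. *)
Definition dist y : nat :=
  if excluded_middle_informative (exists n, reach y n) is left H then ex_minn H else 0%N.

Lemma reachP y n : reflect (exists v, [/\ size v = n, all (fun c => c < C)%N v & acts (@pact C) v thp = y]) (reach y n).
Proof.
apply: (iffP existsP) => [[v /eqP vy]|[v [sv vC vy]]].
  exists (map val v); rewrite size_map size_tuple; split=> //.
  by apply/allP => c /mapP[c' _ ->]; exact: ltn_ord.
have sv' : size (pmap insub v : seq 'I_C) == n by rewrite size_pmap_sub -sv all_count // in vC *.
exists (Tuple sv'); rewrite -vy /=; apply/eqP; congr (acts _ _ _).
by rewrite (pmap_filter (insubK _)); apply/all_filterP; apply: sub_all vC => c cC; rewrite /= insubT.
Qed.

Lemma dist_le v : all (fun c => c < C)%N v -> (dist (acts (@pact C) v thp) <= size v)%N.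
Proof.
move=> vC; rewrite /dist; case: excluded_middle_informative => // H; case: ex_minnP => m _; apply.
by apply/reachP; exists v.
Qed.

Lemma dist_attained v : all (fun c => c < C)%N v ->
  exists v', [/\ size v' = dist (acts (@pact C) v thp), all (fun c => c < C)%N v' & acts (@pact C) v' thp = acts (@pact C) v thp].
Proof.
move=> vC; rewrite /dist; case: excluded_middle_informative => [H|nH]; last first.
  by case: nH; exists (size v); apply/reachP; exists v.
by case: ex_minnP => m /reachP.
Qed.

Lemma dist_act c y : (c < C)%N -> (dist (pact c y) <= (dist y).+1)%N.
Proof.
move=> cC; case: (excluded_middle_informative (exists n, reach y n)) => [[n /reachP[v [_ vC vy]]]|nr].
  have := dist_attained vC; rewrite vy => -[v' [<- v'C v'y]].
  have := @dist_le (rcons v' c); rewrite all_rcons cC v'C size_rcons => /(_ isT).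
  by rewrite -cats1 acts_cat v'y.
suff : dist (pact c y) = 0%N by move=> ->.
rewrite /dist; case: excluded_middle_informative => [H|//]; case: nr; case: H => n /reachP[v [_ vC vy]].
exists (size v).+1; apply/reachP; exists (rcons v c).
by rewrite size_rcons all_rcons cC vC -cats1 acts_cat vy /= pactK.
Qed.

Lemma dist0 : dist thp = 0%N.
Proof. by apply/eqP; rewrite -leqn0; exact: (@dist_le [::]). Qed.

Section Window.
Variable z : int -> int.
Hypothesis zK : involutive z.
Hypothesis z_out : forall i : int, ((i <= 0) || (C.+1%:Z < i))%R -> z i = Theta i.

Lemma C_even : ~~ odd C.+1. Proof. by rewrite /= odd_double. Qed.

Definition zord (i : 'I_C.+1) : 'I_C.+1 := inord `|z i.+1%:Z|.-1.
Lemma zordE (i : 'I_C.+1) : z i.+1%:Z = (zord i).+1%:Z.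
Proof.
have iN : (0 < i.+1 <= C.+1)%N by exact: ltn_ord.
by rewrite /zord; have [k -> kN] := z_window C_even z_out zK iN; rewrite inordK /=; lia.
Qed.
Lemma zordK : involutive zord.
Proof. by move=> i; apply: val_inj; have := zordE (zord i); rewrite -zordE zK => -[]. Qed.
Definition zp : {perm 'I_C.+1} := perm (inv_inj zordK).
Lemma zpE (i : 'I_C.+1) : z i.+1%:Z = (zp i).+1%:Z. Proof. by rewrite permE zordE. Qed.

Lemma word_perm_out v i : all (fun c => c < C)%N v -> ((i <= 0) || (C.+1%:Z < i))%R ->
  word_perm (zw v) i = i.
Proof.
move=> vC iN; elim: v vC => [|c v IH] //= /andP[cC /IH ->].
by rewrite /s_; do !(case: eqP => ? //=); lia.
Qed.

Lemma fpf_conj_acts v : all (fun c => c < C)%N v ->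
  fpf_conj (word_perm (zw v)) z <-> acts (@pact C) v thp = zp.
Proof.
move=> vC; rewrite acts_conj; set g := word_tp C v; split=> [H|H i].
  apply/permP => i; have := H i.+1%:Z; rewrite zpE !word_perm_tp // thp_Theta -/g => -[] /val_inj E.
  by rewrite conjgE !permM -E permKV.
have [[k iE kN]|out] : (exists2 k : nat, i = k.+1%:Z & (k < C.+1)%N) \/ ((i <= 0) || (C.+1%:Z < i))%R.
  by case: i => [[|k]|k]; [right | case: (ltnP k C.+1) => kN; [left; exists k | right; lia] | right].
  rewrite iE -[k]/(nat_of_ord (Ordinal kN)) zpE !word_perm_tp // thp_Theta -/g -H.
  by rewrite conjgE !permM permK.
rewrite z_out // !(@word_perm_out v) //.
have := C_even; move: out; case: (Theta_pm i) (Theta_odd i) => ->; case: i => n; lia.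
Qed.
End Window.
End ThetaPermutation.

Lemma fpf_conj_involutive w z : in_SZ w -> fpf_conj w z -> involutive z.
Proof. by move=> wS wz i; apply: (bij_inj (proj1 wS)); rewrite !wz ThetaK. Qed.

Lemma fpf_word_exists w z : in_SZ w -> fpf_conj w z -> exists a, fpf_word z a.
Proof.
move=> wS wz; have [a [wa _]] := reduced_word_exists wS.
have {wS wz wa}az : fpf_conj (word_perm a) z by apply: eq_fpf_conj wz.
have [n] := ubnP (size a); elim: n a az => // n IH a az an.
case: (excluded_middle_informative (exists2 a', fpf_conj (word_perm a') z & size a' < size a)) => [[a' a'z sa]|nex].
  by apply: IH a'z _; lia.
exists a; split=> // a' a'z; rewrite leqNgt; apply/negP => lt; apply: nex; by exists a'.
Qed.

(** * Weakly increasing sequences of given content *)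

Fixpoint content_seq k (al : seq nat) : seq nat :=
  if al is r :: al' then nseq r k.+1 ++ content_seq k.+1 al' else [::].

Lemma size_content_seq k al : size (content_seq k al) = sumn al.
Proof. by elim: al k => //= r al IH k; rewrite size_cat size_nseq IH. Qed.

Lemma content_seq_gt k al : all (fun x => k < x) (content_seq k al).
Proof.
elim: al k => //= r al IH k; rewrite all_cat all_nseq ltnSn orbT /=.
by apply: sub_all (IH k.+1) => x; lia.
Qed.

Lemma content_seq_sorted k al : sorted leq (content_seq k al).
Proof.
elim: al k => //= r al IH k; elim: r => [|r IHr] //=.
rewrite (path_sortedE leq_trans) IHr andbT all_cat all_nseq leqnn orbT /=.
by apply: sub_all (content_seq_gt k.+1 al) => x; lia.
Qed.

Lemma count_content_seq k al m : count_mem (k + m).+1 (content_seq k al) = nth 0 al m.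
Proof.
elim: al k m => [|r al IH] k m /=; first by rewrite nth_nil.
rewrite count_cat count_nseq /=; case: m => [|m] /=.
  rewrite addn0 eqxx mul1n; apply/eqP; rewrite -[X in _ == X]addn0 eqn_add2l -leqn0 leqNgt -has_count.
  by apply/hasPn => x /(allP (content_seq_gt k.+1 al)) /=; lia.
by rewrite -addSnnS IH (_ : (k.+1 == (k.+1 + m).+1) = false) ?mul0n //; lia.
Qed.

Lemma content_seq_unique al s : sorted leq s -> all (fun k => 0 < k) s ->
  (forall k, count_mem k.+1 s = nth 0 al k) -> s = content_seq 0 al.
Proof.
move=> ss sp sc; apply: (sorted_eq leq_trans anti_leq ss (content_seq_sorted 0 al)).
apply/allP => x _ /=; case: x => [|x]; last by rewrite sc -(count_content_seq 0 al x) add0n.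
rewrite !(count_memPn _) //; apply/negP.
  by move/(allP (content_seq_gt 0 al)).
by move/(allP sp).
Qed.

(** Positions j and j+1 lie in one block exactly when the content sequence has equal entries there;
    this links decreasing blocks to compatible sequences. *)
Lemma mem_dec_concatP c al k v : size v = sumn al -> all (fun a => a < c) v ->
  reflect (forall j, j.+1 < size v -> nth 0 (content_seq k al) j = nth 0 (content_seq k al) j.+1 ->
             nth 0 v j.+1 < nth 0 v j) (v \in dec_concat c al).
Proof.
elim: al k v => [|r al IH] k v /= sv vc.
  by rewrite (size0nil sv) inE eqxx; apply: ReflectT.
have rv : r <= size v by rewrite sv leq_addr.
have st : size (take r v) = r by rewrite size_takel.
have vE : v = take r v ++ drop r v by rewrite cat_take_drop.
have sd : size (drop r v) = sumn al by rewrite size_drop sv; lia.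
move: (vc); rewrite {1}vE all_cat => /andP[tc dc].
have nthc j : nth 0 (nseq r k.+1 ++ content_seq k.+1 al) j = if j < r then k.+1 else nth 0 (content_seq k.+1 al) (j - r).
  by rewrite nth_cat size_nseq; case: ltnP => // jr; rewrite nth_nseq jr.
have -> : (v \in [seq x ++ y | x <- dec_words c r, y <- dec_concat c al]) =
    sorted gtn (take r v) && (drop r v \in dec_concat c al).
  apply/allpairsP/andP => [[[x y] /= [xr yc E]]|[ts dd]].
    move: xr; rewrite mem_dec_words => /and3P[xs _ /eqP sx].
    by rewrite E -sx take_size_cat // drop_size_cat.
  by exists (take r v, drop r v); rewrite /= mem_dec_words ts tc st eqxx dd.
apply: (iffP andP) => [[ts /(IH k.+1 _ sd dc) dd] j jv|H].
  rewrite !nthc; case: (ltnP j r) => jr; case: (ltnP j.+1 r) => jr1.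
  - move=> _; move/(sortedP 0): ts => /(_ j); rewrite st => /(_ jr1).
    by rewrite !nth_take.
  - move=> E; have := content_seq_gt k.+1 al => /(all_nthP 0) /(_ (j.+1 - r)).
    by rewrite size_content_seq => /(_ ltac:(lia)); lia.
  - by lia.
  - have := dd (j - r); rewrite size_drop !nth_drop (_ : r + (j - r).+1 = j.+1); last by lia.
    rewrite (_ : r + (j - r) = j); last by lia.
    rewrite (_ : (j - r).+1 = j.+1 - r); last by lia.
    by move=> dd' E; apply: dd' E; lia.
split.
  apply/(sortedP 0) => j; rewrite st => jr; rewrite !nth_take //; last by lia.
  by apply: H; [lia | rewrite !nthc jr (ltnW jr)].
apply/(IH k.+1 _ sd dc) => j; rewrite size_drop !nth_drop => jv E.
rewrite addnS; apply: H; first by lia.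
by rewrite !nthc !ifF; [rewrite -addnS !addKn | lia | lia].
Qed.

Lemma count_unique (T : eqType) (p : pred T) s x : uniq s -> x \in s -> p x ->
  (forall y, y \in s -> p y -> y = x) -> count p s = 1.
Proof.
move=> us xs px un; transitivity (count_mem x s); last by rewrite count_uniq_mem // xs.
by apply: eq_in_count => y ys /=; apply/idP/eqP => [/(un y ys)|->].
Qed.

Lemma partial_sums_inj (s t : seq nat) : all (fun x => 0 < x) s -> all (fun x => 0 < x) t ->
  (forall k, sumn (take k s) = sumn (take k t)) -> s = t.
Proof.
elim: s t => [|x s IH] [|y t] //=.
- by move=> _ /andP[y0 _] /(_ 1) /=; rewrite take0; lia.
- by move=> /andP[x0 _] _ /(_ 1) /=; rewrite take0; lia.
move=> /andP[x0 sp] /andP[y0 tp] H; have := H 1; rewrite /= !take0 !addn0 => E; rewrite E; congr cons.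
by apply: IH => // k; have := H k.+1; rewrite /= E => /addnI.
Qed.

(** * The (Theta, z)-entries of products of h_r and e_r *)

Section FixedPointFree.
Variables (K : nat) (z w0 : int -> int).
Local Notation C := K.*2.+1.
Hypotheses (w0S : in_SZ w0) (w0z : fpf_conj w0 z).
Hypothesis z_out : forall i : int, ((i <= 0) || (C.+1%:Z < i))%R -> z i = Theta i.
Let zK : involutive z := fpf_conj_involutive w0S w0z.
Local Notation zb := (zp zK z_out).
Local Notation X := {perm 'I_C.+1}.
Local Notation th := (thp K).

Lemma zw_inj : injective zw.
Proof. by apply: inj_comp; apply: inj_map => a b; [case | case]. Qed.

Lemma fpf_word_letters a : fpf_word z a -> exists2 v, all (fun c => c < C) v & a = zw v.
Proof.
case/AFPF_word=> w [wA wa]; have [_ _ wi wf] := atom_window (C_even K) z_out wA.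
have ac := reduced_letters wi wf wa; exists [seq (`|k|%N).-1 | k <- a].
  by rewrite all_map; apply: sub_all ac => k /=; lia.
rewrite /zw /zword -!map_comp -[LHS]map_id; apply/eq_in_map => k /(allP ac) /=; lia.
Qed.

Definition fpf_letters v := [&& all (fun c => c < C) v, acts (@pact C) v th == zb & dist zb == dist th + size v].

(** [fpf_word] minimizes over all integer words, [dist] over words in the window. The minima agree
    since shortest words stay in the window, by [fpf_word_letters]. *)
Lemma fpf_lettersP v : fpf_letters v <-> fpf_word z (zw v).
Proof.
have [a1 a1z] := fpf_word_exists w0S w0z; have [v1 v1C a1E] := fpf_word_letters a1z.
have v1z : acts (@pact C) v1 th = zb by apply/(fpf_conj_acts zK z_out v1C); rewrite -a1E; case: a1z.
have szw v' : size (zw v') = size v' by rewrite !size_map.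
have v1s : size v1 = dist zb.
  have := dist_attained v1C; rewrite v1z => -[v2 [s2 v2C v2z]].
  apply/eqP; rewrite eqn_leq -{2}v1z dist_le // andbT -s2 -(szw v1) -(szw v2) -a1E.
  by case: a1z => _; apply; apply/(fpf_conj_acts zK z_out v2C).
rewrite /fpf_letters dist0 add0n; split=> [/and3P[vC /eqP vz /eqP vs]|vz].
  split; first exact/(fpf_conj_acts zK z_out vC).
  by move=> a' a'z; rewrite szw -vs -v1s -szw -a1E; case: a1z => _; apply.
have [v' vC /zw_inj E] := fpf_word_letters vz; rewrite -{v'}E in vC.
rewrite vC; have -> /= : acts (@pact C) v th = zb by apply/(fpf_conj_acts zK z_out vC); case: vz.
rewrite eqxx -v1s eqn_leq -!szw -a1E /=; apply/andP; split.
  by case: a1z => _; apply; case: vz.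
by case: vz => _; apply; case: a1z.
Qed.

(** The ring structure on square matrices asks for a size that is visibly a successor. *)
Fact card_window : #|{: X}| = #|{: X}|.-1.+1.
Proof. by rewrite prednK //; apply/card_gt0P; exists 1%g. Qed.
Definition xrank (x : X) : 'I_#|{: X}|.-1.+1 := cast_ord card_window (enum_rank x).
Definition xval (i : 'I_#|{: X}|.-1.+1) : X := enum_val (cast_ord (esym card_window) i).
Lemma xrankK : cancel xrank xval.
Proof. by move=> x; rewrite /xval cast_ordK enum_rankK. Qed.
Lemma xvalK : cancel xval xrank.
Proof. by move=> i; rewrite /xrank enum_valK cast_ordKV. Qed.

Definition fpf_u : nat -> 'M[int]_#|{: X}|.-1.+1 := umx xval (@pact C) (@dist K) C.
Definition fpf_entry : 'M[int]_#|{: X}|.-1.+1 -> int := entry xrank th zb.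
HB.instance Definition _ := GRing.Additive.copy fpf_entry (entry xrank th zb).

Let actL c (x : X) : c < C -> dist (pact c x) <= (dist x).+1. Proof. exact: dist_act. Qed.
Lemma fpf_u_sq a : (fpf_u a * fpf_u a = 0)%R.
Proof. by apply: (umx_sq xrankK xvalK actL) => c x _; exact: pactK. Qed.
Lemma fpf_u_far a b : a.+1 < b -> (fpf_u a * fpf_u b = fpf_u b * fpf_u a)%R.
Proof. by apply: (umx_far xrankK xvalK actL) => {}a {}b x; exact: pact_far. Qed.
Lemma fpf_u_braid a : (fpf_u a * fpf_u a.+1 * fpf_u a = fpf_u a.+1 * fpf_u a * fpf_u a.+1)%R.
Proof. by apply: (umx_braid xrankK xvalK actL) => {}a x; exact: pact_braid. Qed.

Lemma fpf_entry_word v : fpf_entry (\prod_(c <- v) fpf_u c)%R = (fpf_letters v : nat)%:Z.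
Proof. by rewrite /fpf_entry (entry_word xrankK xvalK actL). Qed.
Lemma fpf_entry_hh_ee s : fpf_entry (\prod_(r <- s) hh fpf_u C r%:Z)%R =
  fpf_entry (\prod_(r <- rev s) ee fpf_u C r%:Z)%R.
Proof.
apply: phi_hh_ee.
- exact: fpf_u_sq.
- exact: fpf_u_far.
- exact: fpf_u_braid.
- move=> k M; apply: (entry_even xrankK xvalK); [exact: dist0 | exact: pact_even].
- move=> k M kK; apply: (entry_odd xrankK xvalK actL); [ | lia].
  by move=> j; exact: pact_odd.
Qed.

(** Compatible sequences would allow a repeated letter inside a block, strictly decreasing words do
    not; u_a^2 = 0 rules the repetition out. *)
Lemma fpf_letters_neq v j : fpf_letters v -> j.+1 < size v -> nth 0 v j != nth 0 v j.+1.
Proof.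
move=> vz jv; apply/eqP => E; have := fpf_entry_word v; rewrite vz.
rewrite -(cat_take_drop j v) big_cat (drop_nth 0) ?(drop_nth 0 (n := j.+1)) //; last by lia.
rewrite !big_cons -E /= (mulrA (fpf_u _)) fpf_u_sq mul0r mulr0 => H.
by have := raddf0 fpf_entry; rewrite [LHS]H.
Qed.

(** The content determines the sequence i, so a pair counted by [hatF_coeff] amounts to its word,
    cut into decreasing blocks of lengths al. *)
Lemma fpf_entry_hh al : fpf_entry (\prod_(r <- al) hh fpf_u C r%:Z)%R = (hatF_coeff z al)%:Z.
Proof.
rewrite prod_hh_words raddf_sum (eq_bigr _ (fun v _ => fpf_entry_word v)).
rewrite (_ : hatF_coeff z al = count fpf_letters (dec_concat C al)); last first.
  rewrite -size_filter -(size_map (fun v => (zw v, content_seq 0 al))).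
  apply: fcard_eq; first by rewrite map_inj_uniq ?filter_uniq ?uniq_dec_concat // => v v' [] /zw_inj.
  move=> [a i]; split=> /= [[/AFPF_word az [si [ip [is_ [asc cnt]]]]]|].
    have E := content_seq_unique is_ ip cnt; have [v vC aE] := fpf_word_letters az.
    rewrite aE in az si asc *; have vz := az; move/fpf_lettersP: vz => vz.
    rewrite !size_map in si asc *; rewrite E; apply: (map_f (fun v => (zw v, content_seq 0 al))).
    rewrite mem_filter vz; apply/(@mem_dec_concatP C al 0) => //; first by rewrite -si E size_content_seq.
    move=> j jv; rewrite -E => ij; have := fpf_letters_neq vz jv.
    have := asc j jv; rewrite /zw /zword -map_comp !(nth_map 0) ?(ltnW jv) //= ij ltnn.
    by case: ltngtP => // _ /(_ ltac:(lia)).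
  case/mapP=> v; rewrite mem_filter => /andP[vz vd] [-> ->]; have [sv vC] := mem_dec_concat vd.
  split; first exact/AFPF_word/fpf_lettersP.
  rewrite size_content_seq /zw /zword -map_comp size_map sv; split=> //.
  split; first exact: content_seq_gt.
  split; first exact: content_seq_sorted.
  split=> [j jv|k]; last by rewrite -(count_content_seq 0).
  rewrite -sv in jv; rewrite !(nth_map 0) ?(ltnW jv) //= => lt.
  have /(@mem_dec_concatP C al 0 v sv vC) H := vd.
  have := content_seq_sorted 0 al => /(sortedP 0) /(_ j); rewrite size_content_seq -sv => /(_ jv).
  by rewrite leq_eqVlt => /predU1P[/(H j jv)|//]; lia.
by elim: (dec_concat C al) => [|v vs IH]; rewrite ?big_nil // big_cons IH /= PoszD.
Qed.

Definition code_cap t := \sum_(1 <= i < C.+2) minn t (fpf_code z i%:Z).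

Lemma capped_sorted w t : in_AFPF z w -> sorted_atom w -> capped C.+1 t w = code_cap t.
Proof.
move=> wA ws; rewrite /capped big_nat [RHS]big_nat; apply: eq_bigr => i iC.
by rewrite (sorted_atom_code (C_even K) z_out wA ws) //; lia.
Qed.

Lemma capped_le w t : in_AFPF z w -> capped C.+1 t w <= code_cap t.
Proof.
move=> wA; have [w' [w'A w's le _]] := sorted_atom_above (C_even K) z_out wA.
by rewrite -(capped_sorted t w'A w's).
Qed.

Definition blocks (vs : seq (seq nat)) := rev (map (map S) vs).

Lemma flatten_blocks vs : zword (flatten (rev (blocks vs))) = zw (flatten vs).
Proof. by rewrite revK -map_flatten. Qed.

Lemma increasing_blocksS vs : all (sorted ltn) vs -> all (all (fun c => c < C)) vs ->
  increasing_blocks C.+1 (blocks vs).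
Proof.
move=> vss vsC; rewrite /increasing_blocks !all_rev !all_map; apply/andP; split.
  by apply: sub_all vss => v; rewrite /= sorted_map.
by apply: sub_all vsC => v; rewrite /= /window_letters all_map.
Qed.

Lemma blocks_atom s vs : vs \in inc_blocks C s -> fpf_letters (flatten vs) ->
  exists w, [/\ in_AFPF z w, increasing_blocks C.+1 (blocks vs),
    reduced_word w (zword (flatten (rev (blocks vs)))) & map size (blocks vs) = rev s].
Proof.
rewrite mem_inc_blocks => /and3P[vss vsC /eqP <-] /fpf_lettersP /AFPF_word[w [wA wr]].
exists w; split=> //; first exact: increasing_blocksS.
  by rewrite flatten_blocks.
by rewrite map_rev -map_comp; congr rev; apply: eq_map => v; rewrite /= size_map.
Qed.

Lemma fpf_entry_ee s : fpf_entry (\prod_(r <- s) ee fpf_u C r%:Z)%R =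
  (count (fpf_letters \o flatten) (inc_blocks C s))%:Z.
Proof.
rewrite prod_ee_words raddf_sum (eq_bigr _ (fun v _ => fpf_entry_word _)).
by elim: (inc_blocks C s) => [|v vs IH]; rewrite ?big_nil // big_cons IH /= PoszD.
Qed.

Lemma fpf_entry_ee_weight s : fpf_entry (\prod_(r <- s) ee fpf_u C r%:Z)%R != 0%R -> sumn s = dist zb.
Proof.
rewrite fpf_entry_ee eqz_nat -lt0n -has_count => /hasP[vs].
rewrite mem_inc_blocks => /and3P[_ _ /eqP <-] /and3P[_ _ /eqP ->].
by rewrite dist0 add0n size_flatten.
Qed.

Lemma fpf_entry_ee_bound s t : fpf_entry (\prod_(r <- s) ee fpf_u C r%:Z)%R != 0%R ->
  sumn (take t (rev s)) <= code_cap t.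
Proof.
rewrite fpf_entry_ee eqz_nat -lt0n -has_count => /hasP[vs vsC vz].
have [w [wA wi wr <-]] := blocks_atom vsC vz.
exact: leq_trans (capped_blocks t wi wr) (capped_le t wA).
Qed.

(** An unsorted atom has some capped sum too small for these block lengths. Sorted atoms share their
    code, so [tight_unique] leaves one factorization, and [tight_exists] provides it. *)
Lemma fpf_entry_ee_top s : all (fun r => 0 < r) s -> (forall t, sumn (take t (rev s)) = code_cap t) ->
  fpf_entry (\prod_(r <- s) ee fpf_u C r%:Z)%R = 1%R.
Proof.
move=> sp sc; rewrite fpf_entry_ee; congr Posz.
have top_sorted w vs : vs \in inc_blocks C s -> in_AFPF z w ->
    reduced_word w (zword (flatten (rev (blocks vs)))) -> increasing_blocks C.+1 (blocks vs) ->
    map size (blocks vs) = rev s -> sorted_atom w.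
  move=> vsC wA wr wi ws; case: (excluded_middle_informative (sorted_atom w)) => // ns.
  have [w' [w'A w's _ /(_ ns)[t]]] := sorted_atom_above (C_even K) z_out wA.
  by have := capped_blocks t wi wr; rewrite ws sc (capped_sorted t w'A w's); lia.
have [a0 a0z] := fpf_word_exists w0S w0z; have /AFPF_word[w1 [w1A _]] := a0z.
have [w [wA ws _ _]] := sorted_atom_above (C_even K) z_out w1A.
have [wS wz wi wf] := atom_window (C_even K) z_out wA.
have [bs [bi br bt bp]] := tight_exists wS wf.
(* Letters of the window start at 1, those of [inc_blocks] at 0. *)
have bE : bs = blocks (rev (map (map predn) bs)).
  rewrite /blocks map_rev revK -map_comp -[LHS]map_id; apply/eq_in_map => v vb /=.
  rewrite -map_comp -[LHS]map_id; apply/eq_in_map => c cv /=.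
  by move: bi => /andP[_ /allP/(_ _ vb)/allP/(_ _ cv)]; lia.
have bs_s : map size bs = rev s.
  apply: partial_sums_inj; rewrite ?all_map ?all_rev //.
  by move=> t; rewrite -bt sc (capped_sorted _ wA ws).
pose vs := rev (map (map predn) bs); have vsE : blocks vs = bs by rewrite -bE.
have vsC : vs \in inc_blocks C s.
  move: bi => /andP[bss bsN]; rewrite mem_inc_blocks /vs !all_rev !all_map; apply/and3P; split.
  - apply/allP => v vb /=; have /allP/(_ _ vb)/allP vN := bsN; have /allP/(_ _ vb) := bss.
    apply: (homo_sorted_in (P := mem v)) => //.
    by move=> c c' /vN + /vN /=; lia.
  - apply: sub_all bsN => v /= vN; rewrite all_map; apply: sub_all vN => c /=; lia.
  rewrite map_rev -map_comp -[s]revK -bs_s; apply/eqP; congr rev.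
  by apply: eq_map => v; rewrite /= size_map.
apply: (@count_unique _ _ _ vs) => //.
- exact: uniq_inc_blocks.
- by apply/fpf_lettersP; rewrite -flatten_blocks vsE; apply/AFPF_word; exists w.
move=> us usC uz; have [w' [w'A ui ur us_s]] := blocks_atom usC uz.
have w's := top_sorted _ _ usC w'A ur ui us_s.
suff : bs = blocks us.
  by rewrite -vsE => /(can_inj revK)/(inj_map (inj_map succn_inj)).
apply: (tight_unique _ bi ui br ur) => //; first by rewrite bs_s us_s.
move=> i; have [iN|iN] := leqP C.+1 i; first by rewrite !code_out.
have [i0|i0] := posnP i; last first.
  by rewrite !(sorted_atom_code (C_even K) z_out (i := i)) //; lia.
have [_ _ w'i w'f] := atom_window (C_even K) z_out w'A.
have c0 v : injective v -> fixes_outside C.+1 v -> code C.+1 v 0 = 0.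
  move=> vi vf; rewrite /code big_nat big1 // => j jN.
  by have := fixes_outside_range (i := j%:Z) vi vf; rewrite (vf 0%R) //; lia.
by rewrite i0 !c0.
Qed.
End FixedPointFree.

(** * Dominance and conjugation *)

Section Conjugation.
Implicit Types (la mu : seq nat) (k t p : nat).

Lemma leq_foldr_max la p : p \in la -> p <= foldr maxn 0 la.
Proof. by elim: la => //= q la IH; rewrite inE => /predU1P[->|/IH]; lia. Qed.

Lemma nth_conjp la k : nth 0 (conjp la) k = count (fun p => k < p) la.
Proof.
case: (ltnP k (foldr maxn 0 la)) => kM; first by rewrite nth_mkseq.
rewrite nth_default ?size_mkseq //; apply/esym/eqP; rewrite -leqn0 leqNgt -has_count.
by apply/hasPn => p /leq_foldr_max; lia.
Qed.

Lemma sum_ltn n p : \sum_(0 <= k < n) (k < p : nat) = minn n p.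
Proof. by elim: n => [|n IH]; rewrite ?big_nil ?min0n // big_nat_recr //= IH; lia. Qed.

Lemma sumn_take_conjp t la : sumn (take t (conjp la)) = \sum_(p <- la) minn t p.
Proof.
rewrite /conjp /mkseq -map_take take_iota sumnE big_map -[iota _ _]/(iota 0 _).
set n := minn t _; rewrite -[n in iota 0 n]subn0 -/(index_iota 0 n).
rewrite (eq_bigr (fun k => \sum_(p <- la) (k < p : nat))); last by move=> k _; rewrite -sum1_count big_mkcond.
rewrite exchange_big /=; apply: eq_big_seq => p /leq_foldr_max pM.
by rewrite sum_ltn /n -minnA (minn_idPr pM).
Qed.

Lemma conjp_partition la : is_partition (conjp la).
Proof.
apply/andP; split.
  apply/(sortedP 0) => i; rewrite size_mkseq => iM; rewrite !nth_conjp /=.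
  by apply: sub_count => p /=; lia.
apply/(all_nthP 0) => i; rewrite size_mkseq nth_conjp => iM; rewrite -has_count; apply/hasP.
elim: la iM => //= q la IH; case: (leqP (foldr maxn 0 la) q) => qM iM.
  by exists q; [rewrite mem_head | move: iM; lia].
by have [|p pla pi] := IH; [lia | exists p; rewrite // inE pla orbT].
Qed.

Lemma ltn_count_geq la i k : sorted geq la -> (i < count (fun p => k < p) la) = (k < nth 0 la i).
Proof.
have geq_trans : transitive geq by move=> a b c /=; lia.
elim: la i => [|p la IH] i /=; first by rewrite nth_nil.
rewrite (path_sortedE geq_trans) => /andP[/allP lap /IH {}IH]; case: (ltnP k p) => kp /=.
  by case: i => [|i]; rewrite ?add1n //= -IH.
rewrite (_ : count _ _ = 0); last first.
  by apply/eqP; rewrite -leqn0 leqNgt -has_count; apply/hasPn => q /lap /=; lia.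
apply/esym/negbTE; rewrite -leqNgt; case: i => [|i] //=.
by case: (ltnP i (size la)) => il; [have := lap _ (mem_nth 0 il) => /=; lia | rewrite nth_default].
Qed.

Lemma sumn_take t la : sumn (take t la) = \sum_(0 <= i < t) nth 0 la i.
Proof.
elim: t la => [|t IH] [|p la]; rewrite ?take0 ?big_nil //=.
  by rewrite big1 // => i _; rewrite nth_nil.
by rewrite IH big_nat_recl.
Qed.

Lemma conjpK la : is_partition la -> conjp (conjp la) = la.
Proof.
move=> lp; have /andP[las la0] := lp; have /andP[_ cc0] := conjp_partition (conjp la).
apply: partial_sums_inj => // t; rewrite sumn_take_conjp /conjp /mkseq big_map.
set M := foldr _ _ _; rewrite -[M]subn0 -/(index_iota 0 M).
have E k : minn t (count (fun p => k < p) la) = \sum_(0 <= i < t) (k < nth 0 la i : nat).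
  by rewrite -sum_ltn; apply: eq_bigr => i _; rewrite ltn_count_geq.
rewrite (eq_bigr _ (fun k _ => E k)) exchange_big /=.
rewrite sumn_take.
rewrite big_nat [RHS]big_nat; apply: eq_bigr => i _; rewrite sum_ltn; apply/minn_idPr.
case: (ltnP i (size la)) => il; last by rewrite nth_default.
exact/leq_foldr_max/mem_nth.
Qed.

Lemma sumn_conjp la : sumn (conjp la) = sumn la.
Proof.
rewrite -[conjp la](take_size) sumn_take_conjp size_mkseq sumnE.
by apply: eq_big_seq => p /leq_foldr_max /minn_idPr.
Qed.

Lemma leq_size_sum la (F : nat -> nat) a : (forall p, p \in la -> a <= F p) -> size la * a <= \sum_(p <- la) F p.
Proof.
elim: la => [|q la IH] H; first by rewrite big_nil.
by rewrite big_cons mulSn leq_add ?H ?mem_head // IH // => p pla; rewrite H // inE pla orbT.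
Qed.

Lemma leq_sum_size la (F : nat -> nat) a : (forall p, F p <= a) -> \sum_(p <- la) F p <= size la * a.
Proof. by move=> H; elim: la => [|q la IH]; rewrite ?big_nil // big_cons mulSn leq_add. Qed.

Lemma nth_geq la i j : sorted geq la -> i <= j -> nth 0 la j <= nth 0 la i.
Proof.
move=> las ij; case: (ltnP j (size la)) => jl; last by rewrite nth_default.
have geq_trans : transitive geq by move=> a b c /=; lia.
by apply: (sorted_leq_nth geq_trans _ 0 las) => //; rewrite ?inE; [move=> a /= | lia].
Qed.

(* The sum of the first t rows of [la] is read off from its first a columns for
   a = la_t, since these columns are full in the first t rows. *)
Lemma dominance_conj la mu t : sorted geq la -> sumn la = sumn mu ->
  (forall a, \sum_(p <- la) minn a p <= sumn (take a mu)) ->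
  \sum_(p <- mu) minn t p <= sumn (take t la).
Proof.
move=> las lm dom; pose a := nth 0 la t.
have H1 : t * a + sumn la <= sumn (take t la) + \sum_(p <- la) minn a p.
  case: (ltnP t (size la)) => tl; last by rewrite /a nth_default // take_oversize //; lia.
  rewrite -{1 3}(cat_take_drop t la) sumn_cat big_cat /= addnCA leq_add2l.
  apply: leq_add.
    rewrite -{1}(size_takel (ltnW tl)); apply: leq_size_sum => p /(nthP 0)[i]; rewrite size_takel ?(ltnW tl) // => it <-.
    by rewrite nth_take // leq_min leqnn nth_geq // ltnW.
  rewrite sumnE big_seq [X in _ <= X]big_seq leq_sum // => p /(nthP 0)[i _ <-].
  by rewrite nth_drop leq_min leqnn nth_geq // leq_addr.
have H2 : \sum_(p <- mu) minn t p <= t * a + sumn (drop a mu).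
  rewrite -{1}(cat_take_drop a mu) big_cat /=; apply: leq_add; last first.
    by rewrite sumnE leq_sum // => p _; lia.
  apply: leq_trans (leq_sum_size _ (a := t) _) _ => [p|]; first exact: geq_minl.
  by rewrite mulnC leq_mul // size_take; case: ltnP; lia.
have := dom a; rewrite -{1}(cat_take_drop a mu) sumn_cat in lm; lia.
Qed.
End Conjugation.

(** * Chains of strips and dominance *)

Section ShapeRows.
Variables d b : nat.
Implicit Types (l m : {ffun 'I_d.+1 -> 'I_b.+1}) (s : seq nat) (t : nat).

Definition rows l : seq nat := [seq (l i : nat) | i <- enum 'I_d.+1].

Lemma size_rows l : size (rows l) = d.+1. Proof. by rewrite size_map size_enum_ord. Qed.
Lemma nth_rows l (i : 'I_d.+1) : nth 0 (rows l) i = l i.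
Proof. by rewrite (nth_map i) ?size_enum_ord // nth_ord_enum. Qed.

Lemma rows_sorted l : is_part l -> sorted geq (rows l).
Proof.
move=> lp; apply/(sortedP 0) => i; rewrite size_rows => iD.
by rewrite -[i.+1]/(nat_of_ord (Ordinal iD)) -[i]/(nat_of_ord (Ordinal (ltnW iD))) !nth_rows /= is_part_le.
Qed.

Lemma rows_shape l : is_part l -> rows l = shape_seq l ++ nseq (d.+1 - size (shape_seq l)) 0.
Proof.
move=> lp; rewrite -[d.+1](size_rows l) size_filter; apply: filter_nseq_split => [|y _]; last by lia.
have geq_trans : transitive geq by move=> a c e /=; lia.
apply: sub_pairwise (_ : pairwise geq _) => [x y /=|]; first by lia.
by rewrite -sorted_pairwise ?rows_sorted.
Qed.

Lemma shape_seq_inj l m : is_part l -> is_part m -> shape_seq l = shape_seq m -> l = m.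
Proof.
move=> lp mp E; apply/ffunP => i; apply: val_inj; rewrite /= -!nth_rows.
by rewrite (rows_shape lp) (rows_shape mp) E.
Qed.

Lemma shape_partition l : is_part l -> is_partition (shape_seq l).
Proof.
move=> lp; rewrite /is_partition filter_all andbT sorted_filter ?rows_sorted //.
by move=> a c e /=; lia.
Qed.

Lemma shape_sum l (F : nat -> nat) : F 0 = 0 -> \sum_(p <- shape_seq l) F p = \sum_i F (l i).
Proof.
move=> F0; rewrite big_filter big_map -big_enum big_mkcond /=; apply: eq_bigr => i _.
by case: posnP => // ->.
Qed.

Lemma sumn_shape l : sumn (shape_seq l) = weight l.
Proof. by rewrite sumnE (shape_sum l (F := id)). Qed.

Lemma leq_take_rows l m t : (forall i, m i <= l i) -> sumn (take t (rows m)) <= sumn (take t (rows l)).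
Proof.
move=> ml; rewrite !sumn_take; apply: leq_sum => i _; case: (ltnP i d.+1) => iD.
  by rewrite -[i]/(nat_of_ord (Ordinal iD)) !nth_rows.
by rewrite !nth_default ?size_rows.
Qed.

Lemma take_shape l t : is_part l -> sumn (take t (shape_seq l)) = sumn (take t (rows l)).
Proof.
move=> lp; rewrite !sumn_take; apply: eq_bigr => i _; rewrite (rows_shape lp) nth_cat.
by case: ltnP => // il; rewrite nth_nseq nth_default //; case: ifP.
Qed.

Lemma sumn_rows l : sumn (rows l) = weight l.
Proof. by rewrite sumnE big_map big_enum. Qed.

(** After t horizontal strips at most t rows are occupied; [rev s] lists the strips from the
    inside. *)
Lemma hcount_bound s l : hcount s l != 0 ->
  (forall i : 'I_d.+1, size s <= i -> l i = ord0) /\ forall t, sumn (take t (rev s)) <= sumn (take t (rows l)).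
Proof.
elim: s l => [|r s IH] l /= H.
  split=> [i _|t]; last by [].
  by move: H; rewrite eqb0 negbK => /eqP ->; rewrite ffunE.
have wl := hcount_weight (s := r :: s) H.
move: H; rewrite sum_nat_eq0 negb_forall => /existsP[m]; rewrite negb_imply.
move=> /andP[/and3P[mp ml _] /IH [m0 mt]].
have l0 (i : 'I_d.+1) : size s < i -> l i = ord0.
  move=> si; apply: val_inj; apply/eqP; rewrite /= -leqn0.
  have /forallP/(_ i)/andP[_] := ml; rewrite /row_above; case: eqP => [i0|_]; first by rewrite i0 in si.
  by rewrite m0 // inordK; have := ltn_ord i; lia.
split=> // t; rewrite rev_cons; case: (leqP t (size s)) => ts.
  rewrite -cats1 takel_cat ?size_rev //; apply: leq_trans (mt t) _; apply: leq_take_rows => i.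
  exact: hstrip_le.
rewrite take_oversize ?size_rcons ?size_rev // -rev_cons sumn_rev -wl -sumn_rows.
rewrite -[rows l in X in X <= _](cat_take_drop t) sumn_cat -[X in _ <= X]addn0 leq_add2l.
rewrite leqn0 sumnE big_seq big1 // => p /(nthP 0)[i]; rewrite size_drop size_rows => id <-.
have iD : t + i < d.+1 by lia.
by rewrite nth_drop -[t + i]/(nat_of_ord (Ordinal iD)) nth_rows l0 //=; lia.
Qed.

(** After t vertical strips no row is longer than t. *)
Lemma vcount_bound s l : vcount s l != 0 ->
  (forall i, l i <= size s) /\ forall t, sumn (take t (rev s)) <= \sum_i minn t (l i).
Proof.
elim: s l => [|r s IH] l /= H.
  split=> [i|t]; last by [].
  by move: H; rewrite eqb0 negbK => /eqP ->; rewrite ffunE.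
have wl := vcount_weight (s := r :: s) H.
move: H; rewrite sum_nat_eq0 negb_forall => /existsP[m]; rewrite negb_imply.
move=> /andP[/and3P[mp /forallP ml _] /IH [m0 mt]].
have l0 i : l i <= (size s).+1 by have /andP[_ +] := ml i; have := m0 i; lia.
split=> // t; rewrite rev_cons; case: (leqP t (size s)) => ts.
  rewrite -cats1 takel_cat ?size_rev //; apply: leq_trans (mt t) _; apply: leq_sum => i _.
  by have /andP[+ _] := ml i; lia.
rewrite take_oversize ?size_rcons ?size_rev // -rev_cons sumn_rev -wl.
by apply: leq_sum => i _; have := l0 i; lia.
Qed.

Lemma sumn_takeS t s : sumn (take t.+1 s) = sumn (take t s) + nth 0 s t.
Proof. by rewrite !sumn_take big_nat_recr. Qed.

Definition top_rows t l : {ffun 'I_d.+1 -> 'I_b.+1} := [ffun i : 'I_d.+1 => if i < t then l i else ord0].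

Lemma weight_top_rows t l : t <= d.+1 -> weight (top_rows t l) = sumn (take t (rows l)).
Proof.
move=> td; rewrite -sumn_rows -[X in sumn X](cat_take_drop t) sumn_cat.
have -> : sumn (drop t (rows (top_rows t l))) = 0.
  rewrite sumnE big_seq big1 // => p /(nthP 0)[i]; rewrite size_drop size_rows => id <-.
  have iD : t + i < d.+1 by lia.
  by rewrite nth_drop -[t + i]/(nat_of_ord (Ordinal iD)) nth_rows ffunE ifF //=; lia.
rewrite addn0 !sumn_take big_nat [RHS]big_nat; apply: eq_bigr => i it.
have iD : i < d.+1 by lia.
by rewrite -[i]/(nat_of_ord (Ordinal iD)) !nth_rows ffunE ifT.
Qed.

Lemma top_rows_part t l : is_part l -> is_part (top_rows t l).
Proof.
move=> /forallP lp; apply/forallP => i; have := lp i; rewrite /row_above !ffunE.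
case: eqP => [_|/eqP i0 li]; first by case: ifP => //.
case: ltnP => it //; rewrite ifT // inordK; move: i0; rewrite -val_eqE /=; have := ltn_ord i; lia.
Qed.

(** A partition can be built row by row from the top, each new row being a horizontal strip. *)
Lemma hcount_top_rows t l : is_part l -> t <= d.+1 -> 0 < hcount (rev (take t (rows l))) (top_rows t l).
Proof.
move=> lp; elim: t => [|t IH] td.
  by rewrite take0 /= lt0n eqb0 negbK; apply/eqP/ffunP => i; rewrite !ffunE.
rewrite (take_nth 0) ?size_rows // rev_rcons /= (bigD1 (top_rows t l)) /=; first by have := IH (ltnW td); lia.
rewrite top_rows_part // !weight_top_rows ?(ltnW td) // sumn_takeS eqxx andbT /=.
apply/forallP => i; have /forallP/(_ i) := lp; rewrite /row_above !ffunE.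
case: (ltngtP i t) => it li.
- rewrite ifT ?leqnn /=; last by lia.
  case: eqP li => // /eqP i0 li; rewrite ifT // inordK; move: i0; rewrite -val_eqE /=; have := ltn_ord i; lia.
- by rewrite ifF //; lia.
rewrite [i < t.+1]ltnS it leqnn -it /=; case: eqP li => // /eqP i0 li; rewrite ifT // inordK; move: i0; rewrite -val_eqE /=; have := ltn_ord i; lia.
Qed.

Lemma hcount_rows l : is_part l -> 0 < hcount (rev (rows l)) l.
Proof.
move=> lp; have := hcount_top_rows lp (leqnn d.+1).
rewrite take_oversize ?size_rows // (_ : top_rows _ l = l) //.
by apply/ffunP => i; rewrite ffunE ltn_ord.
Qed.

Fact left_columns_bound t l i : minn t (l i) < b.+1.
Proof. by have := ltn_ord (l i); lia. Qed.
Definition left_columns t l : {ffun 'I_d.+1 -> 'I_b.+1} := [ffun i => Ordinal (left_columns_bound t l i)].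

Lemma weight_left_columns t l : weight (left_columns t l) = sumn (take t (conjp (shape_seq l))).
Proof.
rewrite sumn_take_conjp shape_sum ?minn0 //; apply: eq_bigr => i _; by rewrite ffunE.
Qed.

Lemma left_columns_part t l : is_part l -> is_part (left_columns t l).
Proof.
move=> /forallP lp; apply/forallP => i; have := lp i; rewrite /row_above !ffunE /=.
by case: eqP => _; have := ltn_ord (l i); lia.
Qed.

(** Columns added from left to right are vertical strips. *)
Lemma vcount_left_columns t l : is_part l -> t <= size (conjp (shape_seq l)) ->
  0 < vcount (rev (take t (conjp (shape_seq l)))) (left_columns t l).
Proof.
move=> lp; elim: t => [|t IH] td.
  by rewrite take0 /= lt0n eqb0 negbK; apply/eqP/ffunP => i; apply: val_inj; rewrite !ffunE /= min0n.
rewrite (take_nth 0) // rev_rcons /= (bigD1 (left_columns t l)) /=; first by have := IH (ltnW td); lia.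
rewrite left_columns_part // !weight_left_columns sumn_takeS eqxx andbT /=.
by apply/forallP => i; rewrite !ffunE /=; lia.
Qed.

Lemma vcount_conjp l : is_part l -> 0 < vcount (rev (conjp (shape_seq l))) l.
Proof.
move=> lp; have := vcount_left_columns lp (leqnn _); rewrite take_size.
rewrite (_ : left_columns _ l = l) //; apply/ffunP => i; apply: val_inj; rewrite ffunE /= size_mkseq.
apply/minn_idPr; case: (posnP (l i)) => [->//|li]; apply: leq_foldr_max.
by rewrite mem_filter li; apply/mapP; exists i; rewrite ?mem_enum.
Qed.
End ShapeRows.

(** * Schur expansion *)

Lemma sum_eq1_witness (I : finType) (P : pred I) (F : I -> nat) :
  \sum_(i | P i) F i = 1 -> exists2 i, P i & F i = 1.
Proof.
move=> S1; have [i Pi Fi] : exists2 i, P i & F i != 0.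
  apply/exists_inP; apply: contraPT S1 => /exists_inPn H.
  by rewrite big1 // => i Pi; apply/eqP; have := H i Pi; rewrite negbK.
by exists i => //; move: S1; rewrite (bigD1 i) //=; lia.
Qed.

Section SchurExpansion.
Variables (d b : nat) (mu : seq nat).
Local Notation shape := {ffun 'I_d.+1 -> 'I_b.+1}.
Variables (c : shape -> nat) (coef : seq nat -> nat).
Local Notation P l := (is_part l && (weight l == d)).
Hypothesis mu_part : is_partition mu.
Hypothesis sumn_mu : sumn mu = d.
Hypothesis c_rows : forall l, P l -> c l != 0 ->
  forall t, sumn (take t (shape_seq l)) <= sumn (take t mu).
Hypothesis c_columns : forall l, P l -> c l != 0 ->
  forall t, \sum_(p <- shape_seq l) minn t p <= sumn (take t mu).
Hypothesis c_hcount : \sum_(l | P l) c l * hcount (rev mu) l = 1.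
Hypothesis c_vcount : \sum_(l | P l) c l * vcount (rev mu) l = 1.
Hypothesis coefE : forall al, coef al = \sum_(l | P l) c l * schur_coeff (shape_seq l) al.

Lemma shape_between l : P l -> c l != 0 -> dom_le (conjp mu) (shape_seq l) /\ dom_le (shape_seq l) mu.
Proof.
move=> lP cl; have /andP[lp /eqP lw] := lP; have /andP[ls _] := shape_partition lp.
rewrite /dom_le sumn_conjp sumn_shape lw sumn_mu; split; split=> // t; last exact: c_rows.
rewrite sumn_take_conjp; apply: dominance_conj => // [|a]; first by rewrite sumn_shape lw.
exact: c_columns.
Qed.

Lemma dom_le_anti la nu' : is_partition la -> is_partition nu' -> dom_le la nu' -> dom_le nu' la -> la = nu'.
Proof.
move=> /andP[_ la0] /andP[_ n0] [_ h1] [_ h2]; apply: partial_sums_inj => // t.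
by apply/eqP; rewrite eqn_leq h1 h2.
Qed.

(** A sum of naturals equal to 1 has a term c l * hcount equal to 1. Its shape dominates mu by
    [hcount_bound] and is dominated by mu through [c_rows]. *)
Lemma top_shape : exists l, [/\ P l, c l = 1 & shape_seq l = mu].
Proof.
have [l lP /eqP] := sum_eq1_witness c_hcount; rewrite muln_eq1 => /andP[/eqP cl /eqP hl].
have /andP[lp _] := lP; exists l; split=> //.
have [_ la0] := andP (shape_partition lp); have [_ m0] := andP mu_part.
apply: partial_sums_inj => // t; apply/eqP; rewrite eqn_leq c_rows ?cl //=.
by rewrite take_shape // -{1}[mu]revK; have [|_ ->//] := @hcount_bound _ _ (rev mu) l; rewrite hl.
Qed.

Lemma bottom_shape : exists l, [/\ P l, c l = 1 & shape_seq l = conjp mu].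
Proof.
have [l lP /eqP] := sum_eq1_witness c_vcount; rewrite muln_eq1 => /andP[/eqP cl /eqP hl].
have /andP[lp _] := lP; exists l; split=> //.
rewrite -[LHS]conjpK ?shape_partition //; congr conjp.
have [_ la0] := andP (conjp_partition (shape_seq l)); have [_ m0] := andP mu_part.
apply: partial_sums_inj => // t; rewrite sumn_take_conjp; apply/eqP; rewrite eqn_leq c_columns ?cl //=.
rewrite shape_sum ?minn0 // -{1}[mu]revK; have [|_ ->//] := @vcount_bound _ _ (rev mu) l; by rewrite hl.
Qed.

Lemma schur_positive_expansion :
  dom_le (conjp mu) mu /\
  (conjp mu = mu -> forall al, coef al = schur_coeff mu al) /\
  (conjp mu <> mu ->
     exists (L : seq (seq nat)) (c : seq nat -> nat),
       (forall la, la \in L ->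
          [/\ is_partition la, dom_lt (conjp mu) la & dom_lt la mu]) /\
       forall al, coef al =
         (schur_coeff (conjp mu) al + schur_coeff mu al
          + \sum_(la <- L) c la * schur_coeff la al)%N).
Proof.
have [l1 [l1P c1 s1]] := top_shape; have [l2 [l2P c2 s2]] := bottom_shape.
have [l1p _] := andP l1P; have [l2p _] := andP l2P.
split; first by have := shape_between l2P; rewrite c2 s2 => /(_ isT) [].
split=> [E al|NE].
  rewrite coefE (bigD1 l1) //= big1 ?addn0 ?c1 ?mul1n ?s1 // => l /andP[lP ll1].
  have [->//|cl] := eqVneq (c l) 0; have [b1 b2] := shape_between lP cl; have [lp _] := andP lP.
  move: ll1; rewrite (shape_seq_inj lp l1p) ?eqxx // s1.
  by apply: dom_le_anti; rewrite ?shape_partition // -E.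
have l12 : l2 != l1 by apply: contra_not_neq NE => E; rewrite -s2 E.
pose Q l := [&& P l, l != l1, l != l2 & c l != 0].
exists [seq shape_seq l | l in Q].
(* The coefficient has to be a function of the partition; by [shape_seq_inj] this sum has a single
   term on the list. *)
exists (fun la => \sum_(l | is_part l && (shape_seq l == la)) c l); split=> [la /imageP[l /and4P[lP ll1 ll2 cl] ->]|al].
  have [lp _] := andP lP; have [b1 b2] := shape_between lP cl; split; first exact: shape_partition.
    by split=> // E; rewrite (shape_seq_inj lp l2p) ?eqxx // s2 in ll2.
  by split=> // E; rewrite (shape_seq_inj lp l1p) ?eqxx // s1 in ll1.
rewrite coefE (bigD1 l1) //= (bigD1 l2) /=; last by rewrite l2P l12.
rewrite c1 c2 !mul1n s1 s2 addnA [in RHS](addnC (schur_coeff (conjp mu) al)); congr (_ + _).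
rewrite (bigID (fun l => c l != 0)) /= addnC big1 ?add0n; last first.
  by move=> l /andP[_ /negPn/eqP ->].
rewrite big_map big_enum; apply: eq_big => [l|l /andP[/andP[/andP[/andP[lp _] _] _] _]].
  by rewrite unfold_in /Q !andbA.
congr (_ * _); rewrite (big_pred1 l) // => l' /=; apply/andP/eqP => [[l'p /eqP]|->]; last by rewrite lp eqxx.
exact: shape_seq_inj.
Qed.
End SchurExpansion.

Lemma fpf_code_out z (N i : nat) : involutive z ->
  (forall i : int, ((i <= 0) || (N%:Z < i))%R -> z i = Theta i) -> N < i -> fpf_code z i%:Z = 0.
Proof.
move=> zK z_out iN; apply: (fcard_eq (s := [::])) => // j; split=> // -[j0 ji iz jz].
have jN : ~ (N%:Z < j)%R.
  by move=> jN; move: iz; rewrite z_out ?jN ?orbT //; case: (Theta_pm j) => E; have := ThetaK j; rewrite E; lia.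
have := zK j; rewrite (z_out (z j)); last by lia.
by case: (Theta_pm (z j)) => ->; lia.
Qed.

(** [code_bound] is some bound picked by [epsilon]; zero codes add nothing, so every bound gives the
    same sums. *)
Lemma sumn_take_nu z N t : (forall i : nat, N < i -> fpf_code z i%:Z = 0) ->
  sumn (take t (nu z)) = \sum_(1 <= i < N.+1) minn t (fpf_code z i%:Z).
Proof.
move=> zN; rewrite /nu sumn_take_conjp (perm_big _ (permEl (perm_sort _ _))) /= big_filter big_map big_mkcond /=.
have bound : forall i : nat, code_bound z < i -> fpf_code z i%:Z = 0.
  by rewrite /code_bound; set Q := fun _ => _; apply: (epsilon_spec (inhabits 0) Q); exists N.
pose F i := minn t (fpf_code z i%:Z).
have ext n m : (forall i : nat, n < i -> fpf_code z i%:Z = 0) -> n <= m ->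
    \sum_(1 <= i < n.+1) F i = \sum_(1 <= i < m.+1) F i.
  move=> nz nm; rewrite [RHS](@big_cat_nat _ _ _ n.+1) //= -[LHS]addn0; congr (_ + _).
  by rewrite big_nat big1 // => i ni; rewrite /F nz ?minn0 //; lia.
transitivity (\sum_(1 <= i < (code_bound z).+1) F i).
  rewrite /index_iota subn1; apply: eq_bigr => i _.
  by rewrite /F; case: posnP => [->|]; rewrite ?minn0.
by rewrite (ext _ (maxn N (code_bound z)) bound) ?leq_maxr // -(ext _ _ zN) ?leq_maxl.
Qed.

Lemma prod_rev (A : nzRingType) (F : nat -> A) s : (forall r r', GRing.comm (F r) (F r')) ->
  (\prod_(r <- rev s) F r = \prod_(r <- s) F r)%R.
Proof.
move=> FC; elim: s => [|r s IH]; first by rewrite !big_nil.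
rewrite rev_cons -cats1 big_cat big_seq1 big_cons /= IH.
by apply: commr_sym; apply: commr_prod.
Qed.

Theorem theorem3p30 (z : int -> int) (hz : in_Finf z) :
  dom_le (conjp (nu z)) (nu z) /\
  (conjp (nu z) = nu z -> forall al, hatF_coeff z al = schur_coeff (nu z) al) /\
  (conjp (nu z) <> nu z ->
     exists (L : seq (seq nat)) (c : seq nat -> nat),
       (forall la, la \in L ->
          [/\ is_partition la, dom_lt (conjp (nu z)) la & dom_lt la (nu z)]) /\
       forall al, hatF_coeff z al =
         (schur_coeff (conjp (nu z)) al + schur_coeff (nu z) al
          + \sum_(la <- L) c la * schur_coeff la al)%N).
Proof.
have [w0 [[w0S w0neg] w0z]] := hz; have [w0b [K w0K]] := w0S.
(* The size 2K + 2 is even, so Theta preserves the window, and the letters 0, ..., 2K end with an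
   even one, as [phi_hh] requires. *)
have z_out (i : int) : ((i <= 0) || (K.*2.+2%:Z < i))%R -> z i = Theta i.
  move=> io; apply: (bij_inj w0b); rewrite w0z.
  have [i0|iN] : (i <= 0)%R \/ (K.*2.+2%:Z < i)%R by lia.
    rewrite (w0neg i i0) w0neg //; case: (Theta_pm i) (Theta_odd i) => -> H; last by lia.
    have {}H : odd `|i| by apply/H.
    have : i <> 0%R by move=> E; rewrite E in H.
    by lia.
  rewrite (w0K i); last by lia.
  by rewrite w0K //; case: (Theta_pm i) => ->; lia.
pose zK : involutive z := fpf_conj_involutive w0S w0z.
pose C := K.*2.+1; pose u := fpf_u K; pose W : {additive _ -> int} := fpf_entry w0S w0z z_out.
(* [d] is shown below to be the length of the atoms, and [b] is the least bound satisfying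
   [bbig]. *)
pose d := sumn (nu z); pose b := (C + d).+1; have bbig : C + d < b by exact: ltnSn.
have uq := @fpf_u_sq K; have uf := @fpf_u_far K; have ub := @fpf_u_braid K.
pose S (l : {ffun 'I_d.+1 -> 'I_b.+1}) := schur uq uf ub C l.
pose c l := `|W (S l)|.
have nu_part : is_partition (nu z) by exact: conjp_partition.
have nuE t : sumn (take t (nu z)) = code_cap K z t by apply: sumn_take_nu => i; exact: fpf_code_out.
have W_schur l : is_part l -> W (S l) = (c l)%:Z.
  move=> lp; rewrite /c; apply/esym/gez0_abs.
  have := @Pos_schur _ _ uq uf ub C d b bbig (@nonneg_mx _); apply=> //.
  - exact: nonneg0.
  - exact: nonneg1.
  - exact: nonnegD.
  - exact: nonnegM.
  - exact: nonneg_umx.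
have W_h s : sumn s <= d -> W (\prod_(r <- s) hh u C r%:Z)%R = (\sum_(l | is_part l) c l * hcount s l)%N%:Z.
  move=> sd; rewrite (h_expansion uq uf ub bbig sd) (raddf_sum W) (big_morph Posz PoszD erefl).
  by apply: eq_bigr => l lp; rewrite raddfMn W_schur // -mulr_natr natz PoszM.
have W_e s : sumn s <= d -> W (\prod_(r <- s) ee u C r%:Z)%R = (\sum_(l | is_part l) c l * vcount s l)%N%:Z.
  move=> sd; rewrite (e_expansion uq uf ub bbig sd) (raddf_sum W) (big_morph Posz PoszD erefl).
  by apply: eq_bigr => l lp; rewrite raddfMn W_schur // -mulr_natr natz PoszM.
have hC s : (\prod_(r <- rev s) hh u C r%:Z = \prod_(r <- s) hh u C r%:Z)%R.
  by apply: prod_rev => r r'; exact: hhC.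
have W_he s : W (\prod_(r <- s) hh u C r%:Z)%R = W (\prod_(r <- s) ee u C r%:Z)%R.
  by rewrite -hC [LHS]fpf_entry_hh_ee revK.
have W_top : W (\prod_(r <- rev (nu z)) ee u C r%:Z)%R = 1%R.
  apply: fpf_entry_ee_top => [|t]; last by rewrite revK.
  by rewrite all_rev; case/andP: nu_part.
(* The entry for block lengths nu is 1, so some shortest word has length |nu|. *)
have dE : d = dist (zp zK z_out).
  by rewrite /d -sumn_rev; apply: (fpf_entry_ee_weight (w0S := w0S) (w0z := w0z)); rewrite [X in X != _]W_top.
have pos (F : {ffun 'I_d.+1 -> 'I_b.+1} -> nat) l : is_part l -> c l != 0 -> 0 < F l -> \sum_(l | is_part l) c l * F l != 0.
  by move=> lp cl Fl; rewrite (bigD1 l) //= addn_eq0 muln_eq0 (negPf cl) /=; lia.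
have weighted (F : {ffun 'I_d.+1 -> 'I_b.+1} -> nat) : (forall l, F l != 0 -> weight l = d) ->
    \sum_(l | is_part l) c l * F l = \sum_(l | is_part l && (weight l == d)) c l * F l.
  move=> FW; rewrite big_mkcondr; apply: eq_bigr => l _; case: eqP => // wl.
  by have [->|/FW //] := eqVneq (F l) 0; rewrite muln0.
apply: (@schur_positive_expansion d b (nu z) c) => //.
(* By positivity the product of the h_r over the rows of l has a nonzero entry; so has that of the
   e_r, which means increasing blocks with the rows as lengths. *)
- move=> l /andP[lp /eqP lw] cl t; rewrite nuE take_shape // -{1}[rows l]revK.
  apply: (fpf_entry_ee_bound (w0S := w0S) (w0z := w0z) (z_out := z_out)); rewrite -[X in X != _]W_he W_h.
    by rewrite eqz_nat (pos (hcount _) l) // hcount_rows.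
  by rewrite sumn_rev sumn_rows lw.
(* The columns of l are block lengths directly, through the expansion of products of the e_r. *)
- move=> l /andP[lp /eqP lw] cl t; rewrite nuE -sumn_take_conjp -{1}[conjp _]revK.
  apply: (fpf_entry_ee_bound (w0S := w0S) (w0z := w0z) (z_out := z_out)); rewrite [X in X != _]W_e.
    by rewrite eqz_nat (pos (vcount _) l) // vcount_conjp.
  by rewrite sumn_rev sumn_conjp sumn_shape lw.
- rewrite -weighted => [|l /hcount_weight ->]; last by rewrite sumn_rev.
  by apply/eqP; rewrite -eqz_nat -W_h ?sumn_rev // W_he W_top.
- rewrite -weighted => [|l /vcount_weight ->]; last by rewrite sumn_rev.
  by apply/eqP; rewrite -eqz_nat -W_e ?sumn_rev // W_top.
move=> al; under eq_bigr => l /andP[lp _] do rewrite schur_coeff_hcount //.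
have [ad|nad] := eqVneq (sumn al) d.
  rewrite -weighted => [|l /hcount_weight ->]; last by rewrite sumn_rev.
  by apply/eqP; rewrite -eqz_nat -W_h ?sumn_rev ?ad // hC eq_sym; apply/eqP; exact: fpf_entry_hh.
(* In any degree other than d both sides are 0. *)
rewrite big1 => [|l /andP[_ /eqP lw]]; last first.
  have [->|/hcount_weight] := eqVneq (hcount (rev al) l) 0; first by rewrite muln0.
  by rewrite lw sumn_rev => E; rewrite E eqxx in nad.
apply/eqP; rewrite -eqz_nat -(fpf_entry_hh w0S w0z z_out) fpf_entry_hh_ee.
apply: contraNT nad => /fpf_entry_ee_weight; rewrite sumn_rev => ->; exact/eqP.
Qed.
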